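(* Let $(R,\mathfrak m,k)$ be a Cohen-Macaulay local ring that is not Gorenstein, with dualizing module $\omega$. Let $f:R\to S$ be a flat local ring homomorphism such that $S/\mathfrak mS$ is not Gorenstein. Assume that $x,y\in S$ form a pair of exact zero-divisors on $S$ such that the flat dimension $\operatorname{fd}_R(S/xS)$ is finite. Then $S\otimes_R\omega$ is a semidualizing $S$-module which is not a dualizing $S$-module, and $\operatorname{pd}_S(S\otimes_R\omega)=\infty$. Moreover, $x,y$ form a pair of exact zero-divisors on $S\otimes_R\omega$.
   Context: All rings are commutative noetherian with identity (in particular $R$ and $S$; both are local here). ''Finite module'' means finitely generated module. A finite module $B$ over a ring $A$ is semidualizing if the natural homothety map $A\to\operatorname{Hom}_A(B,B)$ is an isomorphism and $\operatorname{Ext}^i_A(B,B)=0$ for all $i>0$. A dualizing module is a semidualizing module of finite injective dimension. For a ring $A$, an $A$-module $M$ and $x,y\in A$, one says that $x,y$ form a pair of exact zero-divisors on $M$ if $xM\neq 0$, $xM\neq M$ and the sequence of multiplication maps $M\xrightarrow{x}M\xrightarrow{y}M\xrightarrow{x}M$ is exact. $\operatorname{fd}$ and $\operatorname{pd}$ denote flat and projective dimension. *)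

(* Defs.v *)
From HB Require Import structures.
From mathcomp Require Import all_boot all_order all_algebra.
From mathcomp Require Import boolp classical_sets.
From mathcomp Require Import freeg.

Set Implicit Arguments.
Unset Strict Implicit.
Unset Printing Implicit Defensive.

Import GRing.Theory.
Local Open Scope classical_set_scope.
Local Open Scope ring_scope.
Local Open Scope quotient_scope.

Inductive span (A : comNzRingType) (V : lmodType A) (X : set V) : set V :=
| span_zero : span X 0
| span_step (a : A) (u v : V) : X u -> span X v -> span X (a *: u + v).

Section Span.
Context (A : comNzRingType) (V : lmodType A) (X : set V).

Lemma span_lin (a : A) (u v : V) :
  span X u -> span X v -> span X (a *: u + v).
Proof.
move=> Xu Xv; elim: Xu => [|b w t Xw _ IH]; first by rewrite scaler0 add0r.
by rewrite scalerDr scalerA -addrA; apply: span_step.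
Qed.

Lemma span_sub (u : V) : X u -> span X u.
Proof.
by move=> Xu; rewrite -[u]scale1r -[1 *: u]addr0; apply: span_step => //; left.
Qed.

Definition spanp : {pred V} := fun v => `[< span X v >].

Lemma spanpE (v : V) : (v \in spanp) = `[< span X v >]. Proof. by []. Qed.

Fact spanp_submod_closed : subsemimod_closed spanp.
Proof.
split; first split.
- by rewrite spanpE; apply/asboolP; left.
- move=> u v; rewrite !spanpE => /asboolP Xu /asboolP Xv; apply/asboolP.
  by rewrite -[u]scale1r; apply: span_lin.
- move=> a u; rewrite !spanpE => /asboolP Xu; apply/asboolP.
  by rewrite -[_ *: _]addr0; apply: span_lin => //; left.
Qed.

HB.instance Definition _ :=
  GRing.isSubmodClosed.Build A V spanp spanp_submod_closed.

(** The quotient module [V / <X>]. *)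
Definition modquot : Type := Quotient.quot spanp.
HB.instance Definition _ := GRing.Zmodule.on modquot.

Definition modpi (v : V) : modquot := \pi_(Quotient.quot spanp) v.

Lemma modpi_surj (q : modquot) : exists v, modpi v = q.
Proof. by exists (repr q); rewrite /modpi reprK. Qed.

Lemma modpiD (u v : V) : modpi (u + v) = modpi u + modpi v.
Proof. exact: raddfD. Qed.

Lemma modpi_eq (u v : V) : modpi u = modpi v <-> span X (u - v).
Proof.
split=> [/eqP|Xuv]; first by rewrite -Quotient.idealrBE spanpE => /asboolP.
by apply/eqP; rewrite -Quotient.idealrBE spanpE; apply/asboolP.
Qed.

Lemma span_repr (v : V) :
  span X (repr (modpi v : Quotient.quot spanp) - v).
Proof. by apply/modpi_eq; rewrite /modpi reprK. Qed.

Definition modquot_scale (a : A) (q : modquot) : modquot :=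
  modpi (a *: repr (q : Quotient.quot spanp)).

Lemma modpiZ (a : A) (v : V) : modquot_scale a (modpi v) = modpi (a *: v).
Proof.
apply/modpi_eq; rewrite -scalerBr -[_ *: _]addr0.
by apply: span_lin; [exact: span_repr | left].
Qed.

Fact modquot_scaleA (a b : A) (q : modquot) :
  modquot_scale a (modquot_scale b q) = modquot_scale (a * b) q.
Proof. by have [v <-] := modpi_surj q; rewrite !modpiZ scalerA. Qed.

Fact modquot_scale1 : left_id 1 modquot_scale.
Proof. by move=> q; have [v <-] := modpi_surj q; rewrite modpiZ scale1r. Qed.

Fact modquot_scaleDr : right_distributive modquot_scale +%R.
Proof.
move=> a p q; have [u <-] := modpi_surj p; have [v <-] := modpi_surj q.
by rewrite -modpiD !modpiZ scalerDr modpiD.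
Qed.

Fact modquot_scaleDl (q : modquot) :
  {morph (fun a : A => modquot_scale a q) : a b / a + b}.
Proof.
by move=> a b /=; have [v <-] := modpi_surj q; rewrite !modpiZ scalerDl modpiD.
Qed.

HB.instance Definition _ := GRing.Zmodule_isLmodule.Build A modquot
  modquot_scaleA modquot_scale1 modquot_scaleDr modquot_scaleDl.

Fact modpi_semilinear : semilinear modpi.
Proof. by split=> [a v|u v]; rewrite ?modpiD // -modpiZ. Qed.

HB.instance Definition _ :=
  GRing.isSemilinear.Build A V modquot _ modpi modpi_semilinear.

Section Lift.
Context (U : lmodType A) (h : {linear V -> U}) (hX : forall v, X v -> h v = 0).

Definition modlift_fun (q : modquot) : U := h (repr (q : Quotient.quot spanp)).

Lemma modlift_funE (v : V) : modlift_fun (modpi v) = h v.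
Proof.
apply/eqP; rewrite -subr_eq0 -linearB; apply/eqP.
elim: (span_repr v) => [|a u w Xu _ IH]; first exact: linear0.
by rewrite linearD linearZ_LR /= hX // IH scaler0 addr0.
Qed.

Fact modlift_semilinear : semilinear modlift_fun.
Proof.
split=> [a q|p q]; have [v <-] := modpi_surj q.
  by rewrite -linearZ_LR !modlift_funE linearZ_LR.
by have [u <-] := modpi_surj p; rewrite -linearD !modlift_funE linearD.
Qed.

Definition modlift : {linear modquot -> U} :=
  HB.pack modlift_fun
    (GRing.isSemilinear.Build A modquot U _ modlift_fun modlift_semilinear).

Lemma modliftE (v : V) : modlift (modpi v) = h v.
Proof. exact: modlift_funE. Qed.

End Lift.
End Span.

Definition is_ideal (A : comNzRingType) (I : set A) : Prop :=
  I 0 /\ forall a u v : A, I u -> I v -> I (a * u + v).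

Definition ideal_gen (A : comNzRingType) (X : set A) : set A :=
  @span A A^o X.

Definition restr (R S : comNzRingType) (f : {rmorphism R -> S})
  (M : lmodType S) : Type := M.

Section Restriction.
Context (R S : comNzRingType) (f : {rmorphism R -> S}) (M : lmodType S).

HB.instance Definition _ := GRing.Zmodule.on (restr f M).

Definition restr_scale (r : R) (u : restr f M) : restr f M := f r *: (u : M).

Fact restr_scaleA (a b : R) (u : restr f M) :
  restr_scale a (restr_scale b u) = restr_scale (a * b) u.
Proof. by rewrite /restr_scale scalerA rmorphM. Qed.

Fact restr_scale1 : left_id 1 restr_scale.
Proof. by move=> u; rewrite /restr_scale rmorph1 scale1r. Qed.

Fact restr_scaleDr : right_distributive restr_scale +%R.
Proof. by move=> a u v; rewrite /restr_scale scalerDr. Qed.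

Fact restr_scaleDl (u : restr f M) :
  {morph (fun a : R => restr_scale a u) : a b / a + b}.
Proof. by move=> a b; rewrite /restr_scale rmorphD scalerDl. Qed.

HB.instance Definition _ := GRing.Zmodule_isLmodule.Build R (restr f M)
  restr_scaleA restr_scale1 restr_scaleDr restr_scaleDl.

End Restriction.

Section Tensor.
Context (R S : comNzRingType) (f : {rmorphism R -> S}).

Section Construction.
Context (N : lmodType S) (M : lmodType R).

Definition fgen (n : N) (m : M) : {freeg (N * M)%type / S} := << (n, m) >>.

Inductive tens_rel : set {freeg (N * M)%type / S} :=
| tens_relDl n n' m : tens_rel (fgen (n + n') m - (fgen n m + fgen n' m))
| tens_relDr n m m' : tens_rel (fgen n (m + m') - (fgen n m + fgen n m'))
| tens_relZl s n m : tens_rel (fgen (s *: n) m - s *: fgen n m)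
| tens_relZr r n m : tens_rel (fgen (f r *: n) m - fgen n (r *: m)).

(** For an [S]-module [N] and an [R]-module [M], this is the tensor product of
    [N] and [M] over [R] with the [S]-module structure of [N]; [f = idfun] gives
    the tensor product of two [R]-modules, and [N = S^o] gives base change. *)
Definition tens : lmodType S := modquot tens_rel.

Definition tpair (n : N) (m : M) : tens := modpi tens_rel (fgen n m).

Definition balanced (P : lmodType S) (b : N -> M -> P) : Prop :=
  [/\ forall n n' m, b (n + n') m = b n m + b n' m,
      forall n m m', b n (m + m') = b n m + b n m',
      forall s n m, b (s *: n) m = s *: b n m &
      forall r n m, b (f r *: n) m = b n (r *: m)].

Lemma tpair_balanced : balanced tpair.
Proof.
rewrite /tpair; split=> *; rewrite -?linearD -?linearZ_LR;
  apply/modpi_eq/span_sub; by constructor.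
Qed.

Section Universal.
Context (P : lmodType S) (b : N -> M -> P) (hb : balanced b).

Definition freeg_lift : {freeg (N * M)%type / S} -> P :=
  fglift (fun p : N * M => b p.1 p.2).

Lemma freeg_liftU k n m : freeg_lift << k *g (n, m) >> = k *: b n m.
Proof. exact: liftU. Qed.

Fact freeg_lift_semilinear : semilinear freeg_lift.
Proof.
have liftB u v : freeg_lift (u - v) = freeg_lift u - freeg_lift v.
  exact: (lift_is_additive (fun p : N * M => b p.1 p.2)).
have lift0 : freeg_lift 0 = 0.
  by have := liftB 0 0; rewrite !subrr.
have liftD u v : freeg_lift (u + v) = freeg_lift u + freeg_lift v.
  by rewrite -{1}[v]opprK liftB -[- v]sub0r liftB lift0 sub0r opprK.
split=> // c D; rewrite [c *: D]/(fgscale c D) /fgscale -[in RHS](freeg_sumE D).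
have lift_sum (I : Type) (s : seq I) F : freeg_lift (\sum_(i <- s) F i) =
    \sum_(i <- s) freeg_lift (F i) by exact: (big_morph _ liftD lift0).
rewrite !lift_sum scaler_sumr; apply: eq_bigr => -[n m] _.
by rewrite !freeg_liftU scalerA.
Qed.

HB.instance Definition _ :=
  GRing.isSemilinear.Build S _ P _ freeg_lift freeg_lift_semilinear.

Lemma freeg_lift_rel v : tens_rel v -> freeg_lift v = 0.
Proof.
have liftU1 n m : freeg_lift (fgen n m) = b n m.
  by rewrite freeg_liftU scale1r.
have [bDl bDr bZl bZr] := hb.
by case=> *; rewrite linearB; apply/eqP; rewrite subr_eq0; apply/eqP;
  rewrite ?linearD ?linearZ_LR /= !liftU1 ?bZr ?(bDl, bDr, bZl).
Qed.

Definition tens_lift : {linear tens -> P} := modlift freeg_lift_rel.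

Lemma tens_liftE n m : tens_lift (tpair n m) = b n m.
Proof. by rewrite [LHS]modliftE -[RHS]scale1r; exact: freeg_liftU. Qed.

End Universal.

Lemma tens_ext (P : lmodType S) (g h : {linear tens -> P}) :
  (forall n m, g (tpair n m) = h (tpair n m)) -> g =1 h.
Proof.
move=> gh t; have [D <-] := modpi_surj t.
rewrite -(freeg_sumE D) !linear_sum; apply: eq_bigr => -[n m] _ /=.
have -> : << coeff (n, m) D *g (n, m) >> = coeff (n, m) D *: fgen n m.
  by apply/eqP/freeg_eqP => p; rewrite coeffZ !coeffU mul1r.
by rewrite !linearZ_LR /= gh.
Qed.

End Construction.

Section Functoriality.
Context (N : lmodType S) (M M' : lmodType R) (g : {linear M -> M'}).

Fact tens_map_balanced : balanced (fun (n : N) m => tpair n (g m)).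
Proof.
have [tDl tDr tZl tZr] := tpair_balanced N M'.
by split=> *; rewrite ?linearD ?linearZ_LR.
Qed.

Definition tens_map : {linear tens N M -> tens N M'} :=
  tens_lift tens_map_balanced.

Lemma tens_mapE (n : N) (m : M) : tens_map (tpair n m) = tpair n (g m).
Proof. exact: tens_liftE. Qed.

End Functoriality.
End Tensor.

Section Homological.
Context (A : comNzRingType).
Implicit Types M N E F P : lmodType A.

Definition exact_at (U V W : lmodType A) (g : U -> V) (h : V -> W) : Prop :=
  forall v, h v = 0 <-> exists u, g u = v.

Definition surj (T U : Type) (g : T -> U) : Prop := forall u, exists t, g t = u.

Definition flat M : Prop :=
  forall (N N' : lmodType A) (g : {linear N -> N'}),
    injective g -> injective (tens_map idfun M g).

Definition projective P : Prop :=
  forall (M N : lmodType A) (p : {linear M -> N}) (g : {linear P -> N}),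
    surj p -> exists h : {linear P -> M}, forall u, p (h u) = g u.

Definition injective_module E : Prop :=
  forall (M N : lmodType A) (i : {linear M -> N}) (g : {linear M -> E}),
    injective i -> exists h : {linear N -> E}, forall u, h (i u) = g u.

Record resolution (Q : lmodType A -> Prop) M := Resolution {
  rterm :> nat -> lmodType A;
  rdiff : forall n, {linear rterm n.+1 -> rterm n};
  raug : {linear rterm 0 -> M};
  _ : forall n, Q (rterm n);
  _ : surj raug;
  _ : exact_at (rdiff 0) raug;
  _ : forall n, exact_at (rdiff n.+1) (rdiff n)
}.

Record coresolution (Q : lmodType A -> Prop) M := Coresolution {
  cterm :> nat -> lmodType A;
  cdiff : forall n, {linear cterm n -> cterm n.+1};
  caug : {linear M -> cterm 0};
  _ : forall n, Q (cterm n);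
  _ : injective caug;
  _ : exact_at caug (cdiff 0);
  _ : forall n, exact_at (cdiff n) (cdiff n.+1)
}.

Definition vanishes_above (F : nat -> lmodType A) (n : nat) : Prop :=
  forall i, (n < i)%N -> forall u : F i, u = 0.

Definition fd_le (n : nat) M : Prop :=
  exists F : resolution flat M, vanishes_above F n.
Definition pd_le (n : nat) M : Prop :=
  exists P : resolution projective M, vanishes_above P n.
Definition id_le (n : nat) M : Prop :=
  exists E : coresolution injective_module M, vanishes_above E n.

Definition fd_finite M : Prop := exists n, fd_le n M.
Definition pd_finite M : Prop := exists n, pd_le n M.
Definition id_finite M : Prop := exists n, id_le n M.

Definition Hom_cocycle M N (P : resolution projective M) (i : nat)
    (phi : {linear P i -> N}) : Prop :=
  forall u, phi (rdiff P i u) = 0.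

Definition Hom_coboundary M N (P : resolution projective M) (i : nat) :
    {linear P i -> N} -> Prop :=
  match i with
  | 0 => fun phi => forall u, phi u = 0
  | j.+1 => fun phi =>
      exists psi : {linear P j -> N}, forall u, phi u = psi (rdiff P j u)
  end.

(** [Ext^i(M, N) = 0], where [Ext] is the cohomology of [Hom(P, N)] for a
    projective resolution [P] of [M]; the choice of [P] is immaterial. *)
Definition Ext_zero (i : nat) M N : Prop :=
  exists P : resolution projective M,
    forall phi : {linear P i -> N}, Hom_cocycle phi -> Hom_coboundary phi.

Definition finite_module M : Prop :=
  exists s : seq M, forall u, span [set v | v \in s] u.

Definition homothety M (a : A) : {linear M -> M} := *:%R a.

Definition homothety_iso M : Prop :=
  forall phi : {linear M -> M}, exists! a : A, phi =1 homothety M a.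

Definition semidualizing M : Prop :=
  [/\ finite_module M, homothety_iso M & forall i, (0 < i)%N -> Ext_zero i M M].

Definition dualizing M : Prop := semidualizing M /\ id_finite M.

Definition exact_zero_divisors M (x y : A) : Prop :=
  [/\ exists u : M, x *: u <> 0,
      exists u : M, forall v : M, x *: v <> u,
      exact_at (homothety M x) (homothety M y) &
      exact_at (homothety M y) (homothety M x)].

Definition noetherian : Prop :=
  forall I : set A, is_ideal I ->
    exists s : seq A, ideal_gen [set a | a \in s] = I.

Definition maximal_ideal (m : set A) : Prop :=
  [/\ is_ideal m, ~ m 1 &
      forall J : set A, is_ideal J -> ~ J 1 -> m `<=` J -> J = m].

(** [A] is a noetherian local ring with maximal ideal [m]. *)
Definition local_ring (m : set A) : Prop :=
  [/\ noetherian, maximal_ideal m & forall J, maximal_ideal J -> J = m].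

Definition prime_ideal (p : set A) : Prop :=
  [/\ is_ideal p, ~ p 1 & forall a b, p (a * b) -> p a \/ p b].

Definition prime_chain (n : nat) : Prop :=
  exists p : nat -> set A,
    (forall i, (i <= n)%N -> prime_ideal (p i)) /\
    (forall i, (i < n)%N -> p i `<` p i.+1).

Definition seq_ideal (s : seq A) : set A := ideal_gen [set a | a \in s].

Definition regular_seq (s : seq A) : Prop :=
  ~ seq_ideal s 1 /\
  forall i, (i < size s)%N -> forall a,
    seq_ideal (take i s) (s`_i * a) -> seq_ideal (take i s) a.

Definition regular_length (m : set A) (n : nat) : Prop :=
  exists s : seq A,
    [/\ size s = n, forall a, a \in s -> m a & regular_seq s].

Definition is_greatest (Q : nat -> Prop) (n : nat) : Prop :=
  Q n /\ forall k, Q k -> (k <= n)%N.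

Definition krull_dim (d : nat) : Prop := is_greatest prime_chain d.
Definition depth (m : set A) (d : nat) : Prop :=
  is_greatest (regular_length m) d.

(** Meant for a local ring with maximal ideal [m]. *)
Definition cohen_macaulay (m : set A) : Prop :=
  exists d, krull_dim d /\ depth m d.

(** Finite self-injective dimension; meant for a noetherian local ring. *)
Definition gorenstein : Prop := id_finite (A^o : lmodType A).

End Homological.

Arguments noetherian : clear implicits.
Arguments gorenstein : clear implicits.

Section ClosedFibre.
Context (R S : comNzRingType) (m : set R) (n : set S) (f : {rmorphism R -> S}).
Context (hS : local_ring n) (hf : forall a, m a -> n (f a)).

Definition fibre_ideal : {pred S} := fun s => `[< ideal_gen (f @` m) s >].

Fact fibre_ideal_closed : idealr_closed fibre_ideal.
Proof.
have inE s : (s \in fibre_ideal) = `[< ideal_gen (f @` m) s >] by [].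
split.
- by rewrite inE; apply/asboolP; left.
- rewrite inE; apply/asboolP; case: hS => _ [[n0 nD] n1 _] _ h1; apply: n1.
  by elim: h1 => [//|a u v [r mr <-] _ IH]; apply: nD => //; apply: hf.
- move=> a u v; rewrite !inE => /asboolP hu /asboolP hv; apply/asboolP.
  exact: (span_lin a hu hv).
Qed.

HB.instance Definition _ := isIdealr.Build S fibre_ideal fibre_ideal_closed.

Definition closed_fibre : comNzRingType := {ideal_quot fibre_ideal}.

End ClosedFibre.

(* Main.v *)
(** Write [N] for [S (x) omega].  A homogeneous linear system over [R] has, after
    the flat base change to [S], only the solutions spanned by the old ones.
    Applied to a resolution of [omega] by finite free modules this makes [N]
    semidualizing.

    If [pd_S N] is finite, the base change of the minimal free resolution of
    [omega] is minimal, hence bounded; as [Ext^i(omega, omega) = 0] for [i > 0], a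
    last nonzero term in positive degree would contradict Nakayama, so [omega] is
    free and [R], a summand of it, has finite injective dimension.

    If [id_S N] is finite, let [E] be a bounded injective coresolution of [N] and
    [J] the subcomplex killed by [m S], a complex of injectives over the closed
    fibre [Q].  Its cohomology [Ext_S^i(S/mS, N)] is the base change of
    [Ext_R^i(R/m, omega)], so it is free over [Q], and it is not always zero.
    Each cocycle module of [J] is then the sum of the coboundaries and a free
    module; descending along [J] every cocycle module has finite injective
    dimension, hence so does its summand [Q].

    Finally [S/xS] has the free resolution [... -y-> S -x-> S], flat over [R], so
    that [Tor^R_i(S/xS, omega)], [i > 0], is 2-periodic.  It vanishes for large
    [i], hence for all [i > 0], which says that [x, y] stay exact on [N]. *)
Require Import Defs.
From HB Require Import structures.
From mathcomp Require Import all_boot all_order all_algebra.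
From mathcomp Require Import boolp classical_sets.

Set Implicit Arguments.
Unset Strict Implicit.
Unset Printing Implicit Defensive.

Import GRing.Theory.
Local Open Scope classical_set_scope.
Local Open Scope ring_scope.

Local Notation span := Defs.span.

(** * Submodules, finite generation and local rings *)

(** No [Ext] or [Tor] module is ever formed. In the injective-dimension argument a cohomology module
    is a pair of subsets, cocycles [Z] and coboundaries [B], studied through congruences modulo [B].
    For a free resolution these are governed by linear systems, which flat base change controls. The
    terms of an injective coresolution need be neither finite nor compatible with base change, so a
    double complex has to carry finiteness, freeness and vanishing between the two sides. Freeness
    over the closed fibre originates in [Ext_R^i(R/m, omega)] being a vector space: minimal
    generators have only relations with coefficients in [m], hence after base change only relations
    with coefficients in [mS]. Nonvanishing comes from noetherian induction on the ideals [I] with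
    some [Ext^i(R/I, omega)] nonzero; [I = 0] is one of them. A flat resolution of [S/xS] may have
    infinite terms. Tor is therefore read off from finite free presentations of [omega], and a
    balance argument links these to short exact sequences in the other variable. *)

Section LinearMaps.
Context (A : comNzRingType) (U V : lmodType A) (h : U -> V).
Context (hl : forall a u v, h (a *: u + v) = a *: h u + h v).

Definition mklin : {linear U -> V} :=
  HB.pack h (GRing.isLinear.Build A U V _ h hl).

Lemma mklinE u : mklin u = h u. Proof. by []. Qed.
End LinearMaps.

Section Submodules.
Context (A : comNzRingType) (V : lmodType A).
Implicit Types Z B : set V.

Definition submodule Z := Z 0 /\ forall a u v, Z u -> Z v -> Z (a *: u + v).

Context (Z : set V) (hZ : submodule Z).

Lemma submod0 : Z 0. Proof. by case: hZ. Qed.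

Lemma submodZ a u : Z u -> Z (a *: u).
Proof. by move=> zu; rewrite -[_ *: _]addr0; apply: hZ.2 => //; apply: submod0. Qed.

Lemma submodD u v : Z u -> Z v -> Z (u + v).
Proof. by move=> zu zv; rewrite -[u]scale1r; apply: hZ.2. Qed.

Lemma submodN u : Z u -> Z (- u).
Proof. by move=> zu; rewrite -scaleN1r; apply: submodZ. Qed.

Lemma submodB u v : Z u -> Z v -> Z (u - v).
Proof. by move=> zu zv; apply: submodD => //; apply: submodN. Qed.

Lemma submod_sum (I : Type) (r : seq I) (P : pred I) (F : I -> V) :
  (forall i, P i -> Z (F i)) -> Z (\sum_(i <- r | P i) F i).
Proof. by move=> h; apply: (big_ind Z) => //; [exact: submod0 | exact: submodD]. Qed.

Lemma submod_comb n (c : 'I_n -> A) (x : 'I_n -> V) :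
  (forall j, Z (x j)) -> Z (\sum_j c j *: x j).
Proof. by move=> h; apply: submod_sum => j _; apply: submodZ. Qed.

Definition submod_pred : {pred V} := fun v => `[< Z v >].

Fact submod_pred_closed : subsemimod_closed submod_pred.
Proof.
split; first split.
- by apply/asboolP; exact: submod0.
- by move=> u v /asboolP zu /asboolP zv; apply/asboolP; exact: submodD.
- by move=> a u /asboolP zu; apply/asboolP; exact: submodZ.
Qed.

HB.instance Definition _ :=
  GRing.isSubmodClosed.Build A V submod_pred submod_pred_closed.

Record submod_type := Submod { submod_val :> V; submod_valP : submod_val \in submod_pred }.
HB.instance Definition _ := [isSub for submod_val].
HB.instance Definition _ := [Choice of submod_type by <:].
HB.instance Definition _ := [SubChoice_isSubLmodule of submod_type by <:].

Definition submod : lmodType A := submod_type.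
Definition submod_in : {linear submod -> V} := (val : submod_type -> V).

Lemma submod_inP u : Z (submod_in u).
Proof. by apply/asboolP; exact: (submod_valP u). Qed.

Lemma submod_in_inj : injective submod_in.
Proof. exact: val_inj. Qed.

Lemma submod_onto v : Z v -> exists u, submod_in u = v.
Proof. by move=> /asboolP zv; exists (Submod zv). Qed.

Lemma submod_corestrict (U : lmodType A) (h : {linear U -> V}) :
  (forall u, Z (h u)) -> exists g : {linear U -> submod}, forall u, submod_in (g u) = h u.
Proof.
move=> zh; have zh' u : h u \in submod_pred by apply/asboolP.
have gl a u v : Submod (zh' (a *: u + v)) = a *: Submod (zh' u) + Submod (zh' v) :> submod.
  by apply: submod_in_inj; rewrite [RHS]linearP /=; exact: linearP.
by exists (mklin gl).
Qed.
End Submodules.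

Section SubmoduleExamples.
Context (A : comNzRingType) (U V : lmodType A).

Lemma submodule_ker (h : {linear U -> V}) : submodule [set u | h u = 0].
Proof.
split=> [|a u v /= hu hv]; first exact: linear0.
by rewrite linearP hu hv scaler0 addr0.
Qed.

Lemma submodule_range (h : {linear U -> V}) : submodule (range h).
Proof.
split=> [|a _ _ [u _ <-] [v _ <-]]; first by exists 0 => //; exact: linear0.
by exists (a *: u + v) => //; exact: linearP.
Qed.

Lemma submodule_set0 : submodule [set (0 : V)].
Proof. by split=> [//|a u v /= -> ->]; rewrite scaler0 addr0. Qed.

Lemma submodule_span (X : set V) : submodule (span X).
Proof. by split=> [|a u v]; [left | exact: span_lin]. Qed.

Lemma span_min (X Z : set V) : submodule Z -> X `<=` Z -> span X `<=` Z.
Proof. by move=> hZ XZ u; elim=> [|a v w /XZ zv _ zw]; [exact: submod0|exact: hZ.2]. Qed.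

Lemma span_seqP (s : seq V) u : span [set v | v \in s] u ->
  exists c : 'I_(size s) -> A, u = \sum_j c j *: s`_j.
Proof.
elim=> [|a v w /= vs _ [c ->]].
  by exists (fun=> 0); rewrite big1 // => j _; rewrite scale0r.
have lt : (index v s < size s)%N by rewrite index_mem.
exists (fun j => (if j == Ordinal lt then a else 0) + c j).
rewrite [RHS](eq_bigr (fun j => (if j == Ordinal lt then a else 0) *: s`_j + c j *: s`_j));
  last by move=> j _ /=; rewrite scalerDl.
rewrite big_split /=; congr (_ + _).
rewrite (bigD1 (Ordinal lt)) //= eqxx nth_index // big1 ?addr0 //.
by move=> j /negPf ->; rewrite scale0r.
Qed.

End SubmoduleExamples.

Section LinearQuotient.
Context (A : comNzRingType) (V : lmodType A) (Z : set V) (hZ : submodule Z).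

Lemma modpi_eq0 u : modpi Z u = 0 <-> Z u.
Proof.
rewrite -(linear0 (modpi Z)) modpi_eq subr0; split; last exact: span_sub.
exact: (span_min hZ (@subset_refl _ Z)).
Qed.
End LinearQuotient.

Lemma surj_inv_lin (A : comNzRingType) (U V W : lmodType A)
    (p : {linear U -> V}) (h : {linear U -> W}) :
  surj p -> (forall u, p u = 0 -> h u = 0) ->
  exists g : {linear V -> W}, forall u, g (p u) = h u.
Proof.
move=> sp kp; pose s v := sval (cid (sp v)).
have sE v : p (s v) = v by rewrite /s; case: cid.
have E u : h (s (p u)) = h u.
  by apply/eqP; rewrite -subr_eq0 -linearB kp // linearB /= sE subrr.
have gl a u v : h (s (a *: u + v)) = a *: h (s u) + h (s v).
  by rewrite -linearP -[RHS]E linearP /= !sE.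
by exists (mklin gl).
Qed.

Lemma inj_inv_lin (A : comNzRingType) (U V W : lmodType A)
    (i : {linear V -> U}) (h : {linear W -> U}) :
  injective i -> (forall w, exists v, i v = h w) ->
  exists g : {linear W -> V}, forall w, i (g w) = h w.
Proof.
move=> ii sh; pose g w := sval (cid (sh w)).
have gE w : i (g w) = h w by rewrite /g; case: cid.
have gl a u v : g (a *: u + v) = a *: g u + g v.
  by apply: ii; rewrite linearP /= !gE linearP.
by exists (mklin gl).
Qed.

Lemma lin_inj (A : comNzRingType) (U V : lmodType A) (h : {linear U -> V}) :
  (forall u, h u = 0 -> u = 0) -> injective h.
Proof.
move=> k u v e; apply/eqP; rewrite -subr_eq0; apply/eqP/k.
by rewrite linearB /= e subrr.
Qed.

Lemma inj_lin0 (A : comNzRingType) (U V : lmodType A) (h : {linear U -> V}) :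
  injective h -> forall u, h u = 0 -> u = 0.
Proof. by move=> ih u e; apply: ih; rewrite e linear0. Qed.

(** [Hom(-, E)] is exact even at a map that is not injective: [k] descends to the range of [h] and
    extends from there. *)
Lemma injective_factor (A : comNzRingType) (E U V : lmodType A)
    (h : {linear U -> V}) (k : {linear U -> E}) :
  injective_module E -> (forall u, h u = 0 -> k u = 0) ->
  exists g : {linear V -> E}, forall u, g (h u) = k u.
Proof.
move=> injE hk; pose S := submod (submodule_range h).
have [q qE] := @submod_corestrict _ _ _ (submodule_range h) _ h (fun u => ex_intro2 _ _ u I erefl).
have sq : surj q.
  move=> v; have [u _ e] := submod_inP v; exists u.
  by apply: submod_in_inj; rewrite qE.
have kq u : q u = 0 -> k u = 0 by move=> e; apply: hk; rewrite -qE e linear0.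
have [k' k'E] := surj_inv_lin sq kq.
have [g gE] := injE _ _ (submod_in (submodule_range h)) k' (@submod_in_inj _ _ _ _).
by exists g => u; rewrite -qE gE k'E.
Qed.

(** Corestricting both maps to the range of [h] restores the surjectivity that the definition of
    projective modules asks for. *)
Lemma projective_factor (A : comNzRingType) (P U V : lmodType A)
    (h : {linear U -> V}) (k : {linear P -> V}) :
  projective P -> (forall u, exists v, h v = k u) ->
  exists l : {linear P -> U}, forall u, h (l u) = k u.
Proof.
move=> prP hk; pose S := submod (submodule_range h).
have [q qE] := @submod_corestrict _ _ _ (submodule_range h) _ h (fun u => ex_intro2 _ _ u I erefl).
have [k' k'E] := @submod_corestrict _ _ _ (submodule_range h) _ k
   (fun u => let: ex_intro x e := hk u in ex_intro2 _ _ x I e).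
have sq : surj q.
  move=> v; have [u _ e] := submod_inP v; exists u.
  by apply: submod_in_inj; rewrite qE.
have [l lE] := prP _ _ q k' sq; exists l => u.
by rewrite -qE lE k'E.
Qed.

Section FinitelyGenerated.
Context (A : comNzRingType).

(** Generation of the subquotient [Z / B], expressed inside [V] so that no quotient has to be built;
    [B = [set 0]] gives ordinary generation. *)
Definition generates_mod (V : lmodType A) (Z B : set V) n (x : 'I_n -> V) :=
  (forall j, Z (x j)) /\
  forall z, Z z -> exists c : 'I_n -> A, B (z - \sum_j c j *: x j).

Definition fg_mod (V : lmodType A) (Z B : set V) :=
  exists n (x : 'I_n -> V), generates_mod Z B x.

(** Induction on [n]: the ideal of first coefficients has finitely many generators, and subtracting
    a combination of lifts of them leaves an element of [Z] that no longer involves [x ord0]. *)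
Lemma fg_sub_family (V : lmodType A) n (x : 'I_n -> V) (Z : set V) :
  noetherian A -> submodule Z ->
  (forall z, Z z -> exists c : 'I_n -> A, z = \sum_j c j *: x j) ->
  fg_mod Z [set 0].
Proof.
move=> nA; elim: n x Z => [|n IH] x Z hZ Zx.
  exists 0, x; split=> [[//]|z /Zx[c ->]]; exists c; by rewrite !big_ord0 subrr.
pose x' j := x (lift ord0 j).
pose I : set A := [set a | exists c : 'I_n -> A, Z (a *: x ord0 + \sum_j c j *: x' j)].
have idI : is_ideal I.
  split.
    exists (fun=> 0); rewrite scale0r add0r big1; first exact: submod0.
    by move=> j _; rewrite scale0r.
  move=> a u v [c hc] [d hd]; exists (fun j => a * c j + d j).
  have -> : (a * u + v) *: x ord0 + \sum_j (a * c j + d j) *: x' j =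
      a *: (u *: x ord0 + \sum_j c j *: x' j) + (v *: x ord0 + \sum_j d j *: x' j).
    rewrite scalerDr scalerDl scalerA addrACA scaler_sumr -big_split /=.
    by congr (_ + _); apply: eq_bigr => j _; rewrite scalerDl scalerA.
  exact: hZ.2.
have [s sI] := nA _ idI.
have sIn i : I s`_(i : 'I_(size s)).
  by rewrite -sI; apply: span_sub => /=; apply: mem_nth.
have [d hd] := choice sIn.
pose y (i : 'I_(size s)) := s`_i *: x ord0 + \sum_j d i j *: x' j.
pose Z' : set V := [set z | Z z /\ exists c : 'I_n -> A, z = \sum_j c j *: x' j].
have hZ' : submodule Z'.
  split.
    split; first exact: submod0.
    by exists (fun=> 0); rewrite big1 // => j _; rewrite scale0r.
  move=> a u v [zu [c uE]] [zv [e vE]]; split; first exact: hZ.2.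
  exists (fun j => a * c j + e j); rewrite uE vE scaler_sumr -big_split /=.
  by apply: eq_bigr => j _; rewrite scalerDl scalerA.
have [m [w [wZ' wg]]] := IH x' Z' hZ' (fun z h => h.2).
exists (size s + m)%N, (fun k => match split k with inl i => y i | inr j => w j end).
split=> [k|z Zz].
  by case: split => i; [exact: hd | exact: (wZ' i).1].
have [c zE] := Zx z Zz.
have Ic : I (c ord0).
  by exists (fun j => c (lift ord0 j)); rewrite -(big_ord_recl _ (fun j => c j *: x j)) -zE.
rewrite -sI in Ic; have [e eE] := span_seqP Ic.
have Z'z : Z' (z - \sum_i e i *: y i).
  split; first by apply: submodB => //; apply: submod_comb => // i; exact: hd.
  exists (fun j => c (lift ord0 j) - \sum_i e i * d i j).
  rewrite zE big_ord_recl eE scaler_suml.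
  rewrite [X in _ - X](eq_bigr (fun i =>
      (e i * s`_i) *: x ord0 + \sum_j (e i * d i j) *: x' j)); last first.
    move=> i _ /=; rewrite scalerDr scalerA scaler_sumr; congr (_ + _).
    by apply: eq_bigr => j _; rewrite scalerA.
  rewrite big_split /= opprD addrACA subrr add0r exchange_big /= -sumrB.
  by apply: eq_bigr => j _; rewrite scalerBl scaler_suml.
have [g gE] := wg _ Z'z.
exists (fun k => match split k with inl i => e i | inr j => g j end).
rewrite big_split_ord /= opprD addrA -[RHS]gE; congr (_ - _ - _).
  by apply: eq_bigr => i _; rewrite -[lshift _ _]/(unsplit (inl i)) unsplitK.
by apply: eq_bigr => i _; rewrite -[rshift _ _]/(unsplit (inr i)) unsplitK.
Qed.

Lemma finite_moduleP (V : lmodType A) :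
  finite_module V <-> exists n (x : 'I_n -> V),
    forall v, exists c : 'I_n -> A, v = \sum_j c j *: x j.
Proof.
split=> [[s hs]|[n [x hx]]].
  by exists (size s), (fun j => s`_j) => v; apply: span_seqP.
exists [seq x j | j <- enum 'I_n] => v; have [c ->] := hx v.
apply: submod_comb; first exact: submodule_span.
by move=> j; apply: span_sub => /=; apply/mapP; exists j; rewrite ?mem_enum.
Qed.

Lemma noetherian_sub (V : lmodType A) (Z : set V) :
  noetherian A -> finite_module V -> submodule Z -> fg_mod Z [set 0].
Proof.
move=> nA /finite_moduleP[n [x hx]] hZ.
exact: (fg_sub_family (x := x) nA hZ (fun z _ => hx z)).
Qed.

Lemma fg_mod_le (V : lmodType A) (Z B B' : set V) :
  B `<=` B' -> fg_mod Z B -> fg_mod Z B'.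
Proof.
move=> BB' [n [x [xZ xg]]]; exists n, x; split=> // z /xg[c h].
by exists c; apply: BB'.
Qed.

End FinitelyGenerated.

Section Local.
Context (A : comNzRingType).

Lemma ideal_submodule (I : set A) : is_ideal I -> @submodule A A^o I.
Proof. by []. Qed.

Lemma chain_ideal (F : set (set A)) : (exists X, F X) ->
  (forall X, F X -> is_ideal X) -> total_on F subset -> is_ideal (\bigcup_(X in F) X).
Proof.
move=> [X0 FX0] Fi tot; split; first by exists X0 => //; case: (Fi _ FX0).
move=> a u v [X FX Xu] [Y FY Yv]; have [XY|YX] := tot X Y FX FY.
  by exists Y => //; apply: (Fi _ FY).2 => //; exact: XY.
by exists X => //; apply: (Fi _ FX).2 => //; exact: YX.
Qed.

Lemma maximal_ideal_above (J : set A) : is_ideal J -> ~ J 1 ->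
  exists m, maximal_ideal m /\ J `<=` m.
Proof.
move=> hJ J1.
pose P (X : set A) := X = set0 \/ [/\ is_ideal X, J `<=` X & ~ X 1].
have [|M [PM Mmax]] := @Zorn_bigcup A P.
  move=> F FP tot; have [F0|] := pselect (forall X, F X -> X = set0).
    by left; apply/seteqP; split=> // a [X /F0 ->].
  move=> /existsNP[X0 /not_implyP[FX0 X0n]]; right.
  pose G : set (set A) := [set X | F X /\ X <> set0].
  have GE : \bigcup_(X in F) X = \bigcup_(X in G) X.
    apply/seteqP; split=> a [X FX Xa]; last by exists X => //; case: FX.
    by exists X => //; split=> // E; rewrite E in Xa.
  have GP X : G X -> [/\ is_ideal X, J `<=` X & ~ X 1].
    by move=> [/FP[]].
  rewrite GE; split.
  - apply: chain_ideal; first by exists X0.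
      by move=> X /GP[].
    by move=> X Y [FX _] [FY _]; apply: tot.
  - by move=> a Ja; exists X0 => //; have [_ + _] := GP X0 (conj FX0 X0n); apply.
  - by move=> [X /GP[_ _ h]].
have [J0 _] := hJ.
have {PM} [iM JM M1] : [/\ is_ideal M, J `<=` M & ~ M 1].
  case: PM => // M0; exfalso; apply: (Mmax J); last by right; split.
  by rewrite M0; split=> // /(_ 0 J0).
exists M; split=> //; split=> // K iK K1 MK; apply/seteqP; split=> // a Ka.
apply: contrapT => Ma; apply: (Mmax K); last by right; split=> // b /JM /MK.
by split=> // /(_ a Ka).
Qed.

(** The union of a chain of ideals belongs to the chain, since its finitely many generators all lie
    in one member; so Zorn's lemma applies to any property [P]. *)
Lemma noetherian_max (P : set A -> Prop) (I0 : set A) : noetherian A ->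
  is_ideal I0 -> P I0 ->
  exists I, [/\ is_ideal I, P I & forall J, is_ideal J -> P J -> I `<=` J -> J `<=` I].
Proof.
move=> nA hI0 PI0.
pose Q (X : set A) := X = set0 \/ (is_ideal X /\ P X).
have [|M [QM Mmax]] := @Zorn_bigcup A Q.
  move=> F FP tot; have [F0|] := pselect (forall X, F X -> X = set0).
    by left; apply/seteqP; split=> // a [X /F0 ->].
  move=> /existsNP[X0 /not_implyP[FX0 X0n]]; right.
  pose G : set (set A) := [set X | F X /\ X <> set0].
  have GE : \bigcup_(X in F) X = \bigcup_(X in G) X.
    apply/seteqP; split=> a [X FX Xa]; last by exists X => //; case: FX.
    by exists X => //; split=> // E; rewrite E in Xa.
  have GP X : G X -> is_ideal X /\ P X by move=> [/FP[]].
  have iG : is_ideal (\bigcup_(X in G) X).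
    apply: chain_ideal; first by exists X0.
      by move=> X /GP[].
    by move=> X Y [FX _] [FY _]; apply: tot.
  rewrite GE; split=> //.
  have [s sE] := nA _ iG.
  have [X GX sX] : exists2 X, G X & forall a, a \in s -> X a.
    have : forall a, a \in s -> exists2 X, G X & X a.
      move=> a as_; have : ideal_gen [set a | a \in s] a by apply: span_sub.
      by rewrite sE => -[X GX Xa]; exists X.
    elim: (s) => [_|a t IH h]; first by exists X0.
    have [X GX Xt] : exists2 X, G X & forall a, a \in t -> X a.
      by apply: IH => b bt; apply: h; rewrite inE bt orbT.
    have [|Y GY Ya] := h a; first by rewrite inE eqxx.
    have [XY|YX] := tot X Y GX.1 GY.1.
      by exists Y => // b; rewrite inE => /orP[/eqP->//|/Xt /XY].
    by exists X => // b; rewrite inE => /orP[/eqP->|/Xt //]; exact: YX.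
  suff -> : \bigcup_(X in G) X = X by case: (GP X GX).
  apply/seteqP; split=> a Xa; last by exists X.
  rewrite -sE in Xa; exact: (@span_min A A^o [set b | b \in s] X (GP X GX).1 sX a Xa).
have {QM} [iM PM] : is_ideal M /\ P M.
  case: QM => // M0; exfalso; apply: (Mmax I0); last by right; split.
  by rewrite M0; split=> // /(_ 0 hI0.1).
exists M; split=> // K iK PK MK a Ka; apply: contrapT => Ma.
apply: (Mmax K); last by right.
by split=> // /(_ a Ka).
Qed.

Context (m : set A) (hm : local_ring m).

Lemma local_ideal : is_ideal m. Proof. by case: hm => _ []. Qed.
Lemma local_proper : ~ m 1. Proof. by case: hm => _ []. Qed.
Lemma local_noeth : noetherian A. Proof. by case: hm. Qed.

Lemma local_sub (J : set A) : is_ideal J -> ~ J 1 -> J `<=` m.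
Proof.
move=> hJ J1; have [M [hM JM]] := maximal_ideal_above hJ J1.
by case: hm => _ _ /(_ _ hM) <-.
Qed.

Lemma local_unit a : ~ m a -> exists b, b * a = 1.
Proof.
move=> ma; apply: contrapT => nb; apply: ma.
apply: (@local_sub [set c | exists b, c = b * a]); last by exists 1; rewrite mul1r.
  split; first by exists 0; rewrite mul0r.
  by move=> c _ _ [b ->] [d ->]; exists (c * b + d); rewrite mulrDl mulrA.
by move=> [b h]; apply: nb; exists b.
Qed.

Lemma local_mul a b : m b -> m (a * b).
Proof. exact: (submodZ (ideal_submodule local_ideal)). Qed.

Lemma local_add a b : m a -> m b -> m (a + b).
Proof. exact: (submodD (ideal_submodule local_ideal)). Qed.

Section Modules.
Context (V : lmodType A) (Z B : set V) (hB : submodule B).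

(** Elimination instead of determinants: [1 - c ord0] is a unit, so modulo [B] the first element is
    a combination of the others with coefficients in [m], and substituting it keeps all coefficients
    in [m]. *)
Lemma nakayama_family n (x : 'I_n -> V) :
  (forall j, exists2 c : 'I_n -> A, forall k, m (c k) & B (x j - \sum_k c k *: x k)) ->
  forall j, B (x j).
Proof.
elim: n x => [|n IH] x hx; first by case.
have [c cm] := hx ord0; rewrite big_ord_recl => c0.
have [u uE] : exists u, u * (1 - c ord0) = 1.
  apply: local_unit => h; apply: local_proper.
  by rewrite -(subrK (c ord0) 1); apply: local_add.
pose x' k := x (lift ord0 k); pose c' k := u * c (lift ord0 k).
have x0E : B (x ord0 - \sum_k c' k *: x' k).
  have := submodZ hB u c0.
  rewrite opprD addrA -{1}(scale1r (x ord0)) -scalerBl scalerBr scalerA uE scale1r.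
  rewrite scaler_sumr; congr (B (_ - _)).
  by apply: eq_bigr => k _; rewrite scalerA.
have Bx' : forall j, B (x' j).
  apply: IH => j; have [d dm dE] := hx (lift ord0 j).
  exists (fun k => d ord0 * c' k + d (lift ord0 k)).
    move=> k; apply: local_add => //.
    by do 2!apply: local_mul.
  have := submodD hB dE (submodZ hB (d ord0) x0E).
  have E (q p s t : V) : q - (p + s) + (p - t) = q - (s + t).
    by rewrite !opprD [- p - s]addrC !addrA subrK.
  congr (B _); rewrite big_ord_recl scalerBr E scaler_sumr -big_split /=.
  congr (_ - _); apply: eq_bigr => k _.
  by rewrite addrC scalerDl scalerA.
move=> j; case: (unliftP ord0 j) => [k ->|->]; first exact: Bx'.
rewrite -(subrK (\sum_k c' k *: x' k) (x ord0)); apply: submodD => //.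
by apply: submod_comb.
Qed.

Lemma nakayama a : m a -> fg_mod Z B ->
  (forall z, Z z -> exists w, Z w /\ a *: w = z) -> Z `<=` B.
Proof.
move=> ma [n [x [xZ xg]]] aZ.
have Bx : forall j, B (x j).
  apply: nakayama_family => j; have [w [Zw wE]] := aZ _ (xZ j).
  have [c cE] := xg _ Zw; exists (fun k => c k * a); first by move=> k; apply: local_mul.
  have := submodZ hB a cE; rewrite scalerBr wE scaler_sumr; congr (B (_ - _)).
  by apply: eq_bigr => k _; rewrite scalerA mulrC.
move=> z /xg[c h]; rewrite -(subrK (\sum_j c j *: x j) z).
by apply: submodD => //; apply: submod_comb.
Qed.

(** Take the least possible number of generators: a relation with a coefficient outside [m], hence a
    unit, would express one generator by the others. *)
Lemma minimal_generators : fg_mod Z B ->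
  exists n (x : 'I_n -> V), generates_mod Z B x /\
    forall c : 'I_n -> A, B (\sum_j c j *: x j) -> forall j, m (c j).
Proof.
move=> fg; have ex : exists n, `[< exists x : 'I_n -> V, generates_mod Z B x >].
  by case: fg => n hn; exists n; apply/asboolP.
case: (ex_minnP ex) => n /asboolP[x [xZ xg]] nmin; exists n, x; split=> // c Bc j0.
apply: contrapT => /local_unit[u uE].
case: n x xZ xg nmin c Bc j0 uE => [|n] x xZ xg nmin c Bc j0 uE.
  by case: j0 uE.
have /nmin : `[< exists x : 'I_n -> V, generates_mod Z B x >]; last by rewrite ltnn.
apply/asboolP; exists (fun k => x (lift j0 k)); split=> // z /xg[d dE].
exists (fun k => d (lift j0 k) - d j0 * u * c (lift j0 k)).
have := submodD hB dE (submodZ hB (d j0 * u) Bc); congr (B _).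
have big F : \sum_j F j = F j0 + \sum_k F (lift j0 k) :> V.
  by rewrite (bigD1_ord j0).
have E (q p s t : V) : q - (p + s) + (p + t) = q - (s - t).
  by rewrite !opprD opprK [- p - s]addrC !addrA subrK.
rewrite !big scalerDr scalerA -mulrA uE mulr1 E scaler_sumr -sumrB; congr (_ - _).
by apply: eq_bigr => k _; rewrite scalerBl scalerA.
Qed.

End Modules.
End Local.

(** * Comparison of resolutions and injective dimension *)

Section ExtIndependence.
Context (A : comNzRingType) (M : lmodType A).
Implicit Types P Q : resolution (@projective A) M.

(** [M] sits in degree 0 and [P n] in degree [n.+1], so that the augmentation and the differentials
    form one family and the comparison can start from the identity of [M]. *)
Definition aug_term P n : lmodType A := if n is n'.+1 then P n' else M.

Definition aug_diff P n : {linear aug_term P n.+1 -> aug_term P n} :=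
  match n with 0 => raug P | n'.+1 => rdiff P n' end.

Lemma aug_exact P n : exact_at (aug_diff P n.+1) (aug_diff P n).
Proof. by case: n => [|n]; case: P => t d a h1 h2 h3 h4; [exact: h3 | exact: (h4 n)]. Qed.

Lemma aug_proj P n : projective (aug_term P n.+1).
Proof. by case: P => t d a h1 h2 h3 h4; exact: h1. Qed.

Lemma aug_dd P n u : aug_diff P n (aug_diff P n.+1 u) = 0.
Proof. by apply/aug_exact; exists u. Qed.

Lemma aug_surj P : surj (aug_diff P 0). Proof. by case: P. Qed.

Lemma aug_lift P Q n (h : {linear aug_term P n -> aug_term Q n}) :
  (forall u, exists v, aug_diff Q n v = h (aug_diff P n u)) ->
  exists k : {linear aug_term P n.+1 -> aug_term Q n.+1},
    (forall u, aug_diff Q n (k u) = h (aug_diff P n u)) /\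
    (forall u, exists v, aug_diff Q n.+1 v = k (aug_diff P n.+1 u)).
Proof.
move=> hh.
have [k kE] := projective_factor (k := h \o aug_diff P n) (@aug_proj P n) hh.
exists k; split=> // u; apply/aug_exact.
by rewrite kE /= aug_dd linear0.
Qed.

(* The chain maps [f : P -> Q], [g : Q -> P] and the homotopy, here
   [r = s \o d], are built one degree at a time. *)
Lemma comparison P Q n :
  exists (f : {linear aug_term P n -> aug_term Q n})
         (g : {linear aug_term Q n -> aug_term P n})
         (r : {linear aug_term Q n -> aug_term Q n}),
    [/\ forall u, exists v, aug_diff Q n v = f (aug_diff P n u),
        forall u, exists v, aug_diff P n v = g (aug_diff Q n u),
        forall x, exists v, aug_diff Q n v = x - f (g x) - r x,
        forall u, r (aug_diff Q n u) = 0 &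
        (match n return {linear aug_term P n -> aug_term Q n} ->
             {linear aug_term Q n -> aug_term P n} ->
             {linear aug_term Q n -> aug_term Q n} -> Prop with
         | 0 => fun f g r => forall x, x - f (g x) - r x = 0
         | n'.+1 => fun _ g r =>
             (exists c : {linear aug_term Q n' -> aug_term P n'},
                forall x, aug_diff P n' (g x) = c (aug_diff Q n' x)) /\
             (exists s : {linear aug_term Q n' -> aug_term Q n'.+1},
                forall x, r x = s (aug_diff Q n' x))
         end) f g r].
Proof.
elim: n => [|n [f [g [r [hf hg hfg hr h0]]]]].
  exists idfun, idfun, \0; split=> // [u|u|x|x] /=; try exact: aug_surj.
  by rewrite subrr subr0.
have [f' [f'E f'd]] := aug_lift hf.
have [g' [g'E g'd]] := aug_lift hg.
have [s sE] : exists s : {linear aug_term Q n -> aug_term Q n.+1},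
    forall x, aug_diff Q n (s x) = x - f (g x) - r x.
  (* In degree 0 the term [M] need not be projective, but there the defect [x - f (g x) - r x] is
     zero and [s = 0] does. *)
  case: n f g r hf hg hfg hr h0 {f' f'E f'd g' g'E g'd} => [|n] f g r hf hg hfg hr h0.
    by exists \0 => x /=; rewrite linear0 h0.
  exact: (projective_factor (k := (idfun \- (f \o g)) \- r) (@aug_proj Q n) hfg).
exists f', g', (s \o aug_diff Q n); split=> //=.
- move=> x; apply/aug_exact; rewrite !linearB /= f'E g'E sE /= hr subr0.
  exact: subrr.
- by move=> u; rewrite aug_dd linear0.
- by split; [exists g | exists s].
Qed.

(** Modulo boundaries [x] is [f (g x) + r x]. On the first summand [phi] is a coboundary by the
    assumption on [Q], on the second because [r] factors through the differential. *)
Lemma Ext_zero_indep (N : lmodType A) P i :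
  Ext_zero i.+1 M N ->
  forall phi : {linear P i.+1 -> N}, Hom_cocycle phi -> Hom_coboundary phi.
Proof.
move=> [Q hQ] phi phic.
(* Degree [i.+2] of the augmented complexes is degree [i.+1] of the resolutions. *)
have [f [g [r [hf hg hfg hr [[c cE] [s sE]]]]]] := comparison Q P i.+2.
have [|psi psiE] := hQ (phi \o f).
  by move=> u /=; have [v <-] := hf u; exact: phic.
exists ((psi \o c) \+ (phi \o s)) => x /=.
have [v vE] := hfg x.
have e : phi (x - f (g x) - r x) = 0 by rewrite -vE; exact: phic.
move: e; rewrite !linearB /= => /eqP; rewrite subr_eq0 subr_eq => /eqP ->.
rewrite sE addrC; congr (_ + _); have /= -> := psiE (g x).
by congr (psi _); exact: cE.
Qed.
End ExtIndependence.

(** * Injective dimension by cosyzygies, and its behaviour under retracts *)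

Section InjectiveDimension.
Context (A : comNzRingType).
Implicit Types M E C : lmodType A.

(** A coresolution unrolled one cosyzygy at a time, the form suited to induction along short exact
    sequences. *)
Fixpoint idim n M : Prop :=
  if n is n'.+1 then
    exists (E C : lmodType A) (i : {linear M -> E}) (p : {linear E -> C}),
      [/\ injective_module E, injective i, surj p, exact_at i p & idim n' C]
  else injective_module M.

Lemma injective_retract M E (s : {linear M -> E}) (r : {linear E -> M}) :
  (forall x, r (s x) = x) -> injective_module E -> injective_module M.
Proof.
move=> rs injE X Y i g injI.
have [h hE] := injE _ _ i (s \o g) injI.
by exists (r \o h) => u /=; rewrite hE /= rs.
Qed.

Lemma injective_prod E E' :
  injective_module E -> injective_module E' ->
  injective_module ((E * E')%type : lmodType A).
Proof.
move=> hE hE' X Y i g injI.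
have [h h1] := hE _ _ i (fst \o g) injI.
have [h' h2] := hE' _ _ i (snd \o g) injI.
have kl a u v : (h (a *: u + v), h' (a *: u + v)) = a *: (h u, h' u) + (h v, h' v) :> (E * E')%type.
  by congr (_, _); exact: linearP.
by exists (mklin kl) => u /=; rewrite /= h1 h2 /=; case: (g u).
Qed.

Lemma idim_prod n E C :
  injective_module E -> idim n C -> idim n ((E * C)%type : lmodType A).
Proof.
move=> hE; case: n => [|n]; first exact: injective_prod.
move=> [E' [C' [i [p [hE' ii sp ex hC']]]]].
have il a u v : ((a *: u + v).1, i (a *: u + v).2) =
    a *: (u.1, i u.2) + (v.1, i v.2) :> (E * E')%type.
  by congr (_, _); exact: linearP.
exists ((E * E')%type : lmodType A), C',
  (mklin il : {linear (E * C)%type -> (E * E')%type}), (p \o snd).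
split=> //=; first exact: injective_prod.
- by move=> [u1 u2] [v1 v2] [-> /ii ->].
- by move=> c; have [e <-] := sp c; exists (0, e).
- move=> [e e'] /=; split=> [/ex[c <-]|[[e1 c] [_ <-]]]; first by exists (e, c).
  by apply/ex; exists c.
Qed.

(* Schanuel's trick: extend the idempotent of [M] to [rho : E -> E]; then
   [E / H] is a retract of [E * C]. *)
Lemma idim_retract n M (H : lmodType A) (s : {linear H -> M}) (r : {linear M -> H}) :
  (forall x, r (s x) = x) -> idim n M -> idim n H.
Proof.
elim: n M H s r => [|n IH] M H s r rs /=; first exact: injective_retract rs.
move=> [E [C [i [p [injE ii sp ex hC]]]]].
have [rho rhoE] := injE _ _ i (i \o s \o r) ii.
pose Z := range (i \o s); have hZ : submodule Z by exact: submodule_range.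
pose q := modpi Z.
have sq : surj q by exact: modpi_surj.
have q0 e : q e = 0 <-> Z e by exact: modpi_eq0.
exists E, (modquot Z), (i \o s), q; split=> //.
- by move=> x y /= /ii e; rewrite -(rs x) e rs.
- by move=> e; rewrite q0; split=> [[u _ <-]|[u <-]]; exists u.
(* The retraction of [alpha] will send [(e, c)] to [q e + b0 c]; it works because
   [q (e - rho e) + q (rho e) = q e]. *)
have al a u v : ((a *: u + v) - rho (a *: u + v), p (a *: u + v)) =
    a *: (u - rho u, p u) + (v - rho v, p v) :> (E * C)%type.
  congr (_, _); last exact: linearP.
  by rewrite linearP opprD addrACA -scalerBr.
have [alpha alphaE] : exists g : {linear modquot Z -> (E * C)%type},
    forall u, g (q u) = (u - rho u, p u).
  apply: (surj_inv_lin (h := mklin al) sq) => u /q0[x _ <-] /=.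
  rewrite rhoE /= rs subrr.
  by congr (_, _); apply/ex; exists (s x).
have [b0 b0E] : exists g : {linear C -> modquot Z}, forall u, g (p u) = q (rho u).
  apply: (surj_inv_lin (h := q \o rho) sp) => u /ex[x <-] /=.
  by rewrite rhoE; apply/q0; exists (r x).
apply: (IH _ _ alpha ((q \o fst) \+ (b0 \o snd))); last exact: idim_prod.
move=> x; have [e <-] := sq x; rewrite alphaE /= b0E.
by rewrite -linearD subrK.
Qed.

Lemma id_le_idim n M : id_le n M -> idim n M.
Proof.
elim: n M => [|n IH] M [[t d a hi ai ex0 ex] van] /=.
  move=> X Y i g injI; have [h hE] := hi 0%N _ _ i (a \o g) injI.
  have [k kE] : exists k : {linear Y -> M}, forall y, a (k y) = h y.
    by apply: (inj_inv_lin (h := h) ai) => w; apply/ex0; exact: (van 1%N).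
  by exists k => u; apply: (ai); rewrite kE hE.
pose Z := range (d 0%N); have hZ : submodule Z by exact: submodule_range.
have [q qE] := @submod_corestrict _ _ _ hZ _ (d 0%N) (fun u => ex_intro2 _ _ u I erefl).
exists (t 0%N), (submod hZ), a, q; split=> //.
- move=> v; have [u _ e] := submod_inP v; exists u.
  by apply: submod_in_inj; rewrite qE.
- move=> v; rewrite -ex0 -(qE v); split=> [->|]; first exact: linear0.
  exact: (inj_lin0 (@submod_in_inj _ _ _ hZ)).
apply: IH; have ex0' : exact_at (submod_in hZ) (d 1%N).
  move=> v; rewrite (ex 0%N v); split=> [[u <-]|[u <-]].
    by apply: submod_onto; exists u.
  by have [w _ <-] := submod_inP u; exists w.
exists (@Coresolution _ _ _ (fun i => t i.+1) (fun i => d i.+1) (submod_in hZ)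
  (fun i => hi i.+1) (@submod_in_inj _ _ _ hZ) ex0' (fun i => ex i.+1)).
by move=> i ni u; apply: (van i.+1).
Qed.

Lemma injective_zero (E : lmodType A) : (forall u : E, u = 0) -> injective_module E.
Proof. by move=> h X Y i g _; exists \0 => u; rewrite [RHS]h. Qed.

Lemma idim_id_le n M : idim n M -> id_le n M.
Proof.
have zE (u : 'rV[A]_0) : u = 0 by exact: thinmx0.
elim: n M => [|n IH] M /=.
  move=> injM; pose t i : lmodType A := if i is _.+1 then 'rV[A]_0 else M.
  have ex0 : exact_at (idfun : {linear M -> t 0%N}) (\0 : {linear t 0%N -> t 1%N}).
    by move=> v; split=> // _; exists v.
  have ex i : exact_at (\0 : {linear t i -> t i.+1}) (\0 : {linear t i.+1 -> t i.+2}).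
    by move=> v; split=> // _; exists 0; rewrite /= [RHS]zE.
  have hi i : injective_module (t i).
    by case: i => [|i] //; apply: injective_zero.
  by exists (@Coresolution _ _ _ t (fun i => \0) idfun hi (fun x y e => e) ex0 ex); case.
move=> [E [C [i [p [injE ii sp exE /IH[[t d a hi ai ex0 ex] van]]]]]].
pose t' i : lmodType A := if i is j.+1 then t j else E.
pose d' i : {linear t' i -> t' i.+1} :=
  match i with 0 => a \o p | j.+1 => d j end.
have ex0' : exact_at i (d' 0%N).
  move=> v; rewrite -exE /=; split=> [|->]; last exact: linear0.
  exact: inj_lin0.
have ex' j : exact_at (d' j) (d' j.+1).
  case: j => [|j] //= v; rewrite ex0; split=> [[c <-]|[e <-]].
    by have [e <-] := sp c; exists e.
  by exists (p e).
have hi' j : injective_module (t' j) by case: j.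
by exists (@Coresolution _ _ _ t' d' i hi' ii ex0' ex'); case.
Qed.

End InjectiveDimension.

(** * Flat base change of linear systems *)

Lemma spanP (A : comNzRingType) (V : lmodType A) (X : set V) u : span X u ->
  exists n (s : 'I_n -> A) (x : 'I_n -> V), (forall j, X (x j)) /\ u = \sum_j s j *: x j.
Proof.
elim=> [|a v w Xv _ [n [s [x [hx ->]]]]].
  by exists 0%N, (fun=> 0), (fun=> 0); split=> [[//]|]; rewrite big_ord0.
exists n.+1, (fun j => if unlift ord0 j is Some k then s k else a),
  (fun j => if unlift ord0 j is Some k then x k else v); split=> [j|].
  by case: unliftP.
rewrite big_ord_recl unlift_none; congr (_ + _).
by apply: eq_bigr => k _; rewrite liftK.
Qed.

Section TensorBasics.
Context (R S : comNzRingType) (f : {rmorphism R -> S}) (N : lmodType S).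
Section OneModule.
Context (M : lmodType R).
Implicit Types (n : N) (m : M).

Lemma tpairDl n n' m : tpair f (n + n') m = tpair f n m + tpair f n' m.
Proof. by case: (tpair_balanced f N M). Qed.
Lemma tpairDr n m m' : tpair f n (m + m') = tpair f n m + tpair f n m'.
Proof. by case: (tpair_balanced f N M). Qed.
Lemma tpairZl s n m : tpair f (s *: n) m = s *: tpair f n m.
Proof. by case: (tpair_balanced f N M). Qed.
Lemma tpairZr r n m : tpair f n (r *: m) = f r *: tpair f n m.
Proof. by case: (tpair_balanced f N M) => _ _ h1 h2; rewrite -h2 h1. Qed.
Lemma tpair0 n : tpair f n (0 : M) = 0.
Proof. by rewrite -(scale0r (0 : M)) tpairZr rmorph0 scale0r. Qed.
Lemma tpairB n m m' : tpair f n (m - m') = tpair f n m - tpair f n m'.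
Proof. by rewrite tpairDr -scaleN1r tpairZr rmorphN1 scaleN1r. Qed.
Lemma tpair_sum n (I : Type) (r : seq I) (P : pred I) (F : I -> M) :
  tpair f n (\sum_(i <- r | P i) F i) = \sum_(i <- r | P i) tpair f n (F i).
Proof. exact: (big_morph _ (tpairDr n) (tpair0 n)). Qed.

Lemma tens_ind (P : tens f N M -> Prop) :
  P 0 -> (forall n m, P (tpair f n m)) -> (forall u v, P u -> P v -> P (u + v)) ->
  forall t, P t.
Proof.
move=> P0 P1 PD t; pose Z := span [set x | exists n m, x = tpair f n m].
have : Z t.
  (* The projection modulo the span of the pure tensors kills every pure tensor, hence is the zero
     map. *)
  apply/(modpi_eq0 (submodule_span _)); rewrite -[RHS]/((\0 : {linear _ -> modquot Z}) t).
  apply: tens_ext => n m /=; apply/modpi_eq0; first exact: submodule_span.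
  by apply: span_sub; exists n, m.
elim=> [//|a u v [n [m ->]] _ Pv]; apply: PD => //.
by rewrite -tpairZl.
Qed.
End OneModule.

Lemma tens_map_comp (M M' M'' : lmodType R) (g : {linear M -> M'}) (h : {linear M' -> M''})
    (k : {linear M -> M''}) t : (forall u, k u = h (g u)) ->
  tens_map f N k t = tens_map f N h (tens_map f N g t).
Proof.
move=> kE; elim/tens_ind: t => [|n m|u v hu hv]; first by rewrite !linear0.
  by rewrite !tens_mapE kE.
by rewrite !linearD hu hv.
Qed.

Lemma tens_surj (M M' : lmodType R) (p : {linear M -> M'}) :
  surj p -> surj (tens_map f N p).
Proof.
move=> sp t; elim/tens_ind: t => [|n m|u v [s <-] [t <-]].
- by exists 0; exact: linear0.
- by have [u <-] := sp m; exists (tpair f n u); exact: tens_mapE.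
- by exists (s + t); exact: linearD.
Qed.

(** For the kernel, a map from the tensor product with [W] to the cokernel of the first map is built
    from a mere set-theoretic section [s] of [p]: two lifts differ by an element coming from [L], so
    the pairing is balanced modulo the image. *)
Lemma tens_exact (L M W : lmodType R) (i : {linear L -> M}) (p : {linear M -> W}) :
  exact_at i p -> surj p -> exact_at (tens_map f N i) (tens_map f N p).
Proof.
move=> ex sp t; split=> [|[l <-]]; last first.
  rewrite -(tens_map_comp (k := \0)) => [|u]; last by apply/esym/ex; exists u.
  elim/tens_ind: l => [|n m|u v hu hv]; first exact: linear0.
    by rewrite tens_mapE tpair0.
  by rewrite linearD hu hv addr0.
pose Z := range (tens_map f N i); have hZ : submodule Z by exact: submodule_range.
pose q : {linear _ -> modquot Z} := modpi Z; pose s w := sval (cid (sp w)).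
have sE w : p (s w) = w by rewrite /s; case: cid.
have qE n m m' : p m = p m' -> q (tpair f n m) = q (tpair f n m').
  move=> e; apply/eqP; rewrite -subr_eq0 -linearB -tpairB; apply/eqP/modpi_eq0 => //.
  have /ex[l <-] : p (m - m') = 0 by rewrite linearB /= e subrr.
  by exists (tpair f n l) => //; exact: tens_mapE.
have bal : balanced f (fun n w => q (tpair f n (s w))).
  split=> [n n' w|n w w'|a n w|r n w].
  - by rewrite tpairDl linearD.
  - rewrite -linearD -tpairDr; apply: qE; by rewrite linearD /= !sE.
  - by rewrite tpairZl linearZ_LR.
  - rewrite tpairZl -tpairZr; apply: qE; by rewrite linearZ_LR /= !sE.
have bE u : tens_lift bal (tens_map f N p u) = q u.
  elim/tens_ind: u => [|n m|u v hu hv]; first by rewrite !linear0.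
    by rewrite tens_mapE tens_liftE; apply: qE; rewrite sE.
  by rewrite !linearD hu hv.
move=> t0; have : q t = 0 by rewrite -bE t0 linear0.
by move/(modpi_eq0 hZ) => [l _ <-]; exists l.
Qed.
End TensorBasics.

Section RestrictedTensor.
Context (R S : comNzRingType) (f : {rmorphism R -> S}) (N : lmodType S) (M : lmodType R).

(** [flat] speaks of the tensor product over [R] of the restricted module, base change of [tens f].
    Giving the former an [S]-structure makes the comparison map [S]-linear, hence definable by the
    universal property. *)
Definition tensR : Type := tens idfun (restr f N) M.
HB.instance Definition _ := GRing.Zmodule.on tensR.

Definition tpairR (n : N) (m : M) : tensR := tpair idfun (n : restr f N) m.

Fact tensR_balanced (s : S) :
  balanced idfun (fun (n : restr f N) (m : M) =>
    tpair idfun ((s *: (n : N)) : restr f N) m).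
Proof.
have E r (n : N) : s *: (f r *: n) = f r *: (s *: n) by rewrite !scalerA mulrC.
split=> [n n' m|n m m'|r n m|r n m].
- by rewrite -tpairDl; congr (tpair _ _ _); exact: (scalerDr s (n : N) (n' : N)).
- exact: tpairDr.
- rewrite -tpairZl; congr (tpair _ _ _).
  exact: E.
- rewrite tpairZr -tpairZl; congr (tpair _ _ _).
  exact: E.
Qed.

Definition tensR_scale (s : S) (t : tensR) : tensR := tens_lift (tensR_balanced s) t.

Lemma tensR_scaleE s n m : tensR_scale s (tpairR n m) = tpairR (s *: n) m.
Proof. exact: tens_liftE. Qed.

Lemma tensR_scaleD s : {morph tensR_scale s : u v / u + v}.
Proof. by move=> u v; exact: linearD. Qed.

Lemma tensR_scale0 s : tensR_scale s 0 = 0.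
Proof. exact: (linear0 (tens_lift (tensR_balanced s))). Qed.

Fact tensR_scaleA (a b : S) (t : tensR) :
  tensR_scale a (tensR_scale b t) = tensR_scale (a * b) t.
Proof.
elim/tens_ind: t => [|n m|u v hu hv]; first by rewrite !tensR_scale0.
  by rewrite -/(tpairR n m) !tensR_scaleE scalerA.
by rewrite !tensR_scaleD hu hv.
Qed.

Fact tensR_scale1 : left_id 1 tensR_scale.
Proof.
move=> t; elim/tens_ind: t => [|n m|u v hu hv]; first by rewrite !tensR_scale0.
  by rewrite -/(tpairR n m) tensR_scaleE scale1r.
by rewrite !tensR_scaleD hu hv.
Qed.

Fact tensR_scaleDr : right_distributive tensR_scale +%R.
Proof. by move=> a u v; rewrite tensR_scaleD. Qed.

Fact tensR_scaleDl (t : tensR) : {morph (fun a : S => tensR_scale a t) : a b / a + b}.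
Proof.
move=> a b /=; elim/tens_ind: t => [|n m|u v hu hv]; first by rewrite !tensR_scale0 addr0.
  rewrite -/(tpairR n m) !tensR_scaleE scalerDl; exact: tpairDl.
by rewrite !tensR_scaleD hu hv addrACA.
Qed.

HB.instance Definition _ := GRing.Zmodule_isLmodule.Build S tensR
  tensR_scaleA tensR_scale1 tensR_scaleDr tensR_scaleDl.

Fact tpairR_balanced : balanced f tpairR.
Proof.
split=> [n n' m|n m m'|s n m|r n m].
- exact: tpairDl.
- exact: tpairDr.
- by rewrite -tensR_scaleE.
- by rewrite [RHS]tpairZr -[RHS]tpairZl.
Qed.

Definition tens_tensR : {linear tens f N M -> tensR} := tens_lift tpairR_balanced.

Lemma tens_tensRE n m : tens_tensR (tpair f n m) = tpairR n m.
Proof. exact: tens_liftE. Qed.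

Fact tpair_restr_balanced :
  balanced idfun (fun (n : restr f N) (m : M) => tpair f n m : restr f (tens f N M)).
Proof.
split=> [n n' m|n m m'|s n m|r n m].
- exact: tpairDl.
- exact: tpairDr.
- exact: tpairZl.
- by rewrite tpairZr; exact: tpairZl.
Qed.

Lemma tens_tensR_inj : injective tens_tensR.
Proof.
pose g := tens_lift tpair_restr_balanced.
apply: (can_inj (g := g)) => t; elim/tens_ind: t => [|n m|u v hu hv].
- by rewrite linear0; exact: (linear0 g).
- by rewrite tens_tensRE; exact: tens_liftE.
- by rewrite linearD [LHS](linearD g) hu hv.
Qed.

Lemma tens_tensR_surj : surj tens_tensR.
Proof.
move=> t; elim/tens_ind: t => [|n m|u v [s <-] [t <-]].
- by exists 0; exact: linear0.
- by exists (tpair f n m); exact: tens_tensRE.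
- by exists (s + t); exact: linearD.
Qed.
End RestrictedTensor.

Section FlatBaseChange.
Context (R S : comNzRingType) (f : {rmorphism R -> S}) (N : lmodType S).
Context (hflat : flat (restr f N)).

Lemma flat_tens_inj (M M' : lmodType R) (g : {linear M -> M'}) :
  injective g -> injective (tens_map f N g).
Proof.
move=> ig t t' e; apply: tens_tensR_inj; apply: (hflat ig).
have nat u : tens_map idfun (restr f N) g (tens_tensR f N M u) =
    tens_tensR f N M' (tens_map f N g u).
  elim/tens_ind: u => [|n m|u v hu hv]; first by rewrite !linear0; exact: erefl.
    by rewrite tens_tensRE !tens_mapE tens_tensRE; exact: erefl.
  by rewrite !linearD -hu -hv.
by rewrite !nat e.
Qed.

(** Factor [h] through its range: flatness keeps the inclusion injective after tensoring, and right
    exactness describes the kernel of the surjective part. *)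
Lemma flat_tens_ker (U V : lmodType R) (h : {linear U -> V}) t :
  tens_map f N h t = 0 ->
  span [set x | exists n u, h u = 0 /\ x = tpair f n u] t.
Proof.
have hr := submodule_range h; have hk := submodule_ker h.
have [q qE] := @submod_corestrict _ _ _ hr _ h (fun u => ex_intro2 _ _ u I erefl).
have sq : surj q.
  move=> v; have [u _ e] := submod_inP v; exists u.
  by apply: submod_in_inj; rewrite qE.
have ex : exact_at (submod_in hk) q.
  move=> v; split=> [e|[u <-]].
    by apply: submod_onto; rewrite /= -qE e linear0.
  by apply: (@submod_in_inj _ _ _ hr); rewrite qE linear0; exact: (submod_inP u).
rewrite (tens_map_comp _ (g := q) (h := submod_in hr)) => [|u]; last by rewrite qE.
move/(inj_lin0 (flat_tens_inj (@submod_in_inj _ _ _ hr))).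
move/(@tens_exact _ _ f N _ _ _ _ _ ex sq _) => [u <-].
elim/tens_ind: u => [|n m|u v hu hv].
- by rewrite linear0; left.
- rewrite tens_mapE; apply: span_sub; exists n, (submod_in hk m); split=> //.
  exact: (submod_inP m).
- rewrite linearD; exact: (submodD (submodule_span _)).
Qed.

(** The maps [h k] are bundled into a single map to [V^n]; [recon] recovers a tensor over [V^n] from
    its coordinates. *)
Lemma flat_tens_joint_ker (U V : lmodType R) n (h : 'I_n -> {linear U -> V}) t :
  (forall k, tens_map f N (h k) t = 0) ->
  span [set x | exists n u, (forall k, h k u = 0) /\ x = tpair f n u] t.
Proof.
move=> h0.
have Hl a u v : [ffun k => h k (a *: u + v)] =
    a *: [ffun k => h k u] + [ffun k => h k v] :> {ffun 'I_n -> V}.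
  by apply/ffunP => k; rewrite !ffunE linearP.
have pl k a (u v : {ffun 'I_n -> V}) : (a *: u + v) k = a *: u k + v k by rewrite !ffunE.
have dl k a (u v : V) : [ffun j => if j == k then a *: u + v else 0] =
    a *: [ffun j => if j == k then u else 0] + [ffun j => if j == k then v else 0]
    :> {ffun 'I_n -> V}.
  by apply/ffunP => j; rewrite !ffunE; case: ifP => // _; rewrite scaler0 addr0.
pose pr k : {linear {ffun 'I_n -> V} -> V} := mklin (pl k).
pose de k : {linear V -> {ffun 'I_n -> V}} := mklin (dl k).
have recon v : v = \sum_k tens_map f N (de k) (tens_map f N (pr k) v).
  elim/tens_ind: v => [|m v|u v hu hv].
  - by rewrite big1 // => k _; rewrite !linear0.
  - rewrite (eq_bigr (fun k => tpair f m (de k (pr k v)))); last by move=> k _; rewrite !tens_mapE.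
    rewrite -tpair_sum; congr (tpair _ _ _); apply/ffunP => j.
    rewrite sum_ffunE (bigD1 j) //= big1 ?addr0; first by rewrite !ffunE eqxx.
    by move=> k kj; rewrite !ffunE eq_sym (negPf kj).
  - rewrite [in LHS]hu [in LHS]hv -big_split; apply: eq_bigr => k _.
    by rewrite !linearD.
have H0 : tens_map f N (mklin Hl) t = 0.
  rewrite [LHS]recon big1 // => k _.
  rewrite -(tens_map_comp (k := h k)) ?h0 ?linear0 // => u.
  by rewrite /= ffunE.
apply: (span_min (submodule_span _)) (flat_tens_ker H0) => _ [m [u [u0 ->]]].
apply: span_sub; exists m, u; split=> // k.
by have /ffunP/(_ k) := u0; rewrite !ffunE.
Qed.
End FlatBaseChange.

(* A homogeneous linear system over [R] with unknowns in [R] and in [M]: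
   after a flat base change its solutions are spanned by the old ones. *)
Lemma flat_solutions (R S : comNzRingType) (f : {rmorphism R -> S}) (M : lmodType R)
    (hflat : flat (restr f S^o)) p q n (xi : 'I_p -> 'I_n -> M) (B : 'I_n -> 'I_q -> R)
    (c : 'I_p -> S) (v : 'I_q -> tens f S^o M) :
  (forall k, \sum_j c j *: tpair f (1 : S^o) (xi j k) + \sum_l f (B k l) *: v l = 0) ->
  exists d (s : 'I_d -> S) (r : 'I_d -> 'I_p -> R) (w : 'I_d -> 'I_q -> M),
    [/\ forall i k, \sum_j r i j *: xi j k + \sum_l B k l *: w i l = 0,
        forall j, c j = \sum_i s i * f (r i j) &
        forall l, v l = \sum_i s i *: tpair f (1 : S^o) (w i l)].
Proof.
move=> h0; pose U : lmodType R := ({ffun 'I_p -> R^o} * {ffun 'I_q -> M})%type.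
have hl k a (u u' : U) :
    \sum_j (a *: u + u').1 j *: xi j k + \sum_l B k l *: (a *: u + u').2 l =
    a *: (\sum_j u.1 j *: xi j k + \sum_l B k l *: u.2 l) +
    (\sum_j u'.1 j *: xi j k + \sum_l B k l *: u'.2 l).
  rewrite scalerDr addrACA !scaler_sumr -!big_split /=; congr (_ + _); apply: eq_bigr => j _.
    by rewrite !ffunE scalerDl -scalerA.
  by rewrite !ffunE scalerDr !scalerA mulrC.
pose h k : {linear U -> M} := mklin (hl k).
have dl l a (u u' : M) : (0, [ffun j => if j == l then a *: u + u' else 0]) =
    a *: (0, [ffun j => if j == l then u else 0]) + (0, [ffun j => if j == l then u' else 0]) :> U.
  congr (_, _); first by rewrite /= scaler0 addr0.
  by apply/ffunP => j; rewrite !ffunE; case: ifP => // _; rewrite scaler0 addr0.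
pose de l : {linear M -> U} := mklin (dl l).
pose dr j : U := ([ffun k => (k == j)%:R], 0).
(* The pair [(c, v)] as one element of [S (x) (R^p x M^q)]; the maps [h k] are the equations of the
   system. *)
pose t := \sum_j c j *: tpair f (1 : S^o) (dr j) + \sum_l tens_map f S^o (de l) (v l).
have ht k : tens_map f S^o (h k) t = 0.
  rewrite -[RHS](h0 k) linearD !linear_sum; congr (_ + _); apply: eq_bigr => j _.
    rewrite linearZ_LR tens_mapE; congr (_ *: tpair _ _ _) => /=.
    rewrite [X in _ + X]big1 ?addr0 => [|i _]; last by rewrite ffunE /= scaler0.
    rewrite (bigD1 j) //= !ffunE eqxx scale1r big1 ?addr0 // => i /negPf ij.
    by rewrite !ffunE ij scale0r.
  elim/tens_ind: (v j) => [|a m|x y hx hy]; first by rewrite !linear0 ?scaler0.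
    rewrite !tens_mapE -tpairZr; congr (tpair _ _ _) => /=.
    rewrite big1 ?add0r => [|i _]; last by rewrite ffunE scale0r.
    rewrite (bigD1 j) //= !ffunE eqxx big1 ?addr0 // => i /negPf ij.
    by rewrite !ffunE ij scaler0.
  by rewrite !linearD hx hy.
have [d [s [x [hx tE]]]] := spanP (flat_tens_joint_ker hflat ht).
have [a ha] := choice hx; have [u hu] := choice ha.
exists d, (fun i => s i * a i), (fun i j => (u i).1 j), (fun i l => (u i).2 l).
(* [b1 j] and [b2 l] read the coordinates [c j] and [v l] back off a tensor. *)
have b1 j : balanced f (fun (n : S^o) (u : U) => n * f (u.1 j) : S^o).
  split=> [m m' w|m w w'|b m w|b m w] /=.
  - exact: mulrDl.
  - by rewrite ffunE rmorphD mulrDr.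
  - by rewrite -scalerAl.
  - by rewrite ffunE rmorphM mulrA -[RHS]mulrA [m * _]mulrC -mulrA mulrCA mulrC !mulrA mulrC.
have b2 l : balanced f (fun (n : S^o) (u : U) => tpair f n (u.2 l)).
  split=> [m m' w|m w w'|b m w|b m w] /=.
  - exact: tpairDl.
  - by rewrite ffunE tpairDr.
  - exact: tpairZl.
  - by rewrite ffunE tpairZl tpairZr.
split=> [i k|j|l].
- exact: (hu i).1.
- have := congr1 (tens_lift (b1 j)) tE; rewrite linearD !linear_sum.
  rewrite [X in _ + X]big1 ?addr0 => [|l _]; last first.
    elim/tens_ind: (v l) => [|m w|y z hy hz]; first by rewrite !linear0.
      by rewrite tens_mapE tens_liftE /= ffunE rmorph0 mulr0.
    by rewrite !linearD hy hz addr0.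
  rewrite (bigD1 j) // big1 => [|i ij]; last first.
    by rewrite linearZ_LR tens_liftE /= ffunE eq_sym (negPf ij) rmorph0 mulr0 scaler0.
  have -> : tens_lift (b1 j) (c j *: tpair f (1 : S^o) (dr j)) = c j.
    by rewrite linearZ_LR tens_liftE /= ffunE eqxx rmorph1 mulr1 -[LHS]/(c j * 1) mulr1.
  move=> e; rewrite -[LHS]addr0 [LHS]e; apply: eq_bigr => i _.
  by rewrite linearZ_LR (hu i).2 tens_liftE /= -mulrA.
- have := congr1 (tens_lift (b2 l)) tE; rewrite linearD !linear_sum.
  rewrite [X in X + _]big1 ?add0r => [|j _]; last first.
    by rewrite linearZ_LR tens_liftE /= ffunE tpair0 scaler0.
  have E i w : tens_lift (b2 l) (tens_map f S^o (de i) w) = if i == l then w else 0.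
    elim/tens_ind: w => [|m w|y z hy hz]; first by rewrite !linear0; case: ifP.
      by rewrite tens_mapE tens_liftE /= ffunE eq_sym; case: ifP => // _; exact: tpair0.
    by rewrite !linearD hy hz; case: ifP => // _; exact: addr0.
  rewrite (eq_bigr (fun i => if i == l then v i else 0)) => [|i _]; last exact: E.
  rewrite -big_mkcond big_pred1_eq => ->; apply: eq_bigr => i _; rewrite linearZ_LR (hu i).2 tens_liftE -scalerA.
  by congr (_ *: _); rewrite -tpairZl; congr (tpair _ _ _); rewrite -[_ *: _]/(_ * _) mulr1.
Qed.

(** * Minimal free resolutions *)

Section RowVectors.
Context (A : comNzRingType) (V : lmodType A).

Fact rvcomb_linear n (x : {ffun 'I_n -> V}) a (u v : 'rV[A]_n) :
  \sum_j (a *: u + v) 0 j *: x j = a *: (\sum_j u 0 j *: x j) + \sum_j v 0 j *: x j.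
Proof.
rewrite scaler_sumr -big_split /=; apply: eq_bigr => j _.
by rewrite !mxE scalerDl scalerA.
Qed.

Definition rvcomb n (x : {ffun 'I_n -> V}) : {linear 'rV[A]_n -> V} :=
  mklin (rvcomb_linear x).

Lemma rvcombE n (x : {ffun 'I_n -> V}) u : rvcomb x u = \sum_j u 0 j *: x j.
Proof. by []. Qed.

Lemma rvcomb0 n (u : 'rV[A]_n) : rvcomb 0 u = 0.
Proof. by rewrite rvcombE big1 // => j _; rewrite ffunE scaler0. Qed.

Lemma rvcomb_delta n (x : {ffun 'I_n -> V}) j : rvcomb x (delta_mx 0 j) = x j.
Proof.
rewrite rvcombE (bigD1 j) //= mxE !eqxx scale1r big1 ?addr0 // => i /negPf ij.
by rewrite mxE ij andbF scale0r.
Qed.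

Lemma rvcomb_eta n (h : {linear 'rV[A]_n -> V}) u :
  h u = rvcomb [ffun j => h (delta_mx 0 j)] u.
Proof.
rewrite {1}[u]row_sum_delta linear_sum; apply: eq_bigr => j _.
by rewrite linearZ_LR ffunE.
Qed.

Fact mxact_linear p q (B : 'M[A]_(p, q)) a (u v : {ffun 'I_q -> V}) :
  [ffun k => \sum_l B k l *: (a *: u + v) l] =
  a *: [ffun k => \sum_l B k l *: u l] + [ffun k => \sum_l B k l *: v l] :> {ffun 'I_p -> V}.
Proof.
apply/ffunP => k; rewrite !ffunE scaler_sumr -big_split /=; apply: eq_bigr => l _.
by rewrite !ffunE scalerDr !scalerA mulrC.
Qed.

(** Precomposition with [rowmul B], once [rvcomb] identifies tuples in [V] with maps out of free
    modules: [Hom(P, V)] becomes the matrices [md P i] acting on tuples. *)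
Definition mxact p q (B : 'M[A]_(p, q)) : {linear {ffun 'I_q -> V} -> {ffun 'I_p -> V}} :=
  mklin (mxact_linear B).

Lemma mxactE p q (B : 'M[A]_(p, q)) v k : mxact B v k = \sum_l B k l *: v l.
Proof. by rewrite ffunE. Qed.

Lemma rvcomb_mulmx p q (B : 'M[A]_(p, q)) (v : {ffun 'I_q -> V}) u :
  rvcomb v (u *m B) = rvcomb (mxact B v) u.
Proof.
rewrite !rvcombE (eq_bigr (fun l => \sum_k (u 0 k * B k l) *: v l)); last first.
  by move=> l _; rewrite mxE scaler_suml.
rewrite exchange_big /=; apply: eq_bigr => k _; rewrite ffunE scaler_sumr.
by apply: eq_bigr => l _; rewrite scalerA.
Qed.

Lemma rvcomb_inj n (x y : {ffun 'I_n -> V}) : rvcomb x =1 rvcomb y -> x = y.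
Proof. by move=> e; apply/ffunP => j; rewrite -!rvcomb_delta e. Qed.

End RowVectors.

Arguments mxact {A V p q} B.

Definition rowmul (A : comNzRingType) p q (B : 'M[A]_(p, q)) :
  {linear 'rV[A]_p -> 'rV[A]_q} := mulmxr B.

Lemma projective_rV (A : comNzRingType) n : projective ('rV[A]_n : lmodType A).
Proof.
move=> M N p g sp; have [y yE] := choice (fun j : 'I_n => sp (g (delta_mx 0 j))).
exists (rvcomb [ffun j => y j]) => u.
rewrite (rvcomb_eta g) !rvcombE linear_sum; apply: eq_bigr => j _.
by rewrite linearZ_LR !ffunE yE.
Qed.

Lemma finite_rV (A : comNzRingType) n : finite_module ('rV[A]_n : lmodType A).
Proof.
apply/finite_moduleP; exists n, (fun j => delta_mx 0 j) => v.
by exists (fun j => v 0 j); exact: row_sum_delta.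
Qed.

(** Resolutions by finite free modules ['rV_(mg i)], given by matrices acting on
    row vectors from the right. *)
Record mxresol (A : comNzRingType) (V : lmodType A) := MxResol {
  mg : nat -> nat;
  md : forall i, 'M[A]_(mg i.+1, mg i);
  mx : {ffun 'I_(mg 0%N) -> V};
  mx_gen : surj (rvcomb mx);
  mx_rel : forall u, rvcomb mx u = 0 <-> exists w, w *m md 0%N = u;
  md_ex : forall i (u : 'rV_(mg i.+1)), u *m md i = 0 <-> exists w : 'rV_(mg i.+2), w *m md i.+1 = u
}.

Section ResolutionOfMxresol.
Context (A : comNzRingType) (V : lmodType A) (P : mxresol V).

Lemma md_dd i : md P i.+1 *m md P i = 0.
Proof.
apply/row_matrixP => k; rewrite row_mul row0; apply/md_ex.
by exists (delta_mx 0 k); rewrite -rowE.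
Qed.

Fact mxresol_ex0 : exact_at (rowmul (md P 0%N)) (rvcomb (mx P)).
Proof. by move=> u; exact: mx_rel. Qed.

Fact mxresol_ex i : exact_at (rowmul (md P i.+1))
  (rowmul (md P i)).
Proof. by move=> u; exact: md_ex. Qed.

Definition mxresolution : resolution (@projective A) V :=
  @Resolution A (@projective A) V (fun i => 'rV[A]_(mg P i))
    (fun i => rowmul (md P i)) (rvcomb (mx P)) (fun i => @projective_rV A (mg P i))
    (@mx_gen _ _ P) mxresol_ex0 mxresol_ex.

(** Exactness of [Hom(P, W)] in degree [i.+1], that is, the vanishing of [Ext^(i+1)(V, W)]. *)
Definition mxexact (W : lmodType A) i :=
  forall v : {ffun 'I_(mg P i.+1) -> W}, mxact (md P i.+1) v = 0 ->
    exists w, v = mxact (md P i) w.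

Lemma mxexact_Ext (W : lmodType A) i : mxexact W i <->
  forall phi : {linear mxresolution i.+1 -> W}, Hom_cocycle phi -> Hom_coboundary phi.
Proof.
split=> [h phi phic|h v vc].
  have [|w wE] := h [ffun j => phi (delta_mx 0 j)].
    apply: rvcomb_inj => u; rewrite -rvcomb_mulmx -rvcomb_eta.
    by rewrite rvcomb0; exact: phic.
  exists (rvcomb w) => u; rewrite (rvcomb_eta phi) wE -rvcomb_mulmx //.
have [|psi psiE] := h (rvcomb v).
  move=> u; by rewrite [LHS]rvcomb_mulmx vc rvcomb0.
exists [ffun j => psi (delta_mx 0 j)].
by apply: rvcomb_inj => u; rewrite -rvcomb_mulmx -rvcomb_eta psiE.
Qed.

Lemma Ext_mxexact (W : lmodType A) i : Ext_zero i.+1 V W <-> mxexact W i.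
Proof.
split=> [E|h]; first by apply/mxexact_Ext => phi; exact: Ext_zero_indep.
by exists mxresolution; apply/mxexact_Ext.
Qed.
End ResolutionOfMxresol.

Section FreeResolution.
Context (A : comNzRingType) (m : set A) (hm : local_ring m).

Lemma minimal_cover (V : lmodType A) q (h : {linear 'rV[A]_q -> V}) :
  exists p (C : 'M[A]_(p, q)), (forall u, h u = 0 <-> exists w : 'rV_p, w *m C = u) /\
    forall w : 'rV_p, w *m C = 0 -> forall j, m (w 0 j).
Proof.
have hk := submodule_ker h; have h0 := submodule_set0 ('rV[A]_q : lmodType A).
have [n [x [[xk xg] xm]]] := minimal_generators hm h0
  (noetherian_sub (local_noeth hm) (finite_rV A q) hk).
pose C := \matrix_(i < n, j < q) x i 0 j.
have CE (w : 'rV_n) : w *m C = \sum_j w 0 j *: x j.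
  rewrite mulmx_sum_row; apply: eq_bigr => i _; congr (_ *: _).
  by apply/rowP => j; rewrite !mxE.
exists n, C; split=> [u|w]; last by rewrite CE => /xm.
split=> [/xg[c cE]|[w <-]].
  exists (\row_j c j); rewrite CE; apply/esym/eqP; rewrite -subr_eq0; apply/eqP.
  by rewrite -[RHS]cE; congr (_ - _); apply: eq_bigr => j _; rewrite mxE.
by rewrite CE; apply: (submod_comb hk).
Qed.

Definition cover_rk (V : lmodType A) q (h : {linear 'rV[A]_q -> V}) : nat :=
  sval (cid (minimal_cover h)).
Definition cover_mx (V : lmodType A) q (h : {linear 'rV[A]_q -> V}) : 'M[A]_(cover_rk h, q) :=
  sval (cid (svalP (cid (minimal_cover h)))).
Lemma cover_mxP (V : lmodType A) q (h : {linear 'rV[A]_q -> V}) :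
  (forall u, h u = 0 <-> exists w : 'rV_(cover_rk h), w *m cover_mx h = u) /\
    forall w : 'rV_(cover_rk h), w *m cover_mx h = 0 -> forall j, m (w 0 j).
Proof. exact: (svalP (cid (svalP (cid (minimal_cover h))))). Qed.

(** The size of each matrix depends on the choices before it, so matrices are bundled with their
    dimensions before iterating. *)
Record stage := Stage { stage_col : nat; stage_row : nat; stage_mx : 'M[A]_(stage_row, stage_col) }.

Definition stage_next s := Stage (cover_mx (rowmul (stage_mx s))).

Context (V : lmodType A) n (x : {ffun 'I_n -> V}) (xg : surj (rvcomb x)).

Definition stages i := iter i stage_next (Stage (cover_mx (rvcomb x))).

Definition free_dim i := stage_col (stages i).
Definition free_mx i : 'M[A]_(free_dim i.+1, free_dim i) := stage_mx (stages i).

Lemma free_mx_ex i (u : 'rV_(free_dim i.+1)) :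
  u *m free_mx i = 0 <-> exists w : 'rV_(free_dim i.+2), w *m free_mx i.+1 = u.
Proof. exact: (cover_mxP (rowmul (stage_mx (stages i)))).1. Qed.

Lemma free_mx_rel u : rvcomb x u = 0 <-> exists w : 'rV_(free_dim 1%N), w *m free_mx 0%N = u.
Proof. exact: (cover_mxP (rvcomb x)).1. Qed.

Definition free_res : mxresol V :=
  @MxResol A V free_dim free_mx x xg free_mx_rel free_mx_ex.

Lemma free_mx_min i (w : 'rV_(free_dim i.+1)) : w *m free_mx i = 0 -> forall j, m (w 0 j).
Proof.
case: i w => [|i] w; first exact: (cover_mxP (rvcomb x)).2.
exact: (cover_mxP (rowmul (stage_mx (stages i)))).2.
Qed.

(** Row [k] of [free_mx i] is a relation among the generators chosen one step earlier, whose
    minimality forces the coefficients into [m]; for [i = 0] those generators are the family [x]. *)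
Lemma free_mx_entries (xm : forall u, rvcomb x u = 0 -> forall j, m (u 0 j)) i k j :
  m (free_mx i k j).
Proof.
have -> : free_mx i k j = row k (free_mx i) 0 j by rewrite mxE.
rewrite rowE; case: i k j => [|i] k j; first by apply: xm; apply/free_mx_rel; exists (delta_mx 0 k).
by apply: (@free_mx_min i); apply/free_mx_ex; exists (delta_mx 0 k).
Qed.
End FreeResolution.

Lemma minimal_mxresol (A : comNzRingType) (m : set A) (hm : local_ring m) (V : lmodType A) :
  finite_module V -> exists P : mxresol V, forall i k j, m (md P i k j).
Proof.
move=> fV; have [n0 [x0 x0g]] := (finite_moduleP V).1 fV.
have fg : fg_mod [set: V] [set 0].
  by exists n0, x0; split=> // z _; have [c ->] := x0g z; exists c; rewrite subrr.
have [n [x [[_ xg] xm]]] := minimal_generators hm (submodule_set0 V) fg.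
have xg' : surj (rvcomb [ffun j => x j]).
  move=> v; have [c cE] := xg v I; exists (\row_j c j).
  apply/esym/eqP; rewrite -subr_eq0 -[X in _ == X]cE rvcombE; apply/eqP; congr (_ - _).
  by apply: eq_bigr => j _; rewrite mxE ffunE.
have xm' u : rvcomb [ffun j => x j] u = 0 -> forall j, m (u 0 j).
  move=> u0; apply: xm; rewrite /= -[RHS]u0 rvcombE.
  by apply: eq_bigr => l _; rewrite ffunE.
exists (free_res hm xg') => i k j; exact: (free_mx_entries (hm := hm) xm' k j).
Qed.

(** * Base change of a resolution *)

Lemma nakayama_module (A : comNzRingType) (m : set A) (hm : local_ring m) (V : lmodType A) :
  finite_module V ->
  (forall u : V, exists q (a : 'I_q -> A) (w : 'I_q -> V),
     (forall l, m (a l)) /\ u = \sum_l a l *: w l) ->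
  forall u : V, u = 0.
Proof.
move=> /finite_moduleP[n [x xg]] mV u.
have x0 : forall j, x j = 0.
  apply: (nakayama_family hm (submodule_set0 V)) => j.
  have [q [a [w [ma ->]]]] := mV (x j).
  have [c cE] := choice (fun l => xg (w l)).
  exists (fun k => \sum_l c l k * a l).
    by move=> k; apply: (submod_sum (ideal_submodule (local_ideal hm))) => l _; exact: local_mul.
  apply/eqP; rewrite subr_eq0; apply/eqP.
  rewrite (eq_bigr (fun l => \sum_k (c l k * a l) *: x k)) => [|l _]; last first.
    by rewrite {1}(cE l) scaler_sumr; apply: eq_bigr => k _; rewrite scalerA mulrC.
  by rewrite exchange_big; apply: eq_bigr => k _; rewrite scaler_suml.
by have [c ->] := xg u; rewrite big1 // => j _; rewrite x0 scaler0.
Qed.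

Section BaseChange.
Context (R S : comNzRingType) (f : {rmorphism R -> S}) (hflat : flat (restr f S^o)).
Context (M : lmodType R) (P : mxresol M).
Local Notation N := (tens f S^o M).

Definition bc_gen : {ffun 'I_(mg P 0) -> N} := [ffun j => tpair f (1 : S^o) (mx P j)].

Lemma tpair1 (W : lmodType R) (s : S) (w : W) :
  tpair f (s : S^o) w = s *: tpair f (1 : S^o) w.
Proof. by rewrite -(@tpairZl _ _ f S^o) -[s *: 1]/(s * 1) mulr1. Qed.

Lemma mxact_tpair1 (W : lmodType R) p q (B : 'M[R]_(p, q)) (w : {ffun 'I_q -> W}) :
  mxact (map_mx f B) [ffun l => tpair f (1 : S^o) (w l)] =
  [ffun k => tpair f (1 : S^o) (mxact B w k)].
Proof.
apply/ffunP => k; rewrite !ffunE tpair_sum; apply: eq_bigr => l _.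
by rewrite ffunE mxE tpairZr.
Qed.

Lemma bc_gen_surj : surj (rvcomb bc_gen).
Proof.
move=> t; elim/tens_ind: t => [|s w|u v [u' <-] [v' <-]].
- by exists 0; exact: linear0.
- have [u <-] := mx_gen P w.
  exists (\row_j (s * f (u 0 j))); rewrite !rvcombE tpair_sum; apply: eq_bigr => j _.
  by rewrite mxE ffunE tpairZr [in RHS]tpair1 scalerA mulrC.
- by exists (u' + v'); exact: linearD.
Qed.

Lemma bc_rel (u : 'rV[S]_(mg P 0)) :
  rvcomb bc_gen u = 0 <-> exists w : 'rV_(mg P 1), w *m map_mx f (md P 0) = u.
Proof.
split=> [u0|[w <-]]; last first.
  rewrite rvcomb_mulmx mxact_tpair1 rvcombE big1 // => k _.
  suff -> : mxact (md P 0) (mx P) = 0 by rewrite !ffunE tpair0 scaler0.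
  apply: rvcomb_inj => v; rewrite -rvcomb_mulmx rvcomb0.
  by apply/mx_rel; exists v.
have [|d [s [r [w [hr cE _]]]]] := @flat_solutions _ _ f M hflat _ 0 1
  (fun j _ => mx P j) (fun _ _ => 0) (fun j => u 0 j) (fun _ => 0).
  move=> k; rewrite big_ord0 addr0 -[RHS]u0 rvcombE; apply: eq_bigr => j _.
  by rewrite ffunE.
have hr' i : exists v : 'rV_(mg P 1), v *m md P 0 = \row_j r i j.
  apply/mx_rel; have := hr i ord0; rewrite big_ord0 addr0 => <-.
  by rewrite rvcombE; apply: eq_bigr => j _; rewrite mxE.
have [v vE] := choice hr'.
exists (\sum_i s i *: map_mx f (v i)); rewrite mulmx_suml; apply/rowP => j.
rewrite summxE cE; apply: eq_bigr => i _.
by rewrite -scalemxAl -map_mxM vE !mxE.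
Qed.

(** Being killed by [B] is a system with coefficients in [R] itself, so [flat_solutions] applies
    with [R^o] as the module and no module unknowns. *)
Lemma flat_mx_ex a b c (B : 'M[R]_(b, c)) (C : 'M[R]_(a, b)) :
  (forall u : 'rV_b, u *m B = 0 <-> exists w : 'rV_a, w *m C = u) ->
  forall u : 'rV_b, u *m map_mx f B = 0 <-> exists w : 'rV_a, w *m map_mx f C = u.
Proof.
move=> ex u; split=> [u0|[w <-]]; last first.
  rewrite -mulmxA -map_mxM; suff -> : C *m B = 0 by rewrite map_mx0 mulmx0.
  apply/row_matrixP => k; rewrite row_mul row0; apply/ex.
  by exists (delta_mx 0 k); rewrite -rowE.
have [|d [s [r [w [hr cE _]]]]] := @flat_solutions _ _ f R^o hflat _ 0 c
  (fun j k => B j k) (fun _ _ => 0) (fun j => u 0 j) (fun _ => 0).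
  move=> k; rewrite big_ord0 addr0.
  transitivity ((u *m map_mx f B) 0 k *: tpair f (1 : S^o) (1 : R^o)); last by rewrite u0 mxE scale0r.
  rewrite mxE scaler_suml; apply: eq_bigr => j _; rewrite mxE.
  by rewrite -scalerA -tpairZr -[B j k *: 1]/(B j k * 1) mulr1.
have hr' i : exists v : 'rV_a, v *m C = \row_j r i j.
  apply/ex/rowP => k; have := hr i k; rewrite big_ord0 addr0 => e.
  by rewrite !mxE -[RHS]e; apply: eq_bigr => j _; rewrite mxE.
have [v vE] := choice hr'.
exists (\sum_i s i *: map_mx f (v i)); rewrite mulmx_suml; apply/rowP => j.
rewrite summxE cE; apply: eq_bigr => i _.
by rewrite -scalemxAl -map_mxM vE !mxE.
Qed.

Definition bc_mxresol : mxresol N :=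
  @MxResol S N (mg P) (fun i => map_mx f (md P i)) bc_gen bc_gen_surj bc_rel
    (fun i => flat_mx_ex (@md_ex _ _ P i)).

Lemma flat_mxact_ker (W : lmodType R) p q (B : 'M[R]_(p, q)) (v : {ffun 'I_q -> tens f S^o W}) :
  mxact (map_mx f B) v = 0 ->
  exists d (s : 'I_d -> S) (w : 'I_d -> {ffun 'I_q -> W}),
    (forall i, mxact B (w i) = 0) /\
    v = \sum_i s i *: [ffun l => tpair f (1 : S^o) (w i l)].
Proof.
move=> v0; have [|d [s [r [w [hw _ vE]]]]] := @flat_solutions _ _ f W hflat 0 q p
  (fun _ _ => 0) (fun k l => B k l) (fun _ => 0) (fun l => v l).
  move=> k; rewrite big_ord0 add0r; transitivity (mxact (map_mx f B) v k).
    by rewrite ffunE; apply: eq_bigr => l _; rewrite mxE.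
  by rewrite v0 ffunE.
exists d, s, (fun i => [ffun l => w i l]); split=> [i|].
  apply/ffunP => k; have := hw i k; rewrite big_ord0 add0r => e.
  by rewrite !ffunE -[RHS]e; apply: eq_bigr => l _; rewrite ffunE.
apply/ffunP => l; rewrite vE sum_ffunE; apply: eq_bigr => i _.
by rewrite !ffunE.
Qed.

Lemma bc_mxexact (W : lmodType R) i :
  mxexact P W i -> mxexact bc_mxresol (tens f S^o W) i.
Proof.
move=> ex v /flat_mxact_ker[d [s [w [w0 ->]]]].
have [y yE] := choice (fun k => ex (w k) (w0 k)).
exists (\sum_k s k *: [ffun l => tpair f (1 : S^o) (y k l)]).
rewrite linear_sum; apply: eq_bigr => k _.
by rewrite linearZ_LR; congr (_ *: _); rewrite [RHS]mxact_tpair1 {1}(yE k).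
Qed.

(** An endomorphism is fixed by its values on the generators, a tuple killed by the relation matrix.
    By flatness this tuple is a combination of tuples coming from endomorphisms of [M], which are
    homotheties. *)
Lemma bc_homothety : homothety_iso M -> homothety_iso N.
Proof.
move=> hM phi.
pose v := [ffun j => phi (bc_gen j)].
have v0 : mxact (map_mx f (md P 0)) v = 0.
  apply: rvcomb_inj => u; rewrite -rvcomb_mulmx rvcomb0.
  transitivity (phi (rvcomb bc_gen (u *m map_mx f (md P 0)))).
    by rewrite !rvcombE linear_sum; apply: eq_bigr => j _; rewrite linearZ_LR ffunE.
  suff -> : rvcomb bc_gen (u *m map_mx f (md P 0)) = 0 by exact: linear0.
  by apply/bc_rel; exists u.
have [d [s [w [w0 vE]]]] := flat_mxact_ker v0.
have ha i : exists a, forall l, w i l = a *: mx P l.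
  have [g gE] : exists g : {linear M -> M}, forall u, g (rvcomb (mx P) u) = rvcomb (w i) u.
    apply: (surj_inv_lin (h := rvcomb (w i)) (@mx_gen _ _ P)) => u /mx_rel[t <-].
    by rewrite rvcomb_mulmx w0 rvcomb0.
  have [a [aE _]] := hM g; exists a => l.
  by rewrite -rvcomb_delta -gE rvcomb_delta aE.
have [a aE] := choice ha.
exists (\sum_i s i * f (a i)); split=> [t|b bE].
  have [u <-] := bc_gen_surj t; rewrite rvcombE linear_sum [RHS]linear_sum; apply: eq_bigr => j _.
  rewrite linearZ_LR [RHS]linearZ_LR; congr (_ *: _).
  have -> : phi (bc_gen j) = v j by rewrite [RHS]ffunE.
  rewrite vE sum_ffunE /homothety /= scaler_suml; apply: eq_bigr => i _.
  by rewrite !ffunE aE tpairZr scalerA.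
apply/eqP; rewrite -subr_eq0; apply/eqP.
(* Uniqueness: [c] kills the generators, so by flatness it is a combination of images of elements of
   [R] that kill [M], and these are 0. *)
set c := _ - b.
have cx k : c *: tpair f (1 : S^o) (mx P k) = 0.
  have -> : tpair f (1 : S^o) (mx P k) = bc_gen k by rewrite ffunE.
  rewrite scalerBl; apply/eqP; rewrite subr_eq0; apply/eqP.
  have := bE (bc_gen k); rewrite /homothety /= => <-.
  have -> : phi (bc_gen k) = v k by rewrite [RHS]ffunE.
  rewrite vE sum_ffunE scaler_suml; apply: eq_bigr => i _.
  by rewrite !ffunE aE tpairZr scalerA.
have [|e [s' [r [w' [hr cE _]]]]] := @flat_solutions _ _ f M hflat 1 0 (mg P 0)
  (fun _ k => mx P k) (fun _ _ => 0) (fun _ => c) (fun _ => 0).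
  by move=> k; rewrite big_ord0 addr0 big_ord1 cx.
rewrite (cE ord0) big1 // => i _.
suff -> : r i ord0 = 0 by rewrite rmorph0 mulr0.
have rx k : r i ord0 *: mx P k = 0 by have := hr i k; rewrite big_ord0 addr0 big_ord1.
have [a0 [_ a0u]] := hM \0.
rewrite -(a0u 0) => [|u]; last by rewrite /homothety /= scale0r.
apply/esym/a0u => u; have [t <-] := mx_gen P u.
rewrite rvcombE /homothety /= scaler_sumr big1 // => j _.
by rewrite scalerA mulrC -scalerA rx scaler0.
Qed.

Lemma bc_finite : finite_module N.
Proof.
apply/finite_moduleP; exists (mg P 0), bc_gen => v.
have [u <-] := bc_gen_surj v; by exists (fun j => u 0 j).
Qed.

Lemma bc_semidualizing : semidualizing M -> semidualizing N.
Proof.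
move=> [_ hM eM]; split; [exact: bc_finite | exact: bc_homothety |].
case=> // i _; apply/(Ext_mxexact bc_mxresol)/bc_mxexact/Ext_mxexact.
exact: eM.
Qed.

Section Local.
Context (m : set R) (hR : local_ring m) (n : set S) (hS : local_ring n).
Context (hf : forall a, m a -> n (f a)) (minP : forall i k j, m (md P i k j)).

(** Tested on the residue field [V = S/n]: the differentials have entries in [n] and act on [V] as
    zero, so [Ext^(p+1)(N, V)] is [V^(mg P p.+1)], while it vanishes if some projective resolution
    stops at degree [p]. *)
Lemma pd_finite_rank : pd_finite N -> exists i, mg P i.+1 = 0%N.
Proof.
move=> [p [Q Q0]]; exists p.
pose V := @modquot S S^o n.
have hn : @submodule S S^o n := ideal_submodule (local_ideal hS).
have nV a (u : V) : n a -> a *: u = 0.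
  move=> na; have [v <-] := modpi_surj u; rewrite -linearZ_LR; apply/(modpi_eq0 hn).
  by rewrite -[a *: v]/(a * v) mulrC; apply: (local_mul hS).
have EV : Ext_zero p.+1 N V.
  exists Q => phi _; exists \0 => u /=.
  by rewrite (Q0 p.+1 _ u) ?linear0.
have act0 i (w : {ffun 'I_(mg P i) -> V}) : mxact (map_mx f (md P i)) w = 0.
  apply/ffunP => k; rewrite !ffunE big1 // => j _; rewrite mxE nV //.
  exact: hf.
move/(Ext_mxexact bc_mxresol) : EV => ex.
have [w] := ex [ffun=> modpi (n : set S^o) 1] (act0 _ _).
rewrite act0 => /ffunP w0; case E: (mg P p.+1) => [//|k]; exfalso.
have j : 'I_(mg P p.+1) by rewrite E; exact: ord0.
by have := w0 j; rewrite !ffunE => /(modpi_eq0 hn) /(local_proper hS).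
Qed.

(** If term [i.+2] is zero and term [i.+1] is not, every constant tuple in degree [i.+1] is a
    cocycle. Being a coboundary under a matrix with entries in [m], it has its value in [m M]; so
    [M = m M]. *)
Lemma mg_zero : finite_module M -> (exists u : M, u <> 0) ->
  (forall i, mxexact P M i) -> (exists i, mg P i.+1 = 0%N) -> mg P 1 = 0%N.
Proof.
move=> fM [u0 u0n] ex [i]; elim: i => [//|i IH] gi; apply: IH.
apply: contrapT => gn; apply: u0n; apply: (nakayama_module hR fM) => u {u0}.
have [|w wE] := ex i [ffun=> u].
  by apply/ffunP => k; exfalso; move: k; rewrite gi => -[].
have k : 'I_(mg P i.+1) by case: (mg P i.+1) gn => // k _; exact: ord0.
exists (mg P i), (fun l => md P i k l), w; split=> //.
by have /ffunP/(_ k) := wE; rewrite !ffunE.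
Qed.
End Local.

Lemma mg_gorenstein : (exists u : M, u <> 0) -> mg P 1 = 0%N -> id_finite M -> gorenstein R.
Proof.
move=> [u0 u0n] g1 [d /id_le_idim hd].
have inj : forall u, rvcomb (mx P) u = 0 -> u = 0.
  move=> u /mx_rel[w <-]; suff -> : w = 0 by rewrite mul0mx.
  by apply/rowP => k; exfalso; move: k; rewrite g1 => -[].
have g0 : (0 < mg P 0)%N.
  rewrite lt0n; apply/eqP => g0; apply: u0n; have [u <-] := mx_gen P u0.
  by rewrite rvcombE big1 // => j; exfalso; move: j; rewrite g0 => -[].
pose j := Ordinal g0.
have pl a (u v : 'rV[R]_(mg P 0)) : ((a *: u + v) 0 j : R^o) = a *: (u 0 j : R^o) + (v 0 j : R^o).
  by rewrite !mxE.
have [r rE] : exists r : {linear M -> R^o}, forall u, r (rvcomb (mx P) u) = u 0 j.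
  apply: (surj_inv_lin (h := mklin (h := fun u : 'rV[R]_(mg P 0) => u 0 j : R^o) pl) (@mx_gen _ _ P)) => u /inj -> /=.
  by rewrite mxE.
have sl a (u v : R^o) : (a *: u + v) *: mx P j = a *: (u *: mx P j) + v *: mx P j.
  by rewrite scalerDl scalerA.
exists d; apply: idim_id_le; apply: (idim_retract (s := mklin sl) (r := r)) hd => a /=.
by rewrite -rvcomb_delta -linearZ_LR rE !mxE !eqxx mulr1.
Qed.
End BaseChange.

Lemma homothety_nonzero (A : comNzRingType) (V : lmodType A) :
  homothety_iso V -> exists u : V, u <> 0.
Proof.
move=> h; apply: contrapT => /forallNP V0; have {}V0 u : u = 0 :> V by apply: contrapT.
have [a [_ au]] := h idfun; have := oner_neq0 A; rewrite -(au 1) ?(au 0) ?eqxx // => u.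
  by rewrite [LHS]V0 [RHS]V0.
by rewrite [LHS]V0 [RHS]V0.
Qed.

(** * Flat dimension and exact zero-divisors *)

Section TensorLeft.
Context (R : comNzRingType).
Implicit Types K F D L G W : lmodType R.
Local Notation "K ** W" := (tens (idfun : {rmorphism R -> R}) K W) (at level 40).
Local Notation tp := (tpair (idfun : {rmorphism R -> R})).
Local Notation tm := (tens_map (idfun : {rmorphism R -> R})).

Fact swap_balanced K W : balanced idfun (fun (k : K) (w : W) => tp w k).
Proof.
split=> [k k' w|k w w'|s k w|r k w].
- exact: tpairDr.
- exact: tpairDl.
- exact: tpairZr.
- by rewrite tpairZr tpairZl.
Qed.

Definition tswap K W : {linear K ** W -> W ** K} := tens_lift (@swap_balanced K W).

Lemma tswapE K W k w : tswap K W (tp k w) = tp w k.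
Proof. exact: tens_liftE. Qed.

Lemma tswapK K W t : tswap W K (tswap K W t) = t.
Proof.
elim/tens_ind: t => [|k w|u v hu hv]; first by rewrite !linear0.
  by rewrite !tswapE.
by rewrite !linearD hu hv.
Qed.

Fact tmapl_balanced W K F (g : {linear K -> F}) :
  balanced idfun (fun (k : K) (w : W) => tp (g k) w).
Proof.
split=> [k k' w|k w w'|s k w|r k w].
- by rewrite linearD tpairDl.
- exact: tpairDr.
- by rewrite linearZ_LR tpairZl.
- by rewrite linearZ_LR tpairZl tpairZr.
Qed.

Definition tmapl W K F (g : {linear K -> F}) : {linear K ** W -> F ** W} :=
  tens_lift (tmapl_balanced W g).

Lemma tmaplE W K F (g : {linear K -> F}) k (w : W) : tmapl W g (tp k w) = tp (g k) w.
Proof. exact: tens_liftE. Qed.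

Lemma tmapl_swap W K F (g : {linear K -> F}) t :
  tswap F W (tmapl W g t) = tm W g (tswap K W t).
Proof.
elim/tens_ind: t => [|k w|u v hu hv]; first by rewrite !linear0.
  by rewrite tmaplE !tswapE tens_mapE.
by rewrite !linearD hu hv.
Qed.

Lemma tmapl_comp W K F D (g : {linear K -> F}) (h : {linear F -> D}) (k : {linear K -> D}) t :
  (forall u, k u = h (g u)) -> tmapl W k t = tmapl W h (tmapl W g t).
Proof.
move=> kE; rewrite -[LHS]tswapK -[RHS]tswapK !tmapl_swap.
by congr (tswap _ _ _); exact: tens_map_comp.
Qed.

Lemma tmapl_surj W K F (g : {linear K -> F}) : surj g -> surj (tmapl W g).
Proof.
move=> sg t; have [u uE] := @tens_surj _ _ idfun W _ _ g sg (tswap F W t).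
exists (tswap W K u); rewrite -[LHS]tswapK tmapl_swap [tswap K W _]tswapK uE.
exact: tswapK.
Qed.

Lemma tmapl_exact W K F D (a : {linear K -> F}) (b : {linear F -> D}) :
  exact_at a b -> surj b -> exact_at (tmapl W a) (tmapl W b).
Proof.
move=> ex sb t; have e := @tens_exact _ _ idfun W _ _ _ a b ex sb (tswap F W t).
split=> [t0|[u <-]].
  have /e[u uE] : tm W b (tswap F W t) = 0 by rewrite -tmapl_swap t0 linear0.
  exists (tswap W K u); rewrite -[LHS]tswapK tmapl_swap [tswap K W _]tswapK uE.
  exact: tswapK.
rewrite -(tmapl_comp (k := \0)) => [|k]; last by apply/esym/ex; exists k.
elim/tens_ind: u => [|k w|u v hu hv]; first exact: linear0.
  by rewrite tmaplE -[X in tp X _](scale0r (0 : D)) tpairZl scale0r.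
by rewrite linearD hu hv addr0.
Qed.

Lemma tmaplC K F L G (g : {linear K -> F}) (h : {linear L -> G}) t :
  tmapl G g (tm K h t) = tm F h (tmapl L g t).
Proof.
elim/tens_ind: t => [|k w|u v hu hv]; first by rewrite !linear0.
  by rewrite !(tmaplE, tens_mapE).
by rewrite !linearD hu hv.
Qed.

(** Tensoring with [R^n] is taking [n]-tuples, by the coordinate maps [e], and [g] acts
    coordinatewise. *)
Lemma tmapl_rV_inj K F n (g : {linear K -> F}) :
  injective g -> injective (tmapl ('rV[R]_n : lmodType R) g).
Proof.
move=> ig; pose G : lmodType R := 'rV[R]_n.
have bal (M : lmodType R) j : balanced idfun (fun (k : M) (u : G) => u 0 j *: k).
  split=> [k k' u|k u u'|s k u|r k u].
  - exact: scalerDr.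
  - by rewrite mxE scalerDl.
  - by rewrite !scalerA mulrC.
  - by rewrite !mxE !scalerA mulrC.
pose e M j : {linear M ** G -> M} := tens_lift (bal M j).
have eE M j k u : e M j (tp k u) = u 0 j *: k by exact: tens_liftE.
have recon M (t : M ** G) : t = \sum_j tp (e M j t) (delta_mx 0 j : G).
  elim/tens_ind: t => [|k w|u v hu hv].
  - rewrite big1 // => j _; rewrite linear0 -[X in tp X _](scale0r (0 : M)).
    by rewrite tpairZl scale0r.
  - rewrite [in LHS](row_sum_delta w) tpair_sum; apply: eq_bigr => j _.
    by rewrite eE tpairZr tpairZl.
  - rewrite [in LHS]hu [in LHS]hv -big_split; apply: eq_bigr => j _.
    by rewrite linearD tpairDl.
have nat j t : e F j (tmapl G g t) = g (e K j t).
  elim/tens_ind: t => [|k w|u v hu hv]; first by rewrite !linear0.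
    by rewrite tmaplE !eE linearZ_LR.
  by rewrite !linearD hu hv.
apply: lin_inj => t t0; rewrite (recon _ t) big1 // => j _.
have -> : e K j t = 0 by apply: (inj_lin0 ig); rewrite -nat t0 linear0.
by rewrite -(scale0r (0 : K)) tpairZl scale0r.
Qed.

Definition ses K F D (a : {linear K -> F}) (b : {linear F -> D}) :=
  [/\ injective a, surj b & exact_at a b].

Section Balance.
Context (K F D : lmodType R) (a : {linear K -> F}) (b : {linear F -> D}) (hab : ses a b).
Context (L G W : lmodType R) (i : {linear L -> G}) (p : {linear G -> W}) (hip : ses i p).
Context (aG : injective (tmapl G a)).

(** A snake-type chase in the diagram of tensor products. For flat [F] and free [G], both
    [ker(D (x) L -> D (x) G)] and [ker(K (x) W -> F (x) W)] are [Tor_1(D, W)], computed in one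
    variable or the other. *)
Lemma tor1_balance_r : injective (tm D i) -> injective (tmapl W a).
Proof.
have [ia sb exab] := hab; have [ii sp exip] := hip.
have Eb := @tmapl_exact L _ _ _ a b exab sb.
have Ebg := @tmapl_exact G _ _ _ a b exab sb.
have Ep := @tens_exact _ _ idfun F _ _ _ i p exip sp.
have Epk := @tens_exact _ _ idfun K _ _ _ i p exip sp.
move=> Di; apply: lin_inj => t t0.
have [u uE] := @tens_surj _ _ idfun K _ _ p sp t.
have /Ep[v vE] : tm F p (tmapl G a u) = 0 by rewrite -tmaplC uE.
have bv : tmapl L b v = 0.
  by apply: (inj_lin0 Di); rewrite -tmaplC vE; apply/Ebg; exists u.
have [w wE] := (Eb v).1 bv.
have uw : u = tm K i w by apply: aG; rewrite tmaplC wE vE.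
by rewrite -uE; apply/Epk; exists w.
Qed.

Lemma tor1_balance_l : flat F -> injective (tmapl W a) -> injective (tm D i).
Proof.
have [ia sb exab] := hab; have [ii sp exip] := hip.
have Eb := @tmapl_exact L _ _ _ a b exab sb.
have Ebg := @tmapl_exact G _ _ _ a b exab sb.
have Ep := @tens_exact _ _ idfun F _ _ _ i p exip sp.
have Epk := @tens_exact _ _ idfun K _ _ _ i p exip sp.
move=> fF aW; apply: lin_inj => t t0.
have [v vE] := @tmapl_surj L _ _ b sb t.
have /Ebg[u uE] : tmapl G b (tm F i v) = 0 by rewrite tmaplC vE.
have pu : tm K p u = 0.
  by apply: (inj_lin0 aW); rewrite tmaplC uE; apply/Ep; exists v.
have [w wE] := (Epk u).1 pu.
have vw : v = tmapl L a w by apply: (fF _ _ _ ii); rewrite -tmaplC wE uE.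
by rewrite -vE; apply/Eb; exists w.
Qed.
End Balance.

(** [torv j D W]: the vanishing of [Tor_(j+1)(D, W)]. *)
Fixpoint torv j D W : Prop :=
  forall n (L : lmodType R) (i : {linear L -> 'rV[R]_n}) (p : {linear 'rV[R]_n -> W}),
    ses i p -> if j is j'.+1 then torv j' D L else injective (tm D i).

(** Dimension shift in the first variable, [Tor_(j+2)(D, W) = Tor_(j+1)(K, W)]. As [torv] recurses
    on the second variable, only the lowest case needs an argument, by the balance of [Tor_1]. *)
Lemma torv_shift K F D W (a : {linear K -> F}) (b : {linear F -> D}) j :
  ses a b -> flat F -> torv j K W -> torv j.+1 D W.
Proof.
move=> hab fF; elim: j W => [|j IH] W hK n L i p hip; last first.
  by apply: IH; exact: (hK n L i p).
move=> n' L' i' p' hip'; apply: (tor1_balance_l hab hip' fF).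
have aG := @tmapl_rV_inj K F n a (let: And3 h _ _ := hab in h).
apply: lin_inj => t t0; apply: (inj_lin0 (hK _ _ _ _ hip)); apply: (inj_lin0 aG).
by rewrite tmaplC t0 linear0.
Qed.

Lemma ses_finite n L W (i : {linear L -> 'rV[R]_n}) (p : {linear 'rV[R]_n -> W}) :
  noetherian R -> ses i p -> finite_module L.
Proof.
move=> nR [ii _ _].
have [k [x [xZ xg]]] := noetherian_sub nR (finite_rV R n) (submodule_range i).
have [y yE] := choice (fun j => let: ex_intro2 u _ e := xZ j in ex_intro (fun u => i u = x j) u e).
apply/finite_moduleP; exists k, y => v.
have [|c cE] := xg (i v); first by exists v.
exists c; apply: ii; apply/eqP; rewrite -subr_eq0 linear_sum -[X in _ == X]cE; apply/eqP.
by congr (_ - _); apply: eq_bigr => j _; rewrite linearZ_LR yE.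
Qed.

Lemma ses_exists W : finite_module W ->
  exists n (L : lmodType R) (i : {linear L -> 'rV[R]_n}) (p : {linear 'rV[R]_n -> W}), ses i p.
Proof.
move=> /finite_moduleP[n [x xg]].
pose p := rvcomb [ffun j => x j]; have hk := submodule_ker p.
exists n, (submod hk), (submod_in hk), p; split.
- exact: submod_in_inj.
- move=> w; have [c ->] := xg w; exists (\row_j c j).
  by rewrite rvcombE; apply: eq_bigr => j _; rewrite mxE ffunE.
- move=> u; split=> [/(submod_onto hk)//|[v <-]]; exact: (submod_inP v).
Qed.

(** [torv] quantifies over presentations, so using the hypothesis requires a finite presentation of
    the syzygy [L]; this is where noetherianity and finiteness enter. *)
Lemma torv_unshift K F D W (a : {linear K -> F}) (b : {linear F -> D}) j :
  noetherian R -> finite_module W -> ses a b -> flat F -> torv j.+1 D W -> torv j K W.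
Proof.
move=> nR fW hab fF; elim: j W fW => [|j IH] W fW hD n L i p hip; last first.
  by apply: IH; [exact: ses_finite hip | exact: (hD n L i p)].
have [n' [L' [i' [p' hip']]]] := ses_exists (ses_finite nR hip).
have [ia _ _] := hab; have [ii _ _] := hip.
have aL := tor1_balance_r hab hip' (@tmapl_rV_inj K F n' a ia) (hD _ _ _ _ hip _ _ _ _ hip').
change (injective (tm K i)); apply: lin_inj => t t0; apply: (inj_lin0 aL); apply: (inj_lin0 (fF _ _ _ ii)).
by rewrite -tmaplC t0 linear0.
Qed.

(** Induction on the number [n] of possibly nonzero terms, splitting off the first one by
    [torv_shift]; with no terms left [D] is 0. *)
Lemma torv_fd n D (P : resolution (@flat R) D) :
  (forall i, (n <= i)%N -> forall u : P i, u = 0) ->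
  forall j W, (n <= j)%N -> torv j D W.
Proof.
elim: n D P => [|n IH] D [t d a hf sa ex0 ex] /= van j W nj.
  have D0 (x : D) : x = 0 by have [y <-] := sa x; have -> : y = 0 := van 0%N isT y; exact: linear0.
  have T0 L (s : D ** L) : s = 0.
    elim/tens_ind: s => [//|k w|u v -> ->]; last exact: addr0.
    by rewrite (D0 k) -(scale0r (0 : D)) tpairZl scale0r.
  elim: j W {nj} => [|j IHj] W k L i p hip; last exact: IHj.
  by move=> u v _; rewrite [u]T0 [v]T0.
case: j nj => [//|j] nj; pose Z := range (d 0%N); have hZ : submodule Z by exact: submodule_range.
have [q qE] := @submod_corestrict _ _ _ hZ _ (d 0%N) (fun u => ex_intro2 _ _ u I erefl).
have hs : ses (submod_in hZ) a.
  split=> //; first exact: submod_in_inj.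
  move=> v; rewrite ex0; split=> [[u <-]|[u <-]].
    by apply: submod_onto; exists u.
  by have [w _ <-] := submod_inP u; exists w.
have sq : surj q.
  move=> v; have [u _ e] := submod_inP v; exists u.
  by apply: submod_in_inj; rewrite qE.
have exq : exact_at (d 1%N) q.
  move=> v; rewrite -(ex 0%N) -(qE v); split=> [->|]; first exact: linear0.
  exact: (inj_lin0 (@submod_in_inj _ _ _ hZ)).
apply: (torv_shift hs (hf 0%N)).
exact: (IH _ (@Resolution _ _ _ (fun i => t i.+1) (fun i => d i.+1) q
  (fun i => hf i.+1) sq exq (fun i => ex i.+1)) (fun i => van i.+1)).
Qed.
End TensorLeft.

Section RestrictScalars.
Context (R S : comNzRingType) (f : {rmorphism R -> S}) (U V : lmodType S) (h : {linear U -> V}).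

Fact restr_map_linear a (u v : restr f U) :
  (h (a *: u + v : restr f U) : restr f V) = a *: (h u : restr f V) + (h v : restr f V).
Proof. exact: (linearP h (f a) u v). Qed.

Definition restr_map : {linear restr f U -> restr f V} :=
  mklin (h := fun u : restr f U => h u : restr f V) restr_map_linear.
End RestrictScalars.

(** * Two-periodic Tor of a pair of exact zero-divisors *)

Section ExactZeroDivisors.
Context (R S : comNzRingType) (f : {rmorphism R -> S}) (hflat : flat (restr f S^o)).
Context (nR : noetherian R) (W : lmodType R) (fW : finite_module W).
Local Notation mp z := (@modpi S S^o [set z]).
Local Notation quo z := (restr f (@modquot S S^o [set z])).
Local Notation annihilates y x := (forall s : S, x * s = 0 <-> exists t, y * t = s).

Lemma span1 (z s : S) : @span S S^o [set z] s <-> exists t, z * t = s.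
Proof.
split=> [|[t <-]].
  elim=> [|a u v -> _ [t <-]]; first by exists 0; rewrite mulr0.
  by exists (a + t); rewrite mulrDr mulrC.
by rewrite mulrC; apply: (submodZ (submodule_span _)); apply: span_sub.
Qed.

(** Multiplication by [x] on [S] has kernel [yS] and cokernel [S/xS], whence
    [0 -> S/yS -> S -> S/xS -> 0], taken over [R]. *)
Lemma mul_ses (x y : S) : annihilates y x ->
  exists c : {linear quo y -> restr f S^o},
    [/\ forall s, c (mp y s) = x * s & ses c (restr_map f (mp x))].
Proof.
move=> yx.
have ml a (u v : S^o) : (x * (a *: u + v) : S^o) = a *: (x * u : S^o) + (x * v : S^o).
  by rewrite mulrDr; congr (_ + _); exact: mulrCA.
pose mu : {linear S^o -> S^o} := mklin ml.
have mu0 (v : (S^o : lmodType S)) : ([set y] : set S^o) v -> mu v = 0 by move=> ->; apply/yx; exists 1; rewrite mulr1.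
exists (restr_map f (@modlift S S^o [set y] S^o mu mu0)).
have cE s := @modliftE S S^o [set y] S^o mu mu0 s.
split=> [s|]; first exact: cE.
split.
- apply: lin_inj => u; have [s <-] := modpi_surj u => e.
  have e' : x * s = 0 by rewrite -[RHS]e; apply/esym; exact: cE.
  by rewrite -[RHS](linear0 (mp y)); apply/modpi_eq; rewrite subr0 span1; apply/yx.
- exact: modpi_surj.
- move=> s; split=> [e|[u <-]].
    have : mp x s = mp x 0 by rewrite linear0.
    move/modpi_eq; rewrite subr0 span1 => -[t <-].
    by exists (mp y t); exact: cE.
  have [t <-] := modpi_surj u.
  rewrite -[RHS](linear0 (mp x)); apply/modpi_eq; rewrite subr0 span1.
  by exists t; apply/esym; exact: cE.
Qed.

(** As [S] is flat, the two sequences of [mul_ses] shift Tor of [S/xS] to Tor of [S/yS] and back, so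
    the descent from beyond the flat dimension carries both. *)
Lemma torv_zero_divisors (x y : S) : annihilates y x -> annihilates x y ->
  fd_finite (quo x) -> torv 0 (quo x) W /\ torv 0 (quo y) W.
Proof.
move=> yx xy [k [P van]].
have [c [_ hc]] := mul_ses yx; have [c' [_ hc']] := mul_ses xy.
have hx j : (k < j)%N -> torv j (quo x) W by exact: (torv_fd (P := P) van).
have : torv k.+1 (quo x) W /\ torv k.+1 (quo y) W.
  split; first exact: hx.
  by apply: (torv_unshift nR fW hc hflat); apply: hx.
elim: k.+1 => [//|j IH] [h1 h2]; apply: IH; split.
  exact: (torv_unshift nR fW hc' hflat).
exact: (torv_unshift nR fW hc hflat).
Qed.

(** Multiplication by [x] factors as [S -> S/yS -> S]. Since [Tor_1(S/xS, W) = 0], the second map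
    stays injective after tensoring, so an element killed by [x] dies in [S/yS (x) W] and is a
    multiple of [y]. *)
Lemma torv_mul_exact (x y : S) : annihilates y x -> torv 0 (quo x) W ->
  exact_at (homothety (tens f S^o W) y) (homothety (tens f S^o W) x).
Proof.
move=> yx tx u; rewrite /homothety /=.
have xy0 : x * y = 0 by apply/yx; exists 1; rewrite mulr1.
split=> [u0|[v <-]]; last by rewrite scalerA xy0 scale0r.
have [c [cE hc]] := mul_ses yx.
have [n [L [i [p hip]]]] := ses_exists fW.
have [ic _ _] := hc.
have cW := tor1_balance_r hc hip (tmapl_rV_inj ic) (tx _ _ _ _ hip).
pose T := tens_tensR f S^o W.
pose mu z : {linear restr f S^o -> restr f S^o} := restr_map f (homothety S^o z).
have muE z (v : tens f S^o W) : tmapl W (mu z) (T v) = T (z *: v).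
  elim/tens_ind: v => [|s w|v v' hv hv'].
  - by rewrite scaler0 !linear0; exact: erefl.
  - by rewrite -tpairZl !tens_tensRE; exact: tmaplE.
  - by rewrite scalerDr !linearD -hv -hv'; exact: erefl.
pose q : {linear restr f S^o -> quo y} := restr_map f (mp y).
have q0 : tmapl W q (T u) = 0.
  apply: (inj_lin0 cW); rewrite -(tmapl_comp (k := mu x)); last by move=> s; rewrite cE.
  by rewrite muE u0 linear0.
have exq : exact_at (mu y) q.
  move=> s; split=> [e|[t <-]].
    have : mp y s = mp y 0 by rewrite linear0.
    by move/modpi_eq; rewrite subr0 span1 => -[t <-]; exists t.
  rewrite -[RHS](linear0 (mp y)); apply/modpi_eq; rewrite subr0 span1.
  by exists t.
have sq : surj q by exact: modpi_surj.
have /(tmapl_exact exq sq)[t tE] := q0.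
have [v vE] := tens_tensR_surj t.
by exists v; apply: tens_tensR_inj; rewrite -tE -vE; apply/esym; exact: muE.
Qed.

Lemma tens_zero_divisors (n : set S) (hS : local_ring n) (x y : S) :
  exact_zero_divisors (S^o : lmodType S) x y -> fd_finite (quo x) ->
  finite_module (tens f S^o W) -> (exists u : tens f S^o W, u <> 0) ->
  exact_zero_divisors (tens f S^o W) x y.
Proof.
move=> [[s0 s0n] [s1 s1n] xy yx] fd fN [w wn].
have {}yx : annihilates y x by exact: yx.
have {}xy : annihilates x y by exact: xy.
have [tx ty] := torv_zero_divisors yx xy fd.
have ex1 := torv_mul_exact xy ty; have ex2 := torv_mul_exact yx tx.
have nak z : n z -> ~ (forall u : tens f S^o W, exists v, z *: v = u).
  move=> nz h; apply: wn; apply: (nakayama_module hS fN) => u.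
  have [v vE] := h u; exists 1%N, (fun=> z), (fun=> v); split=> //.
  by rewrite big_ord1.
have nx : n x.
  apply: contrapT => /(local_unit hS)[b bx]; apply: (s1n (b * s1)).
  by rewrite -[LHS]/(x * (b * s1)) mulrCA mulrA bx mul1r.
(* A unit [y] would force [x = 0], because [x * y = 0]. *)
have ny : n y.
  apply: contrapT => /(local_unit hS)[b by1]; apply: s0n.
  have -> : x = 0 by rewrite -[x]mul1r -by1 mulrAC -mulrA mulrC (yx y).2 ?mul0r //; exists 1; rewrite mulr1.
  by rewrite scale0r.
split=> //.
(* If [x] killed the module, exactness would make [y] surjective on it, against Nakayama. *)
- apply: contrapT => /forallNP x0; apply: (nak y ny) => u.
  by apply/ex2; apply: contrapT; exact: x0.
- apply: contrapT => /forallNP xs; apply: (nak x nx) => u.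
  by have /existsNP[v /contrapT vE] := xs u; exists v.
Qed.
End ExactZeroDivisors.

(** * Two computations of Ext of a cyclic module *)

Section Subquotients.
Context (A : comNzRingType).
Implicit Types V W : lmodType A.

(** An isomorphism [Z / B -> Z' / B'] of subquotients, as a linear relation. *)
Definition sqiso V W (Z B : set V) (Z' B' : set W) := exists rel : V -> W -> Prop,
  [/\ rel 0 0,
      forall a u v u' v', rel u u' -> rel v v' -> rel (a *: u + v) (a *: u' + v'),
      forall z, Z z -> exists z', Z' z' /\ rel z z',
      forall z', Z' z' -> exists z, Z z /\ rel z z' &
      forall z z', Z z -> Z' z' -> rel z z' -> (B z <-> B' z')].

Lemma sqiso_refl V (Z B : set V) : sqiso Z B Z B.
Proof.
exists eq; split=> //; first by move=> a u v u' v' -> ->.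
- by move=> z hz; exists z.
- by move=> z hz; exists z.
- by move=> z z' _ _ ->.
Qed.

Lemma sqiso_trans V1 V2 V3 (Z1 B1 : set V1) (Z2 B2 : set V2) (Z3 B3 : set V3) :
  submodule Z2 -> sqiso Z1 B1 Z2 B2 -> sqiso Z2 B2 Z3 B3 -> sqiso Z1 B1 Z3 B3.
Proof.
move=> h2 [r [r0 rl rt rs rb]] [q [q0 ql qt qs qb]].
exists (fun u w => exists v, [/\ Z2 v, r u v & q v w]); split.
- by exists 0; split=> //; exact: submod0.
- move=> a u v u' v' [x [zx rx qx]] [y [zy ry qy]]; exists (a *: x + y).
  by split; [exact: h2.2 | exact: rl | exact: ql].
- by move=> z /rt[y [zy ry]]; have [w [zw qw]] := qt y zy; exists w; split=> //; exists y.
- by move=> z /qs[y [zy ry]]; have [w [zw qw]] := rs y zy; exists w; split=> //; exists y.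
- move=> z z' hz hz' [y [zy ry qy]]; rewrite (rb z y) //; exact: qb.
Qed.

Lemma sqiso_ext V W (Z B C : set V) (Z' B' C' : set W) :
  (forall z, Z z -> (C z <-> B z)) -> (forall z, Z' z -> (C' z <-> B' z)) ->
  sqiso Z B Z' B' -> sqiso Z C Z' C'.
Proof.
move=> h h' [r [r0 rl rt rs rb]]; exists r; split=> // z z' hz hz' rz.
by rewrite h // h' //; exact: rb.
Qed.

Section Transport.
Context V W (Z B : set V) (Z' B' : set W) (hZ : submodule Z) (hZ' : submodule Z').
Context (iso : sqiso Z B Z' B').

(** The linear relation extends to combinations, so besides generation the exact set of relations
    modulo boundaries is carried over; freeness of a cohomology module needs the latter. *)
Lemma sqiso_generators n (x' : 'I_n -> W) : generates_mod Z' B' x' ->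
  exists x : 'I_n -> V, generates_mod Z B x /\
    forall c, B (\sum_j c j *: x j) <-> B' (\sum_j c j *: x' j).
Proof.
move=> [x'Z xg]; have [rel [r0 rl rt rs rb]] := iso.
have [x hx] := choice (fun j => rs _ (x'Z j)).
have comb (c : 'I_n -> A) : rel (\sum_j c j *: x j) (\sum_j c j *: x' j).
  apply: (big_ind2 rel) => // [u u' v v' h h'|j _]; last first.
    by have := rl (c j) _ _ _ _ (hx j).2 r0; rewrite !addr0.
  by have := rl 1 _ _ _ _ h h'; rewrite !scale1r.
have xZ j : Z (x j) by case: (hx j).
exists x; split=> [|c]; last by apply: rb => //; exact: submod_comb.
split=> // z zZ; have [z' [z'Z rz]] := rt z zZ; have [c cE] := xg z' z'Z.
exists c; rewrite (rb _ (z' - \sum_j c j *: x' j)) //.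
- by apply: submodB => //; exact: submod_comb.
- by apply: submodB => //; exact: submod_comb.
- by have := rl (-1) _ _ _ _ (comb c) rz; rewrite !scaleN1r ![- _ + _]addrC.
Qed.

Lemma sqiso_zero : Z `<=` B -> Z' `<=` B'.
Proof.
move=> ZB z' hz'; have [rel [r0 rl rt rs rb]] := iso.
by have [z [hz rz]] := rs z' hz'; apply/(rb z) => //; exact: ZB.
Qed.

End Transport.

Lemma sqiso_sym V W (Z B : set V) (Z' B' : set W) : sqiso Z B Z' B' -> sqiso Z' B' Z B.
Proof.
move=> [r [r0 rl rt rs rb]]; exists (fun u v => r v u); split=> //.
- by move=> a u v u' v'; exact: rl.
- by move=> z z' hz hz' rz; split=> /rb; apply.
Qed.
End Subquotients.

(** * Balancing cohomology along the staircase of a double complex *)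

Section DoubleComplex.
Context (A : comNzRingType) (K : nat -> nat -> lmodType A).
Context (dh : forall a b, {linear K a b -> K a.+1 b}) (dv : forall a b, {linear K a b -> K a b.+1}).
Context (dC : forall a b u, dh a b.+1 (dv a b u) = dv a.+1 b (dh a b u)).
Context (exh : forall a b, exact_at (dh a b) (dh a.+1 b)).
Context (exv : forall a b, exact_at (dv a b) (dv a b.+1)).

(** For [a = 0], [dz] modulo [dbv] is the vertical cohomology of the kernel of [dh]; for [b = 0],
    [dz] modulo [dbh] is the horizontal cohomology of the kernel of [dv]. *)
Definition dz a b : set (K a b) := [set v | dh a b v = 0 /\ dv a b v = 0].
Definition dbv a b : set (K a b) :=
  match b return set (K a b) with
  | 0 => [set 0]
  | b'.+1 => [set v | exists w, dh a b' w = 0 /\ dv a b' w = v]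
  end.
Definition dbh a b : set (K a b) :=
  match a return set (K a b) with
  | 0 => [set 0]
  | a'.+1 => [set v | exists w, dv a' b w = 0 /\ dh a' b w = v]
  end.

Lemma submodule_dz a b : submodule (@dz a b).
Proof.
split=> [|c u v [hu vu] [hv vv]]; first by split; exact: linear0.
by split; rewrite linearP ?hu ?hv ?vu ?vv scaler0 addr0.
Qed.

Lemma dbhv a b v : @dbh a.+1 b.+1 v <-> @dbv a.+1 b.+1 v.
Proof.
split=> -[w [w0 <-]] /=.
  have [u <-] := (exv w).1 w0; exists (dh a b u); split; last by rewrite dC.
  by apply/exh; exists u.
have [u <-] := (exh w).1 w0; exists (dv a b u); split; last by rewrite dC.
by apply/exv; exists u.
Qed.

(** The zigzag: [w] links [dv w] to [dh w]. Two choices of [w] with the same [dv w] differ by an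
    element of the kernel of [dv], which changes [dh w] by an element of [dbh]. *)
Lemma dz_step a b : sqiso (@dz a b.+1) (@dbv a b.+1) (@dz a.+1 b) (@dbh a.+1 b).
Proof.
exists (fun v v' => exists w, dv a b w = v /\ dh a b w = v'); split.
- by exists 0; rewrite !linear0.
- move=> c _ _ _ _ [u [<- <-]] [v [<- <-]]; exists (c *: u + v).
  by rewrite !linearP.
- move=> v [hv vv]; have [w wE] := (exv v).1 vv; exists (dh a b w); split.
    by split; [apply/exh; exists w | rewrite -dC wE hv].
  by exists w.
- move=> v [hv vv]; have [w wE] := (exh v).1 hv; exists (dv a b w); split.
    by split; [rewrite dC wE vv | apply/exv; exists w].
  by exists w.
- move=> _ _ _ _ [w [<- <-]]; split=> -[u [u0 uE]] /=.
    by exists (w - u); rewrite !linearB /= u0 uE subrr subr0.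
  by exists (w - u); rewrite !linearB /= u0 uE subrr subr0.
Qed.

Lemma dz_balance i : sqiso (@dz 0 i) (@dbv 0 i) (@dz i 0) (@dbh i 0).
Proof.
(* [dz_step] starts from [dbv] and lands in [dbh]; [U] is the boundary needed at the next start, and
   [dbh] at the end [b = 0] of the staircase. *)
pose U a b : set (K a b) := if b is _.+1 then @dbv a b else @dbh a b.
suff main b : forall a, (a + b)%N = i -> sqiso (@dz a b) (U a b) (@dz i 0) (@dbh i 0).
  have := main i 0%N (add0n i); apply: sqiso_ext => z _ //.
  by rewrite /U; case: i main z.
elim: b => [|b IH] a e; first by move: e; rewrite addn0 => <-; exact: sqiso_refl.
have s1 := @dz_step a b; have s2 := IH a.+1 (etrans (addSnnS a b) e).
apply: sqiso_trans (submodule_dz a.+1 b) s1 _.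
apply: sqiso_ext s2 => z _ //.
by rewrite /U; case: b z {IH e} => [//|b] z; exact: dbhv.
Qed.
End DoubleComplex.

Section CyclicExt.
Context (A : comNzRingType) (M : lmodType A) (E : coresolution (@injective_module A) M).

(** [Hom(A/I, E i)] is the part of [E i] killed by [I], so [kz] modulo [kb] is [Ext^i(A/I, M)];
    boundaries must come from elements that [I] already kills. *)
Definition kz (I : set A) i : set (E i) :=
  [set e | (forall a, I a -> a *: e = 0) /\ cdiff E i e = 0].
Definition kb (I : set A) i : set (E i) :=
  match i return set (E i) with
  | 0 => [set 0]
  | j.+1 => [set e | exists w : E j, (forall a, I a -> a *: w = 0) /\ cdiff E j w = e]
  end.

Lemma cterm_inj i : injective_module (E i).
Proof. by case: E => t d a h1 h2 h3 h4; exact: h1. Qed.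
Lemma cdiff_exact i : exact_at (cdiff E i) (cdiff E i.+1).
Proof. by case: E => t d a h1 h2 h3 h4; exact: (h4 i). Qed.
Lemma caug_exact : exact_at (caug E) (cdiff E 0).
Proof. by case: E. Qed.
Lemma caug_inj : injective (caug E).
Proof. by case: E. Qed.
Lemma cdiff_dd i e : cdiff E i.+1 (cdiff E i e) = 0.
Proof. by apply/cdiff_exact; exists e. Qed.

Lemma submodule_kz I i : submodule (@kz I i).
Proof.
split=> [|c u v [hu du] [hv dv]].
  by split; [move=> a _; rewrite scaler0 | exact: linear0].
split=> [a Ia|]; last by rewrite linearP du dv scaler0 addr0.
by rewrite scalerDr scalerA mulrC -scalerA hu // hv // scaler0 addr0.
Qed.

Lemma submodule_kb I i : submodule (@kb I i).
Proof.
case: i => [|i]; first exact: submodule_set0.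
split; first by exists 0; split; [move=> a _; rewrite scaler0 | exact: linear0].
move=> c _ _ [u [hu <-]] [v [hv <-]]; exists (c *: u + v); split; last exact: linearP.
by move=> a Ia; rewrite scalerDr scalerA mulrC -scalerA hu // hv // scaler0 addr0.
Qed.

Lemma kb_kz I i : @kb I i `<=` @kz I i.
Proof.
case: i => [|i] e /=.
  by move=> ->; split; [move=> a _; rewrite scaler0 | exact: linear0].
move=> [w [Iw <-]]; split; last exact: cdiff_dd.
by move=> a Ia; rewrite -linearZ_LR Iw // linear0.
Qed.

Context (T : lmodType A) (P : mxresol T).

Definition mz (W : lmodType A) i : set {ffun 'I_(mg P i) -> W} :=
  [set v | mxact (md P i) v = 0].
Definition mb (W : lmodType A) i : set {ffun 'I_(mg P i) -> W} :=
  match i return set {ffun 'I_(mg P i) -> W} with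
  | 0 => [set 0]
  | j.+1 => range (mxact (md P j))
  end.

Lemma submodule_mz W i : submodule (@mz W i).
Proof. exact: submodule_ker. Qed.

Lemma submodule_mb W i : submodule (@mb W i).
Proof. by case: i => [|i]; [exact: submodule_set0 | exact: submodule_range]. Qed.

Lemma mxact_dd (W : lmodType A) i (v : {ffun 'I_(mg P i) -> W}) :
  mxact (md P i.+1) (mxact (md P i) v) = 0.
Proof.
apply: rvcomb_inj => u; rewrite -!rvcomb_mulmx -mulmxA md_dd mulmx0 rvcomb0.
exact: linear0.
Qed.

Lemma injective_mxexact (W : lmodType A) i : injective_module W -> mxexact P W i.
Proof.
move=> injW v v0.
have [|g gE] := injective_factor (h := rowmul (md P i)) (k := rvcomb v) injW.
  by move=> u /(@md_ex _ _ P)[w <-]; rewrite rvcomb_mulmx v0 rvcomb0.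
exists [ffun j => g (delta_mx 0 j)].
by apply: rvcomb_inj => u; rewrite -rvcomb_mulmx -rvcomb_eta -gE.
Qed.

Fact ffmap_linear (W W' : lmodType A) n (h : {linear W -> W'}) a (u v : {ffun 'I_n -> W}) :
  [ffun j => h ((a *: u + v) j)] = a *: [ffun j => h (u j)] + [ffun j => h (v j)]
    :> {ffun 'I_n -> W'}.
Proof. by apply/ffunP => j; rewrite !ffunE linearP. Qed.

Definition ffmap (W W' : lmodType A) n (h : {linear W -> W'}) :
  {linear {ffun 'I_n -> W} -> {ffun 'I_n -> W'}} := mklin (@ffmap_linear W W' n h).

Lemma ffmap_mxact (W W' : lmodType A) (h : {linear W -> W'}) p q (B : 'M[A]_(p, q)) u :
  mxact B (ffmap q h u) = ffmap p h (mxact B u).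
Proof.
apply/ffunP => k; rewrite !ffunE linear_sum; apply: eq_bigr => l _.
by rewrite ffunE linearZ_LR.
Qed.

Lemma ffmap_exact (W W' W'' : lmodType A) n (h : {linear W -> W'}) (g : {linear W' -> W''}) :
  exact_at h g -> exact_at (ffmap n h) (ffmap n g).
Proof.
move=> ex v; split=> [v0|[u <-]]; last first.
  by apply/ffunP => j; rewrite !ffunE; apply/ex; exists (u j).
have hv j : exists u, h u = v j.
  by apply/ex; have /ffunP/(_ j) := v0; rewrite !ffunE.
have [u uE] := choice hv.
by exists [ffun j => u j]; apply/ffunP => j; rewrite !ffunE.
Qed.

Context (j0 : 'I_(mg P 0)) (j0P : forall j, j = j0).
Local Notation I := [set a | a *: mx P j0 = 0].

(** With a single generator, the entries of [md P 0] generate its annihilator. *)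
Lemma cyclic_rel (W : lmodType A) (v : {ffun 'I_(mg P 0) -> W}) :
  mxact (md P 0) v = 0 <-> forall a, a *: mx P j0 = 0 -> a *: v j0 = 0.
Proof.
split=> [v0 a ax|Iv].
  have [|w wE] := (@mx_rel _ _ P (a *: delta_mx 0 j0)).1.
    by rewrite linearZ_LR rvcomb_delta.
  by rewrite -rvcomb_delta -linearZ_LR -wE rvcomb_mulmx v0 rvcomb0.
apply/ffunP => k; rewrite mxactE [RHS]ffunE (bigD1 j0) //= [X in _ + X]big1 ?addr0; last first.
  by move=> j; rewrite (j0P j) eqxx.
apply: Iv; have : rvcomb (mx P) (delta_mx 0 k *m md P 0) = 0.
  by apply/mx_rel; exists (delta_mx 0 k).
rewrite rvcombE -rowE (bigD1 j0) //= [X in _ + X]big1 ?addr0 ?mxE //.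
by move=> j; rewrite (j0P j) eqxx.
Qed.

Lemma ffun_j0 (W : lmodType A) (v : {ffun 'I_(mg P 0) -> W}) : v = [ffun=> v j0].
Proof. by apply/ffunP => j; rewrite ffunE (j0P j). Qed.

(** Both sides compute [Ext^i(T, M)] for the cyclic module [T] with annihilator
    [I]: from [E] on the left, from the free resolution [P] on the right. *)
Lemma cyclic_balance i : sqiso (@kz I i) (@kb I i) (@mz M i) (@mb M i).
Proof.
(* The double complex [Hom(P a, E b)]; its two edges are the complexes to be compared. *)
pose K a b : lmodType A := {ffun 'I_(mg P a) -> E b}.
pose dh a b : {linear K a b -> K a.+1 b} := mxact (md P a).
pose dv a b : {linear K a b -> K a b.+1} := ffmap (mg P a) (cdiff E b).
have dC a b u : dh a b.+1 (dv a b u) = dv a.+1 b (dh a b u) by exact: ffmap_mxact.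
have exh a b : exact_at (dh a b) (dh a.+1 b).
  move=> v; split=> [v0|[u <-]]; last exact: mxact_dd.
  by have [w ->] := injective_mxexact (@cterm_inj b) v0; exists w.
have exv a b : exact_at (dv a b) (dv a b.+1) by exact: ffmap_exact (@cdiff_exact b).
have bal := dz_balance dC exh exv i.
have dvE a b u j : dv a b u j = cdiff E b (u j) by rewrite ffunE.
refine (sqiso_trans (submodule_dz dh dv 0 i) _
  (sqiso_trans (submodule_dz dh dv i 0) bal _)).
  (* Edge [a = 0]: a tuple over the single generator is killed by [dh] exactly when its entry is
     killed by [I]. *)
  exists (fun e v => v = [ffun=> e]); split.
  - by apply/ffunP => j; rewrite !ffunE.
  - by move=> a u v _ _ -> ->; apply/ffunP => j; rewrite !ffunE.
  - move=> e [Ie de]; exists [ffun=> e]; split=> //; split.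
      by apply/cyclic_rel => a; rewrite ffunE; exact: Ie.
    by apply/ffunP => j; rewrite dvE !ffunE.
  - move=> v [/cyclic_rel Iv dv0]; exists (v j0); split; last exact: ffun_j0.
    by split=> //; rewrite -dvE dv0 ffunE.
  - move=> e _ _ _ ->; case: i {bal} e => [|i] e /=.
      split=> [->|/ffunP/(_ j0)]; first by apply/ffunP => j; rewrite !ffunE.
      by rewrite !ffunE.
    split=> [[w [Iw <-]]|[w [/cyclic_rel Iw wE]]].
      exists [ffun=> w]; split; last by apply/ffunP => j; rewrite dvE !ffunE.
      by apply/cyclic_rel => a; rewrite ffunE; exact: Iw.
    by exists (w j0); split=> //; have /ffunP/(_ j0) := wE; rewrite !ffunE.
(* Edge [b = 0]: tuples in [E 0] killed by the differential come from tuples in [M]. *)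
pose au n := ffmap n (caug E).
have auE n v : dv n 0 v = 0 <-> exists u, au (mg P n) u = v.
  exact: ffmap_exact caug_exact v.
have aui n : injective (au n).
  move=> u v /ffunP e; apply/ffunP => j; apply: caug_inj.
  by have := e j; rewrite !ffunE.
exists (fun v u => v = au _ u); split.
- by rewrite linear0.
- by move=> a u v u' v' -> ->; rewrite linearP.
- move=> v [hv /auE[u uE]]; exists u; split=> //.
  by apply: aui; rewrite -ffmap_mxact linear0 -[RHS]hv -uE.
- move=> u hu; exists (au _ u); split=> //; split; last by apply/auE; exists u.
  by rewrite [LHS]ffmap_mxact hu linear0.
- move=> _ u _ _ ->; case: i {bal} u => [|i] u.
    by rewrite /=; split=> [|->]; [exact: (inj_lin0 (@aui _)) | apply/ffunP => j; rewrite !ffunE linear0].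
  split=> [[w [/auE[w' <-] wE]]|[w _ <-]].
    by exists w' => //; apply: aui; rewrite -wE -ffmap_mxact.
  exists (au _ w); split; first by apply/auE; exists w.
  exact: ffmap_mxact.
Qed.
End CyclicExt.

(** * Nonvanishing of Ext of the residue field *)

Lemma finite_ffun (A : comNzRingType) (V : lmodType A) n :
  finite_module V -> finite_module ({ffun 'I_n -> V} : lmodType A).
Proof.
move=> /finite_moduleP[q [x xg]].
pose e j l : {ffun 'I_n -> V} := [ffun k => if k == j then x l else 0].
exists [seq e j l | j <- enum 'I_n, l <- enum 'I_q] => v.
have [c cE] := choice (fun j => xg (v j)).
have -> : v = \sum_j \sum_l c j l *: e j l.
  apply/ffunP => k; rewrite sum_ffunE (bigD1 k) //= [X in _ + X]big1 ?addr0; last first.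
    move=> j jk; rewrite sum_ffunE big1 // => l _.
    by rewrite !ffunE eq_sym (negPf jk) scaler0.
  by rewrite sum_ffunE {1}cE; apply: eq_bigr => l _; rewrite !ffunE eqxx.
apply: (submod_sum (submodule_span _)) => j _; apply: (submod_comb (submodule_span _)) => l.
by apply: span_sub => /=; apply/allpairsP; exists (j, l); rewrite !mem_enum.
Qed.

Section ExtOverLocal.
Context (A : comNzRingType) (m : set A) (hm : local_ring m).

Lemma cyclic_res (I : set A) : is_ideal I ->
  exists (T : lmodType A) (P : mxresol T) (j0 : 'I_(mg P 0)),
    (forall j, j = j0) /\ [set a | a *: mx P j0 = 0] = I.
Proof.
move=> hI; pose T := @modquot A A^o I; have hI' := ideal_submodule hI.
have xg : surj (rvcomb [ffun _ : 'I_1 => @modpi A A^o I 1]).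
  move=> t; have [a <-] := modpi_surj t; exists (\row_j a).
  by rewrite rvcombE big_ord1 ffunE mxE -linearZ_LR -[a *: 1]/(a * 1) mulr1.
exists T, (free_res hm xg), ord0; split=> [j|]; first exact: ord1.
apply/seteqP; split=> a /=; rewrite ffunE -linearZ_LR -[a *: 1]/(a * 1) mulr1.
  by move/(modpi_eq0 hI').
by move=> Ia; apply/(modpi_eq0 hI').
Qed.

Context (M : lmodType A) (fM : finite_module M) (E : coresolution (@injective_module A) M).

(** Finiteness of [Ext^i(A/I, M)] is not visible on injective modules; it is transported from a
    finite free resolution of [A/I]. *)
Lemma kz_fg (I : set A) i : is_ideal I -> fg_mod (@kz _ _ E I i) (@kb _ _ E I i).
Proof.
move=> /cyclic_res[T [P [j0 [j0P <-]]]].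
have fgZ : fg_mod (@mz _ _ P M i) (@mb _ _ P M i).
  apply: (@fg_mod_le _ _ _ [set 0]); first by move=> _ ->; exact: submod0 (submodule_mb _ _ _).
  exact: noetherian_sub (local_noeth hm) (finite_ffun _ fM) (submodule_mz _ _ _).
have [n [x' hx']] := fgZ.
have [x [hx _]] := sqiso_generators (submodule_kz E _ i) (submodule_mz P M i)
  (cyclic_balance E j0P i) hx'.
by exists n, x.
Qed.

(** Multiplication by [a] embeds [A/(I : a)] in [A/I]. The map sending 1 to [w] on the former
    extends to the latter by injectivity, and [w'] is the image of 1. *)
Lemma injective_colon (W : lmodType A) (I : set A) a (w : W) : injective_module W -> is_ideal I ->
  (forall b, I (b * a) -> b *: w = 0) ->
  exists w', (forall b, I b -> b *: w' = 0) /\ a *: w' = w.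
Proof.
move=> injW hI Iw; have hI' := ideal_submodule hI.
have hl c (u v : A^o) : @modpi A A^o I ((c *: u + v : A^o) * a) =
    c *: @modpi A A^o I (u * a) + @modpi A A^o I (v * a).
  by rewrite -linearP; congr (modpi _ _); rewrite mulrDl -scalerAl.
have kl c (u v : A^o) : (c *: u + v : A^o) *: w = c *: (u *: w) + v *: w.
  by rewrite scalerDl scalerA.
have [|g gE] := injective_factor (h := mklin hl) (k := mklin kl) injW.
  by move=> b /(modpi_eq0 hI'); exact: Iw.
exists (g (@modpi A A^o I 1)); split=> [b Ib|].
  rewrite -linearZ_LR; have -> : b *: @modpi A A^o I 1 = 0; last exact: linear0.
  by rewrite -linearZ_LR -[b *: 1]/(b * 1) mulr1; apply/(modpi_eq0 hI').
rewrite -linearZ_LR -[RHS]scale1r; have /= <- := gE 1; congr (g _).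
by rewrite -linearZ_LR mul1r -[a *: 1]/(a * 1) mulr1.
Qed.

(** Among the ideals with some nonzero [Ext^i(A/I, M)] a maximal one must be [m]. Otherwise take [a]
    in [m] outside [I] and use [0 -> A/(I : a) -> A/I -> A/(I + aA) -> 0], whose last term has no
    Ext in any degree by maximality. *)
Lemma ext_nonzero : (exists u : M, u <> 0) ->
  exists i z, @kz _ _ E m i z /\ ~ @kb _ _ E m i z.
Proof.
move=> [u0 u0n].
pose NZ (I : set A) := exists i z, @kz _ _ E I i z /\ ~ @kb _ _ E I i z.
have [||I [hI [i [z [zI zB]]] Imax]] := @noetherian_max A NZ [set 0] (local_noeth hm).
- by split=> // a u v -> ->; rewrite mulr0 addr0.
- exists 0%N, (caug E u0); split; last by move=> /(inj_lin0 (@caug_inj _ _ E)).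
  by split; [move=> a ->; rewrite scale0r | apply/caug_exact; exists u0].
have I1 : ~ I 1.
  move=> I1; apply: zB; have -> : z = 0 by rewrite -[z]scale1r zI.1.
  exact: submod0 (submodule_kb E I i).
have Im := local_sub hm hI I1.
suff mI : m `<=` I by exists i, z; have -> : m = I by apply/seteqP.
move=> a ma; apply: contrapT => Ia; apply: zB.
have maxP J : is_ideal J -> I `<=` J -> (exists b, J b /\ ~ I b) ->
    forall i z, @kz _ _ E J i z -> @kb _ _ E J i z.
  move=> hJ IJ [b [Jb Ib]] i' z' hz'; apply: contrapT => nz'.
  by apply: Ib; apply: (Imax J) => //; exists i', z'.
pose Ia' : set A := [set b | exists c d, I d /\ b = c * a + d].
have hIa : is_ideal Ia'.
  split; first by exists 0, 0; split; [case: hI | rewrite mul0r addr0].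
  move=> b _ _ [c [d [Id ->]]] [c' [d' [Id' ->]]]; exists (b * c + c'), (b * d + d').
  by split; [exact: hI.2 | rewrite mulrDr mulrDl addrACA mulrA].
have IIa : I `<=` Ia' by move=> b Ib; exists 0, b; rewrite mul0r add0r.
have Iaa : Ia' a by exists 1, 0; split; [case: hI | rewrite mul1r addr0].
have zIa := maxP _ hIa IIa (ex_intro _ a (conj Iaa Ia)).
have kIa (W : lmodType A) (w : W) : (forall b, I b -> b *: w = 0) -> a *: w = 0 ->
    forall b, Ia' b -> b *: w = 0.
  by move=> Iw aw b [c [d [Id ->]]]; rewrite scalerDl -scalerA aw (Iw d) // scaler0 addr0.
pose Ic : set A := [set b | I (b * a)].
have hIc : is_ideal Ic.
  split; first by rewrite /Ic /= mul0r; case: hI.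
  by move=> b c d Ic1 Id1; rewrite /Ic /= mulrDl -mulrA; exact: hI.2.
have IIc : I `<=` Ic.
  by move=> b Ib; rewrite /Ic /= mulrC; exact: (submodZ (ideal_submodule hI)).
(* If [I : a] exceeds [I], its Ext vanishes too: [a *: z] is a boundary, and subtracting a suitable
   boundary from [z] leaves a cocycle killed by [I + aA]. *)
have [[b [Icb Ib]]|nc] := pselect (exists b, Ic b /\ ~ I b).
  have zIc := maxP _ hIc IIc (ex_intro _ b (conj Icb Ib)).
  have az : @kz _ _ E Ic i (a *: z).
    split; last by rewrite linearZ_LR zI.2 scaler0.
    by move=> c Icc; rewrite scalerA zI.1.
  have := zIc _ _ az; case: i z zI {az} => [|i] z zI.
    by move=> /= az; apply: (zIa 0%N); split; [exact: kIa zI.1 az | exact: zI.2].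
  move=> [w [Icw wE]].
  have [w' [Iw' aw']] := injective_colon (@cterm_inj _ _ E i) hI Icw.
  have [|u [Iu uE]] := zIa i.+1 (z - cdiff E i w').
    split; last by rewrite linearB /= zI.2 cdiff_dd subr0.
    apply: kIa; last by rewrite scalerBr -linearZ_LR aw' wE subrr.
    by move=> c Ic1; rewrite scalerBr zI.1 // -linearZ_LR Iw' // linear0 subr0.
  exists (u + w'); split; last by rewrite linearD /= uE subrK.
  by move=> c Ic1; rewrite scalerDr Iw' // Iu ?addr0 //; exact: IIa.
(* Now [I : a] equals [I]. Vanishing over [I + aA] lets every cocycle be divided by [a] within the
   cocycles, so Nakayama makes [z] a boundary. *)
have cI b : I (b * a) -> I b.
  by move=> Iba; apply: contrapT => Ib; apply: nc; exists b.
apply: (nakayama hm (submodule_kb E I i) ma (kz_fg i hI) _ zI) => y [Iy dy].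
have [w [Iw aw]] := injective_colon (@cterm_inj _ _ E i) hI (fun b h => Iy b (cI b h)).
have [|u [Iu uE]] := zIa i.+1 (cdiff E i w).
  split; last exact: cdiff_dd.
  apply: kIa; last by rewrite -linearZ_LR aw dy.
  by move=> b Ib; rewrite -linearZ_LR Iw // linear0.
exists (w - u); split; last by rewrite scalerBr aw (Iu a) // subr0.
split; last by rewrite linearB /= uE subrr.
by move=> b Ib; rewrite scalerBr Iw // Iu ?subr0 //; exact: IIa.
Qed.
End ExtOverLocal.

(** * The closed fibre *)

Section QuotientModules.
Context (S Q : comNzRingType) (pi : {rmorphism S -> Q}) (spi : surj pi).

Section Structure.
Context (V : lmodType S) (kV : forall a, pi a = 0 -> forall v : V, a *: v = 0).

(** The [Q]-module structure on an [S]-module killed by the kernel of [S -> Q]. *)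
Definition qmod_type : Type := V.
HB.instance Definition _ := GRing.Zmodule.on qmod_type.

Definition qmod_scale (q : Q) (v : qmod_type) : qmod_type :=
  sval (cid (spi q)) *: (v : V).

Lemma qmod_scaleE s (v : V) : qmod_scale (pi s) v = s *: v.
Proof.
rewrite /qmod_scale; case: cid => t /= tE; apply/eqP; rewrite -subr_eq0 -scalerBl.
by rewrite kV // rmorphB /= tE subrr.
Qed.

Fact qmod_scaleA (a b : Q) (v : qmod_type) :
  qmod_scale a (qmod_scale b v) = qmod_scale (a * b) v.
Proof.
have [s <-] := spi a; have [t <-] := spi b.
by rewrite -rmorphM !qmod_scaleE scalerA.
Qed.

Fact qmod_scale1 : left_id 1 qmod_scale.
Proof. by move=> v; rewrite -(rmorph1 pi) qmod_scaleE scale1r. Qed.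

Fact qmod_scaleDr : right_distributive qmod_scale +%R.
Proof. by move=> a u v; exact: scalerDr. Qed.

Fact qmod_scaleDl (v : qmod_type) : {morph (fun a : Q => qmod_scale a v) : a b / a + b}.
Proof.
move=> a b /=; have [s <-] := spi a; have [t <-] := spi b.
by rewrite -rmorphD !qmod_scaleE; exact: scalerDl.
Qed.

HB.instance Definition _ := GRing.Zmodule_isLmodule.Build Q qmod_type
  qmod_scaleA qmod_scale1 qmod_scaleDr qmod_scaleDl.

Definition qmod : lmodType Q := qmod_type.

Lemma qmodE s (v : qmod) : pi s *: v = (s *: (v : V) : qmod).
Proof. exact: qmod_scaleE. Qed.

Lemma to_qmod (X : lmodType Q) (h : X -> V) :
  (forall s x y, h (pi s *: x + y) = s *: h x + h y) ->
  exists g : {linear X -> qmod}, forall x, g x = h x.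
Proof.
move=> hl; have gl a x y : (h (a *: x + y) : qmod) = a *: (h x : qmod) + (h y : qmod).
  by have [s <-] := spi a; rewrite qmodE hl.
by exists (mklin gl).
Qed.

(** The elements of [W] killed by the kernel of [pi] form [Hom_S(Q, W)]. A [Q]-map into it is
    extended over [S] into [W], and the extension lands there because its source is a [Q]-module. *)
Lemma injective_qmod (W : lmodType S) (i : {linear V -> W}) : injective_module W ->
  injective i -> (forall w, (forall a, pi a = 0 -> a *: w = 0) -> exists v, i v = w) ->
  injective_module qmod.
Proof.
move=> injW ii ir X Y j g injj.
have gl s (x y : restr pi X) : i (g (s *: x + y : restr pi X)) = s *: i (g x) + i (g y).
  by rewrite -linearP; congr (i _); rewrite (linearP g (pi s) x y) qmodE.
have [h hE] := injW _ _ (restr_map pi j) (mklin gl) injj.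
have [k kE] : exists k : {linear restr pi Y -> V}, forall y, i (k y) = h y.
  apply: (inj_inv_lin ii) => y; apply: ir => a pa; rewrite -linearZ_LR.
  have -> : a *: y = 0 by rewrite [LHS](_ : _ = pi a *: (y : Y)) // pa scale0r.
  exact: linear0.
have [l lE] : exists l : {linear Y -> qmod}, forall y, l y = k y.
  by apply: to_qmod => s x y; exact: (linearP k s x y).
by exists l => x; rewrite lE; apply: ii; rewrite kE; exact: (hE x).
Qed.
End Structure.

Lemma qmod_map (U V : lmodType S) (kU : forall a, pi a = 0 -> forall v : U, a *: v = 0)
    (kV : forall a, pi a = 0 -> forall v : V, a *: v = 0) (h : {linear U -> V}) :
  exists g : {linear qmod kU -> qmod kV}, forall u, g u = h u.
Proof. by apply: to_qmod => s x y; rewrite qmodE; exact: (linearP h s x y). Qed.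

Section Basis.
Context (V : lmodType S) (Z B : set V) (hZ : submodule Z) (hB : submodule B) (BZ : B `<=` Z).
Context (kZ : forall z, Z z -> forall a, pi a = 0 -> a *: z = 0).
Context (n : nat) (x : 'I_n -> V) (xg : generates_mod Z B x).
Context (xr : forall c : 'I_n -> S, B (\sum_j c j *: x j) -> forall j, pi (c j) = 0).

Lemma submod_killed (Y : set V) (hY : submodule Y) (YZ : Y `<=` Z) a :
  pi a = 0 -> forall v : submod hY, a *: v = 0.
Proof.
move=> pa v; apply: submod_in_inj; rewrite linearZ_LR linear0; apply: kZ => //.
by apply: YZ; exact: (submod_inP v).
Qed.

Arguments submod_killed [Y] hY YZ [a].

(** The coordinates of [z] in the basis of [Z / B] are unique up to the kernel of [pi], which kills
    [Z]; so subtracting the combination is a well-defined retraction of [Z] onto [B]. *)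
Lemma basis_split : exists r : {linear submod hZ -> submod hB},
  forall (b : submod hB) (z : submod hZ), submod_in hZ z = submod_in hB b -> r z = b.
Proof.
have ex (z : submod hZ) : exists b : submod hB, exists c : 'I_n -> S,
    submod_in hB b = submod_in hZ z - \sum_j c j *: x j.
  have [c cE] := xg.2 _ (submod_inP z); have [b bE] := submod_onto hB cE.
  by exists b, c.
have [r rE] := choice ex.
have uniq (b b' : submod hB) z c d : submod_in hB b = z - \sum_j c j *: x j ->
    submod_in hB b' = z - \sum_j d j *: x j -> b = b'.
  move=> bE bE'; apply: submod_in_inj; rewrite bE bE'; congr (_ - _).
  have : B (\sum_j (c j - d j) *: x j).
    have <- : submod_in hB (b' - b) = \sum_j (c j - d j) *: x j.
      rewrite linearB bE bE' opprB addrC subrKA -sumrB.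
      by apply: eq_bigr => j _; rewrite scalerBl.
    exact: submod_inP.
  move=> /xr cd; apply/eqP; rewrite -subr_eq0 -sumrB big1 // => j _.
  by rewrite -scalerBl kZ //; exact: xg.1.
have rl a u v : r (a *: u + v) = a *: r u + r v.
  have [[c cE] [[d dE] [e eE]]] := (rE u, (rE v, rE (a *: u + v))).
  apply: (uniq _ _ (submod_in hZ (a *: u + v)) e (fun j => a * c j + d j)) => //.
  rewrite !linearP cE dE scalerBr addrACA; congr (_ + _).
  rewrite -opprD scaler_sumr -big_split /=; congr (- _); apply: eq_bigr => j _.
  by rewrite scalerDl scalerA.
exists (mklin rl) => b z zb; have [c cE] := rE z.
apply: (uniq _ _ (submod_in hZ z) c (fun=> 0)) => //.
by rewrite zb big1 ?subr0 // => j _; rewrite scale0r.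
Qed.

(** Coordinates modulo the kernel of [pi] are well defined on [Z]; the coordinate map at [j0], split
    by a basis element, will make [Q] a summand of [Z]. *)
Lemma basis_coord (j0 : 'I_n) :
  exists (r : {linear qmod (submod_killed hZ (@subset_refl _ Z)) -> Q^o})
  (z0 : qmod (submod_killed hZ (@subset_refl _ Z))), r z0 = 1.
Proof.
have ex (z : submod hZ) : exists c : 'I_n -> S, B (submod_in hZ z - \sum_j c j *: x j).
  exact: xg.2 _ (submod_inP z).
have [c cE] := choice ex.
have uniq z d e : B (z - \sum_j d j *: x j) -> B (z - \sum_j e j *: x j) -> pi (d j0) = pi (e j0).
  move=> hd he; apply/eqP; rewrite -subr_eq0 -rmorphB /=; apply/eqP.
  apply: (xr (c := fun j => d j - e j)); have := submodB hB he hd.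
  congr (B _); rewrite opprB addrC subrKA -sumrB.
  by apply: eq_bigr => j _; rewrite scalerBl.
have rl a (u v : qmod (submod_killed hZ (@subset_refl _ Z))) :
    (pi (c (a *: u + v) j0) : Q^o) = a *: (pi (c u j0) : Q^o) + (pi (c v j0) : Q^o).
  have [s <-] := spi a; rewrite qmodE -[_ *: _ in RHS]/(_ * _) -rmorphM -rmorphD /=.
  apply: (uniq (submod_in hZ (s *: (u : submod hZ) + v)) _ (fun j => s * c u j + c v j)).
    exact: cE.
  rewrite linearP; have := hB.2 s _ _ (cE u) (cE v); congr (B _).
  rewrite scalerBr addrACA -opprD scaler_sumr -big_split /=; congr (_ - _).
  by apply: eq_bigr => j _; rewrite scalerDl scalerA.
have [z0 z0E] := submod_onto hZ (xg.1 j0).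
exists (mklin rl), z0; rewrite mklinE -(rmorph1 pi).
have -> : 1 = (j0 == j0)%:R :> S by rewrite eqxx.
apply: (uniq (submod_in hZ z0) _ (fun j => (j == j0)%:R) (cE z0)).
rewrite z0E (bigD1 j0) //= eqxx scale1r big1 ?addr0 ?subrr; first exact: submod0.
by move=> j /negPf ->; rewrite scale0r.
Qed.
End Basis.
Arguments submod_killed [V Z] kZ [Y] hY YZ [a].

(* With [J i] the part of [E i] killed by the kernel of [S -> Q], injective over
   [Q], and [Z i], [B i] its cycles and boundaries: the cohomology [Z i / B i] is
   free over [Q], so [B i] is a summand of [Z i], and the sequences
   [0 -> Z i -> J i -> B i.+1 -> 0] bound the injective dimensions downwards. *)
Lemma fibre_gorenstein (N : lmodType S) (E : coresolution (@injective_module S) N) p :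
  vanishes_above E p ->
  (forall i, exists n (x : 'I_n -> E i),
    generates_mod (@kz _ _ E [set a | pi a = 0] i) (@kb _ _ E [set a | pi a = 0] i) x /\
    forall c, @kb _ _ E [set a | pi a = 0] i (\sum_j c j *: x j) -> forall j, pi (c j) = 0) ->
  (exists i z, @kz _ _ E [set a | pi a = 0] i z /\ ~ @kb _ _ E [set a | pi a = 0] i z) ->
  gorenstein Q.
Proof.
set I := [set a | pi a = 0] => van basis [i0 [z0 [z0Z z0B]]].
have hZ i := submodule_kz E I i; have hB i := submodule_kb E I i.
have BZ i := @kb_kz _ _ E I i.
pose J i : set (E i) := [set e | forall a, I a -> a *: e = 0].
have hJ i : submodule (J i).
  split=> [a _|c u v hu hv a Ia]; first by rewrite scaler0.
  by rewrite scalerDr scalerA mulrC -scalerA hu // hv // scaler0 addr0.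
have kJ i (z : E i) : J i z -> forall a, pi a = 0 -> a *: z = 0 by move=> h; exact: h.
have kZ i z : @kz _ _ E I i z -> forall a, pi a = 0 -> a *: z = 0 by case.
pose QZ i := qmod (submod_killed (@kZ i) (hZ i) (@subset_refl _ _)).
pose QB i := qmod (submod_killed (@kZ i) (hB i) (BZ i)).
pose QJ i := qmod (submod_killed (@kJ i) (hJ i) (@subset_refl _ _)).
have injJ i : injective_module (QJ i).
  apply: (injective_qmod (i := submod_in (hJ i)) (@cterm_inj _ _ E i)).
    exact: submod_in_inj.
  by move=> w Iw; apply: submod_onto.
(* Descending induction on [i]: for [i] at least [p] the term [E i.+1] is zero, so the cycles are
   all of [J i] and are injective. *)
have dim k : forall i, (p <= i + k)%N -> exists d, idim d (QZ i).
  elim: k => [|k IH] i pik.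
    exists 0%N; apply: (injective_qmod (i := submod_in (hZ i)) (@cterm_inj _ _ E i)).
      exact: submod_in_inj.
    move=> w Iw; apply: submod_onto; split=> //; apply: (van i.+1).
    by rewrite addn0 in pik.
  have [|d hd] := IH i.+1; first by rewrite addSnnS.
  have hdB : idim d (QB i.+1).
    have [n [x [xg xr]]] := basis i.+1.
    have [r rE] := basis_split (hZ i.+1) (hB i.+1) (@kZ i.+1) xg xr.
    have [s sE] := @submod_corestrict _ _ _ (hZ i.+1) _ (submod_in (hB i.+1))
      (fun b => BZ i.+1 _ (submod_inP b)).
    have [r' r'E] := qmod_map (submod_killed (@kZ i.+1) (hZ i.+1) (@subset_refl _ _))
       (submod_killed (@kZ i.+1) (hB i.+1) (BZ i.+1)) r.
    have [s' s'E] := qmod_map (submod_killed (@kZ i.+1) (hB i.+1) (BZ i.+1))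
       (submod_killed (@kZ i.+1) (hZ i.+1) (@subset_refl _ _)) s.
    apply: (idim_retract (s := s') (r := r')) hd => b.
    by rewrite r'E s'E; apply: rE; exact: sE.
  exists d.+1.
  have [zj zjE] := @submod_corestrict _ _ _ (hJ i) _ (submod_in (hZ i))
    (fun z => (submod_inP z).1).
  have [jb jbE] := @submod_corestrict _ _ _ (hB i.+1) _ (cdiff E i \o submod_in (hJ i))
    (fun e => ex_intro _ _ (conj (submod_inP e) erefl)).
  have [zj' zj'E] := qmod_map (submod_killed (@kZ i) (hZ i) (@subset_refl _ _))
    (submod_killed (@kJ i) (hJ i) (@subset_refl _ _)) zj.
  have [jb' jb'E] := qmod_map (submod_killed (@kJ i) (hJ i) (@subset_refl _ _))
    (submod_killed (@kZ i.+1) (hB i.+1) (BZ i.+1)) jb.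
  exists (QJ i), (QB i.+1), zj', jb'; split=> //.
  - move=> u v; rewrite !zj'E => e; apply: (@submod_in_inj _ _ _ (hZ i)).
    by rewrite -!zjE; congr (submod_in (hJ i) _).
  - move=> b; have [w [Iw wE]] := submod_inP (b : submod (hB i.+1)).
    have [e eE] := submod_onto (hJ i) Iw; exists e; rewrite jb'E.
    by apply: (@submod_in_inj _ _ _ (hB i.+1)); rewrite jbE -[LHS]/(cdiff E i (submod_in (hJ i) e)) eE.
  - move=> v; rewrite jb'E; split=> [e|[u <-]].
      have [|u uE] := submod_onto (hZ i) (v := submod_in (hJ i) v).
        split; first exact: (submod_inP (v : submod (hJ i))).
        by rewrite -[LHS]/((cdiff E i \o submod_in (hJ i)) v) -jbE [X in submod_in _ X]e; exact: linear0.
      by exists u; rewrite zj'E; apply: (@submod_in_inj _ _ _ (hJ i)); rewrite zjE.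
    rewrite zj'E; apply: (@submod_in_inj _ _ _ (hB i.+1)); rewrite jbE.
    rewrite -[LHS]/(cdiff E i (submod_in (hJ i) (zj u))) zjE.
    rewrite [RHS](linear0 (submod_in (hB i.+1))); exact: (submod_inP (u : submod (hZ i))).2.
have [|d hd] := dim p i0; first exact: leq_addl.
have [n [x [xg xr]]] := basis i0.
(* Nonzero cohomology forces the basis to be nonempty. *)
have [j0 _] : exists j0 : 'I_n, True.
  case: n x xg {xr} => [|n] x xg; last by exists ord0.
  by have [c] := xg.2 _ z0Z; rewrite big_ord0 subr0 => /z0B.
have [r [z1 rz1]] := basis_coord (hZ i0) (hB i0) (@kZ i0) xg xr j0.
have sl a (u v : Q^o) : (a *: u + v) *: z1 = a *: (u *: z1) + v *: z1.
  by rewrite scalerDl scalerA.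
exists d; apply: idim_id_le; apply: (idim_retract (s := mklin sl) (r := r)) hd => a.
by rewrite mklinE linearZ_LR rz1 -[_ *: _]/(_ * _) mulr1.
Qed.
End QuotientModules.

(** * Base change of a basis of cohomology *)

Section BaseChangeBasis.
Context (R S : comNzRingType) (f : {rmorphism R -> S}) (hflat : flat (restr f S^o)).
Context (T : lmodType R) (P : mxresol T) (W : lmodType R).
Local Notation P' := (bc_mxresol hflat P).
Local Notation N := (tens f S^o W).

Definition fftens n (w : {ffun 'I_n -> W}) : {ffun 'I_n -> N} :=
  [ffun l => tpair f (1 : S^o) (w l)].

Lemma fftensZ n a (w : {ffun 'I_n -> W}) : fftens (a *: w) = f a *: fftens w.
Proof. by apply/ffunP => l; rewrite !ffunE tpairZr. Qed.

Lemma fftensB n (w w' : {ffun 'I_n -> W}) : fftens (w - w') = fftens w - fftens w'.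
Proof. by apply/ffunP => l; rewrite !ffunE tpairB. Qed.

Lemma fftens_sum n (J : finType) (w : J -> {ffun 'I_n -> W}) :
  fftens (\sum_j w j) = \sum_j fftens (w j).
Proof.
apply/ffunP => l; rewrite ffunE !sum_ffunE tpair_sum.
by apply: eq_bigr => j _; rewrite ffunE.
Qed.

Lemma mb_fftens i w : @mb _ _ P W i w -> @mb _ _ P' N i (fftens w).
Proof.
case: i w => [|i] w; first by move=> ->; apply/ffunP => l; rewrite !ffunE tpair0.
by move=> [u _ <-]; exists (fftens u) => //; exact: mxact_tpair1.
Qed.

(** The relations of the generator are generated by the entries of [md P' 0], which are images of
    elements of the old annihilator. *)
Lemma bc_annihilator (j0 : 'I_(mg P 0)) (j0P : forall j, j = j0) :
  [set a | a *: mx P' j0 = 0] = ideal_gen (f @` [set a | a *: mx P j0 = 0]).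
Proof.
apply/seteqP; split=> a /=.
  move=> a0; have [|w wE] := (@mx_rel _ _ P' (a *: delta_mx 0 j0)).1.
    by rewrite linearZ_LR rvcomb_delta.
  have <- : (w *m md P' 0) 0 j0 = a by rewrite wE !mxE !eqxx mulr1.
  rewrite mxE; apply: (submod_sum (submodule_span (_ : set S^o))) => k _.
  apply: (submodZ (submodule_span (_ : set S^o))); apply: span_sub.
  exists (md P 0 k j0); last by rewrite /= mxE.
  have : rvcomb (mx P) (delta_mx 0 k *m md P 0) = 0.
    by apply/mx_rel; exists (delta_mx 0 k).
  rewrite rvcombE -rowE (bigD1 j0) //= [X in _ + X]big1 ?addr0 ?mxE //.
  by move=> j; rewrite (j0P j) eqxx.
elim=> [|b u v [r /= r0 <-] _ IH]; first by rewrite scale0r.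
rewrite scalerDl IH addr0 -[b *: (f r : S^o)]/(b * f r) -scalerA ffunE -tpairZr r0 tpair0.
exact: scaler0.
Qed.

(** Being a cocycle and being a relation modulo coboundaries are both linear systems over [R], so
    flatness reduces them to solutions over [R], where the coefficients of relations lie in [m]. *)
Lemma bc_basis (m : set R) i n (xi : 'I_n -> {ffun 'I_(mg P i) -> W}) :
  generates_mod (@mz _ _ P W i) (@mb _ _ P W i) xi ->
  (forall c : 'I_n -> R, @mb _ _ P W i (\sum_j c j *: xi j) -> forall j, m (c j)) ->
  generates_mod (@mz _ _ P' N i) (@mb _ _ P' N i) (fun j => fftens (xi j)) /\
  forall c : 'I_n -> S, @mb _ _ P' N i (\sum_j c j *: fftens (xi j)) ->
    forall j, ideal_gen (f @` m) (c j).
Proof.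
move=> [xZ xg] xr; have hB := submodule_mb P' N i.
split; [split=> [j|z]|].
- apply: (etrans (mxact_tpair1 f (md P i) (xi j))); rewrite (xZ j).
  by apply/ffunP => k; rewrite !ffunE tpair0.
- move=> /(flat_mxact_ker hflat)[d [s [w [w0 ->]]]].
  have [c cE] := choice (fun k => xg (w k) (w0 k)).
  exists (fun j => \sum_k s k * f (c k j)).
  have -> : \sum_k s k *: fftens (w k) - \sum_j (\sum_k s k * f (c k j)) *: fftens (xi j) =
      \sum_k s k *: fftens (w k - \sum_j c k j *: xi j).
    rewrite (eq_bigr (fun j => \sum_k (s k * f (c k j)) *: fftens (xi j))); last first.
      by move=> j _; rewrite scaler_suml.
    rewrite exchange_big -sumrB; apply: eq_bigr => k _ /=.
    rewrite fftensB scalerBr fftens_sum scaler_sumr; congr (_ - _).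
    by apply: eq_bigr => j _; rewrite fftensZ scalerA.
  by apply: (submod_comb hB) => k; exact: mb_fftens.
- move=> c cB.
  suff [d [s [r [cE rB]]]] : exists d (s : 'I_d -> S) (r : 'I_d -> 'I_n -> R),
      (forall j, c j = \sum_k s k * f (r k j)) /\
      forall k, @mb _ _ P W i (\sum_j r k j *: xi j).
    move=> j; rewrite cE; apply: (submod_sum (submodule_span (_ : set S^o))) => k _.
    apply: (submodZ (submodule_span (_ : set S^o))); apply: span_sub.
    by exists (r k j) => //; exact: xr.
  (* In degree 0 only zero is a coboundary; higher up, a preimage [v] of the coboundary joins the
     system, with a sign, as a tuple of module unknowns. *)
  case: i xi xZ xg xr hB cB => [|i] xi xZ xg xr hB cB.
    have [|d [s [r [w [hr cE _]]]]] := @flat_solutions _ _ f W hflat n 0 (mg P 0)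
      (fun j k => xi j k) (fun _ _ => 0) c (fun _ => 0).
      have cB0 : \sum_j c j *: fftens (xi j) = 0 := cB.
      move=> k; rewrite big_ord0 addr0.
      transitivity ((\sum_j c j *: fftens (xi j)) k); last by rewrite cB0 ffunE.
      by rewrite sum_ffunE; apply: eq_bigr => j _; rewrite !ffunE.
    exists d, s, r; split=> // k; apply/ffunP => l.
    have := hr k l; rewrite big_ord0 addr0 => e; rewrite sum_ffunE [RHS]ffunE -[RHS]e.
    by apply: eq_bigr => j _; rewrite !ffunE.
  have [v _ vE] := cB.
  have [|d [s [r [w [hr cE _]]]]] := @flat_solutions _ _ f W hflat n (mg P i) (mg P i.+1)
    (fun j k => xi j k) (md P i) c (fun l => - v l).
    move=> k; have /ffunP/(_ k) := vE; rewrite sum_ffunE ffunE => e.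
    apply/eqP; rewrite addr_eq0 -sumrN; apply/eqP.
    transitivity (\sum_j (c j *: fftens (xi j)) k).
      by apply: eq_bigr => j _; rewrite !ffunE.
    by rewrite -[LHS]e; apply: eq_bigr => l _; rewrite mxE scalerN opprK.
  exists d, s, r; split=> // k; exists [ffun l => - w k l] => //.
  apply/ffunP => l; have := hr k l => /eqP; rewrite addr_eq0 => /eqP e.
  rewrite sum_ffunE ffunE.
  transitivity (\sum_j r k j *: xi j l); last by apply: eq_bigr => j _; rewrite !ffunE.
  rewrite e -sumrN; apply: eq_bigr => l' _.
  by rewrite ffunE scalerN.
Qed.
End BaseChangeBasis.

Section ClosedFibreProjection.
Local Open Scope quotient_scope.

Lemma closed_fibre_proj (R S : comNzRingType) (m : set R) (n : set S) (f : {rmorphism R -> S})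
    (hS : local_ring n) (hf : forall a, m a -> n (f a)) :
  exists pi : {rmorphism S -> closed_fibre hS hf},
    surj pi /\ forall s, pi s = 0 <-> ideal_gen (f @` m) s.
Proof.
rewrite /closed_fibre; match goal with
  | |- context [@Quotient.quot ?V ?I] => pose J := I; pose Q := @Quotient.quot V J
end.
exists (\pi_Q : {rmorphism S -> Q}); split=> [q|s].
  by exists (repr (q : Q)); exact: reprK.
have e := @Quotient.idealrBE _ J s 0; rewrite subr0 in e.
have -> : ideal_gen (f @` m) s <-> s \in J by split=> [|/asboolP //]; move/asboolP.
rewrite e; split=> [h|/eqP h]; last by rewrite [LHS]h; exact: raddf0.
by apply/eqP; rewrite [LHS]h; apply/esym; exact: raddf0.
Qed.

End ClosedFibreProjection.

Section FlatLocal.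
Context (R S : comNzRingType) (m : set R) (hR : local_ring m) (n : set S) (hS : local_ring n).
Context (f : {rmorphism R -> S}) (hflat : flat (restr f S^o)).
Context (hf : forall a, m a -> n (f a)) (M : lmodType R).

(* [Ext_S^i(S/mS, S (x) M)] is the base change of [Ext_R^i(R/m, M)], hence free
   over the closed fibre, and nonzero for some [i]. *)
Lemma base_change_injective_dim : finite_module M -> (exists u : M, u <> 0) ->
  id_finite M -> id_finite (tens f S^o M) -> gorenstein (closed_fibre hS hf).
Proof.
move=> fM M0 [p [E _]] [p' [E' van]].
have hm := local_ideal hR.
have [T [P [j0 [j0P ann]]]] := cyclic_res hR hm.
have [pi [spi kpi]] := closed_fibre_proj hS hf.
have ann' : [set a | a *: mx (bc_mxresol hflat P) j0 = 0] = [set s | pi s = 0].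
  by rewrite bc_annihilator // ann; apply/seteqP; split=> s /kpi.
have basis i : exists k (xi : 'I_k -> {ffun 'I_(mg P i) -> M}),
    generates_mod (@mz _ _ P M i) (@mb _ _ P M i) xi /\
    forall c : 'I_k -> R, @mb _ _ P M i (\sum_j c j *: xi j) -> forall j, m (c j).
  apply: (minimal_generators hR (submodule_mb P M i)).
  apply: (@fg_mod_le _ _ _ [set 0]); first by move=> _ ->; exact: submod0 (submodule_mb _ _ _).
  exact: noetherian_sub (local_noeth hR) (finite_ffun _ fM) (submodule_mz _ _ _).
have iso i := cyclic_balance E' (P := bc_mxresol hflat P) j0P i; rewrite ann' in iso.
apply: (fibre_gorenstein spi van) => [i|].
  have [k [xi [xg xr]]] := basis i.
  have [xg' xr'] := bc_basis hflat xg xr.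
  have [x [hx hxr]] := sqiso_generators (submodule_kz E' _ i) (submodule_mz _ _ i) (iso i) xg'.
  by exists k, x; split=> // c /hxr /xr' cI j; apply/kpi.
have [i [z [zZ zB]]] := ext_nonzero hR fM E M0.
(* If degree [i] over [S] had only boundaries, a basis element from [R] would satisfy a relation
   with coefficient 1, placing 1 in [mS] and so in [n]. Hence the basis is empty and the cohomology
   over [R] is zero, against the choice of [z]. *)
exists i; apply: contrapT => nz.
have isoR := cyclic_balance E (P := P) j0P i; rewrite ann in isoR.
have [k [xi [xg xr]]] := basis i.
have [xg' xr'] := bc_basis hflat xg xr.
have mZB : @mz _ _ (bc_mxresol hflat P) (tens f S^o M) i `<=` @mb _ _ (bc_mxresol hflat P) _ i.
  apply: (sqiso_zero (iso i)) => w hw; apply: contrapT => nw.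
  by apply: nz; exists w.
apply: zB; apply: (sqiso_zero (sqiso_sym isoR) _ zZ) => w /xg.2[c].
suff k0 : (k = 0)%N by rewrite big1 ?subr0 // => j; exfalso; move: j; rewrite k0 => -[].
case: k xi xg xr xg' xr' {c} => [//|k] xi xg xr xg' xr'; exfalso.
have Bx : @mb _ _ (bc_mxresol hflat P) (tens f S^o M) i
    (\sum_j (j == ord0)%:R *: fftens f (xi j)).
  rewrite (bigD1 ord0) //= scale1r big1 ?addr0 => [|j /negPf ->]; last by rewrite scale0r.
  exact/mZB/xg'.1.
have := xr' _ Bx ord0; rewrite eqxx => h1; apply: (local_proper hS).
apply: (span_min (ideal_submodule (local_ideal hS)) _ h1) => _ [r mr <-].
exact: hf.
Qed.

Lemma base_change_pd_infinite : ~ gorenstein R -> dualizing M -> ~ pd_finite (tens f S^o M).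
Proof.
move=> hRG [[fM hM eM] idM] pd; apply: hRG.
have M0 := homothety_nonzero hM.
have [P minP] := minimal_mxresol hR fM.
apply: (mg_gorenstein (P := P) M0 _ idM); apply: (mg_zero hR minP fM M0).
  by move=> i; apply/Ext_mxexact; exact: eM.
exact: (pd_finite_rank hflat hS hf minP pd).
Qed.
End FlatLocal.

Theorem proposition3p1
  (R : comNzRingType) (m : set R)
  (hR : local_ring m) (hCM : cohen_macaulay m) (hRG : ~ gorenstein R)
  (omega : lmodType R) (homega : dualizing omega)
  (S : comNzRingType) (n : set S) (hS : local_ring n)
  (f : {rmorphism R -> S})
  (hflat : flat (restr f S^o))
  (hf : forall a, m a -> n (f a))
  (hfibre : ~ gorenstein (closed_fibre hS hf))
  (x y : S)
  (hxy : exact_zero_divisors (S^o : lmodType S) x y)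
  (hfd : fd_finite (restr f (@modquot S S^o [set x]))) :
  [/\ semidualizing (tens f S^o omega),
      ~ dualizing (tens f S^o omega),
      ~ pd_finite (tens f S^o omega) &
      exact_zero_divisors (tens f S^o omega) x y].
Proof.
have [[fM hM eM] idM] := homega.
have [P _] := minimal_mxresol hR fM.
have sN : semidualizing (tens f S^o omega) := bc_semidualizing hflat P homega.1.
have [fN hN _] := sN.
split=> //.
- move=> [_ idN]; apply: hfibre.
  exact: (base_change_injective_dim hR hS hflat hf fM (homothety_nonzero hM) idM idN).
- exact: (base_change_pd_infinite hR hS hflat hf hRG homega).
- exact: (tens_zero_divisors hflat (local_noeth hR) fM hS hxy hfd fN (homothety_nonzero hN)).
Qed.
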